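(* Let $n\in\mathbb{N}$, $0<\alpha<1$ and $T>0$. For a discretization parameter $\hbar>0$, let $m\in\ell^{\infty}(\hbar\mathbb{Z}^{n})$ be non-negative and let $f\in L^{2}([0,T];\ell^{2}(\hbar\mathbb{Z}^{n}))$. Consider the Cauchy problem $$ \begin{cases} \partial_{t}^{2}u(t,k)+\hbar^{-2\alpha}(-\mathcal{L}_{\hbar})^{\alpha}u(t,k)+m(k)u(t,k)=f(t,k), & (t,k)\in(0,T]\times\hbar\mathbb{Z}^{n},\\ u(0,k)=u_{0}(k), & k\in\hbar\mathbb{Z}^{n},\\ \partial_{t}u(0,k)=u_{1}(k), & k\in\hbar\mathbb{Z}^{n}, \end{cases} $$ where $(-\mathcal{L}_{\hbar})^{\alpha}$ is the discrete fractional Laplacian on $\hbar\mathbb{Z}^n$. Then this Cauchy problem is well-posed in $\ell^{2}(\hbar\mathbb{Z}^{n})$. In particular, if $u_{0},u_{1}\in\ell^{2}(\hbar\mathbb{Z}^{n})$ and $f\in L^{2}([0,T];\ell^{2}(\hbar\mathbb{Z}^{n}))$, then there is a unique solution $u$, and $u(t),\partial_{t}u(t)\in\ell^{2}(\hbar\mathbb{Z}^{n})$ for every $t\in[0,T]$. Moreover, for each $\hbar>0$, the solution satisfies, for every $t\in[0,T]$, the estimate $$ \|u(t,\cdot)\|_{\ell^{2}(\hbar\mathbb{Z}^{n})}^{2}+\|\partial_{t}u(t,\cdot)\|_{\ell^{2}(\hbar\mathbb{Z}^{n})}^{2}\le C\left(1+\|m\|_{\ell^{\infty}(\hbar\mathbb{Z}^{n})}\right)\left[\left(\hbar^{-2\alpha}+\|m\|_{\ell^{\infty}(\hbar\mathbb{Z}^{n})}\right)\|u_{0}\|_{\ell^{2}(\hbar\mathbb{Z}^{n})}^{2}+\|u_{1}\|_{\ell^{2}(\hbar\mathbb{Z}^{n})}^{2}+\|f\|_{L^{2}([0,T];\ell^{2}(\hbar\mathbb{Z}^{n}))}^{2}\right]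 $$ for all $u_{0},u_{1}\in\ell^{2}(\hbar\mathbb{Z}^{n})$ and $f\in L^{2}([0,T];\ell^{2}(\hbar\mathbb{Z}^{n}))$, where the constant $C>0$ depends on $T$ (and on the fixed $n,\alpha$) but not on $\hbar$, $m$, $u_{0}$, $u_{1}$, $f$ or $t$.
   Context: The lattice is $\hbar\mathbb{Z}^{n}=\{x\in\mathbb{R}^{n}:x=\hbar k,\ k\in\mathbb{Z}^{n}\}$. Norms are unweighted: $\|u\|_{\ell^{2}(\hbar\mathbb{Z}^{n})}=\big(\sum_{k\in\hbar\mathbb{Z}^{n}}|u(k)|^{2}\big)^{1/2}$ and $\|u\|_{\ell^{\infty}(\hbar\mathbb{Z}^{n})}=\sup_{k\in\hbar\mathbb{Z}^{n}}|u(k)|$; also $\|f\|_{L^{2}([0,T];\ell^{2}(\hbar\mathbb{Z}^{n}))}^{2}=\int_{0}^{T}\|f(t,\cdot)\|_{\ell^{2}(\hbar\mathbb{Z}^{n})}^{2}\,dt$. The discrete fractional Laplacian on $\hbar\mathbb{Z}^{n}$, for $0<\alpha<1$, is $$(-\mathcal{L}_{\hbar})^{\alpha}u(k)=\sum_{j\in\mathbb{Z}^{n}}a_{j}^{(\alpha)}u(k+j\hbar),\qquad a_{j}^{(\alpha)}=\int_{[-\frac12,\frac12]^{n}}\Big[\sum_{i=1}^{n}4\sin^{2}(\pi\theta_{i})\Big]^{\alpha}e^{-2\pi i j\cdot\theta}\,d\theta ,$$ where in the exponential $i$ is the imaginary unit. A solution means a function $u\in C^{1}([0,T];\ell^{2}(\hbar\mathbb{Z}^{n}))$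 attaining the initial data and satisfying the equation in $\ell^{2}(\hbar\mathbb{Z}^{n})$ for almost every $t\in(0,T]$ (with $\partial_t u$ absolutely continuous in time). Functions are complex-valued, except that $m$ is real-valued and non-negative.
   Formalization: The estimate with one C for all ħ>0 fails as ħ→∞ (m=f=u_1=0, u_0 a unit mass, t=0), so it is proved for all 0<ħ≤ħ_0 with ħ_0>0 arbitrary and C depending on T, n, α and ħ_0; well-posedness is proved for every ħ>0. *)

(* Defs.v *)
From HB Require Import structures.
From mathcomp Require Import all_boot all_order all_algebra.
From mathcomp Require Import all_classical all_reals all_analysis.
From mathcomp Require Import complex.

Set Implicit Arguments.
Unset Strict Implicit.
Unset Printing Implicit Defensive.

Import Order.TTheory GRing.Theory Num.Theory.
Import numFieldNormedType.Exports.

Local Open Scope classical_set_scope.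
Local Open Scope ring_scope.
Local Open Scope complex_scope.

(* The norms take values in \bar R; they are +oo outside the space. *)
Definition l2norm {R : realType} {K : choiceType} (u : K -> R[i]) : \bar R :=
  ((\esum_(x in [set: K]) (Normc.normc (u x) ^+ 2)%:E) `^ 2^-1)%E.

Definition in_l2 {R : realType} {K : choiceType} (u : K -> R[i]) : Prop :=
  (l2norm u < +oo)%E.

Definition linfnorm {R : realType} {K : choiceType} (m : K -> R) : \bar R :=
  ereal_sup (range (fun x => `|m x|%:E)).

(* Unconditional sums of real and complex families.  The value is only        *)
(* meaningful for absolutely summable families; the families below are        *)
(* products of two square-summable ones.                                      *)
Definition rsum {R : realType} {K : choiceType} (F : K -> R) : R :=
  fine (\esum_(x in [set: K]) (Num.max (F x) 0)%:E) -
  fine (\esum_(x in [set: K]) (Num.max (- F x) 0)%:E).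

Definition csum {R : realType} {K : choiceType} (F : K -> R[i]) : R[i] :=
  rsum (fun x => complex.Re (F x)) +i* rsum (fun x => complex.Im (F x)).

(* [w] is the derivative at [t], in l^2 and relative to [0, T] (hence         *)
(* one-sided at the end points), of [u].                                      *)
Definition l2_derivative {R : realType} {K : choiceType} (T : R)
    (u : R -> K -> R[i]) (t : R) (w : K -> R[i]) : Prop :=
  l2norm (fun x => (u s x - u t x) / (s - t)%:C - w x)
    @[s --> within `[0, T] t^'] --> 0%E.

Definition l2_continuous {R : realType} {K : choiceType} (T : R)
    (u : R -> K -> R[i]) : Prop :=
  forall t : R, t \in `[0, T] ->
    l2norm (fun x => u s x - u t x) @[s --> within `[0, T] (nbhs t)] --> 0%E.

(* [u] is in C^1([0, T]; l^2) with time derivative [du]. *)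
Definition C1_l2 {R : realType} {K : choiceType} (T : R)
    (u du : R -> K -> R[i]) : Prop :=
  [/\ forall t : R, t \in `[0, T] -> in_l2 (u t) /\ in_l2 (du t),
      forall t : R, t \in `[0, T] -> l2_derivative T u t (du t)
    & l2_continuous T du].

Definition l2_absolutely_continuous {R : realType} {K : choiceType} (T : R)
    (v : R -> K -> R[i]) : Prop :=
  forall e : R, 0 < e -> exists2 d : R, 0 < d &
    forall (N : nat) (a b : 'I_N -> R),
      (forall i, 0 <= a i /\ a i <= b i /\ b i <= T) ->
      (forall i j, i != j -> b i <= a j \/ b j <= a i) ->
      \sum_(i < N) (b i - a i) < d ->
      (\sum_(i < N) l2norm (fun x => v (b i) x - v (a i) x)%R < e%:E)%E.

Definition l2_simple {R : realType} {K : choiceType}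
    (s : R -> K -> R[i]) : Prop :=
  exists (N : nat) (A : 'I_N -> set (measurableTypeR R))
         (c : 'I_N -> K -> R[i]),
    [/\ forall i, measurable (A i), forall i, in_l2 (c i)
      & forall t x, s t x = \sum_(i < N) (\1_(A i) t : R)%:C * c i x].

(* Bochner (strong) measurability on [0, T] for the Lebesgue measure. *)
Definition l2_strongly_measurable {R : realType} {K : choiceType} (T : R)
    (f : R -> K -> R[i]) : Prop :=
  exists2 s : nat -> R -> K -> R[i], forall p, l2_simple (s p) &
    {ae lebesgue_measure, forall t : measurableTypeR R, t \in `[0, T] ->
      l2norm (fun x => s p t x - f t x) @[p --> \oo] --> 0%E}.

(* The norm of L^2([0, T]; l^2). *)
Definition L2norm {R : realType} {K : choiceType} (T : R)
    (f : R -> K -> R[i]) : \bar R :=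
  ((\int[lebesgue_measure]_(t in `[0%R, T]) (l2norm (f t) ^+ 2)) `^ 2^-1)%E.

Definition in_L2 {R : realType} {K : choiceType} (T : R)
    (f : R -> K -> R[i]) : Prop :=
  [/\ forall t : R, t \in `[0, T] -> in_l2 (f t),
      l2_strongly_measurable T f & (L2norm T f < +oo)%E].

Definition lattice {R : realType} (n : nat) (h : R) : set 'rV[R]_n :=
  [set x | exists k : 'rV[int]_n, x = h *: map_mx intr k].
Arguments lattice {R} n h.

Lemma lattice_shift_subproof {R : realType} (n : nat) (h : R)
    (x : lattice n h) (j : 'rV[int]_n) :
  val x + h *: map_mx intr j \in lattice n h.
Proof.
case: x => x /= /set_mem [k ->]; apply/mem_set; exists (k + j).
by rewrite map_mxD scalerDr.
Qed.

Definition lattice_shift {R : realType} (n : nat) (h : R)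
    (x : lattice n h) (j : 'rV[int]_n) : lattice n h :=
  exist _ (val x + h *: map_mx intr j) (lattice_shift_subproof x j).

(* The n-fold product of the Lebesgue measure on R: as in product_measure1,   *)
(* the measure of a set is the integral over the first coordinate of the      *)
(* measures of its sections.                                                  *)
Fixpoint lebesgue_measure_tuple {R : realType} (n : nat) :
    set (n.-tuple (measurableTypeR R)) -> \bar R :=
  match n with
  | 0 => fun A => \d_([tuple] : 0.-tuple (measurableTypeR R)) A
  | p.+1 => fun A => (\int[lebesgue_measure]_x
      @lebesgue_measure_tuple R p
        [set y : p.-tuple _ | A [tuple of x :: y]])%E
  end.

Definition half_cube {R : realType} (n : nat) :
    set (n.-tuple (measurableTypeR R)) :=
  [set th | forall i, - 2^-1 <= tnth th i <= 2^-1].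

Definition cube_integral {R : realType} (n : nat)
    (F : n.-tuple (measurableTypeR R) -> R[i]) : R[i] :=
  fine (\int[@lebesgue_measure_tuple R n]_(th in @half_cube R n)
          (complex.Re (F th))%:E) +i*
  fine (\int[@lebesgue_measure_tuple R n]_(th in @half_cube R n)
          (complex.Im (F th))%:E).

Definition expi {R : realType} (y : R) : R[i] := cos y +i* sin y.

Definition laplacian_symbol {R : realType} (n : nat)
    (th : n.-tuple (measurableTypeR R)) : R :=
  \sum_(i < n) 4 * sin (pi * tnth th i) ^+ 2.

Definition fraclap_coef {R : realType} (n : nat) (alpha : R)
    (j : 'rV[int]_n) : R[i] :=
  cube_integral (fun th : n.-tuple (measurableTypeR R) =>
    (laplacian_symbol th `^ alpha)%:C *
    expi (- (2 * pi * \sum_(i < n) (j ord0 i)%:~R * tnth th i))).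

Definition fraclap {R : realType} (n : nat) (alpha h : R)
    (u : lattice n h -> R[i]) (x : lattice n h) : R[i] :=
  csum (fun j : 'rV[int]_n => fraclap_coef alpha j * u (lattice_shift x j)).

(* [u] is a solution on [0, T] and [du] its time derivative.  Only the values *)
(* for times in [0, T] matter.                                                *)
Definition is_solution {R : realType} (n : nat) (alpha T h : R)
    (m : lattice n h -> R) (f : R -> lattice n h -> R[i])
    (u0 u1 : lattice n h -> R[i]) (u du : R -> lattice n h -> R[i]) : Prop :=
  [/\ C1_l2 T u du,
      l2_absolutely_continuous T du,
      u 0 = u0,
      du 0 = u1
    & {ae lebesgue_measure, forall t : measurableTypeR R, t \in `]0, T] ->
        exists ddu : lattice n h -> R[i],
          [/\ in_l2 ddu, l2_derivative T du t ddu
            & forall x, ddu x + (h `^ (- (2 * alpha)))%:C * fraclap alpha (u t) x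
                        + (m x)%:C * u t x = f t x]}].

Definition existence_uniqueness {R : realType} (n : nat) (alpha T h : R)
    (m : lattice n h -> R) (f : R -> lattice n h -> R[i])
    (u0 u1 : lattice n h -> R[i]) : Prop :=
  exists u du : R -> lattice n h -> R[i],
    [/\ is_solution alpha T m f u0 u1 u du,
        forall t : R, t \in `[0, T] -> in_l2 (u t) /\ in_l2 (du t)
      & forall v dv, is_solution alpha T m f u0 u1 v dv ->
          forall t : R, t \in `[0, T] -> v t = u t /\ dv t = du t].

(* The solution depends continuously on the data: the solution map            *)
(* l^2 * l^2 * L^2([0, T]; l^2) -> C^1([0, T]; l^2) is continuous.            *)
Definition continuous_dependence {R : realType} (n : nat) (alpha T h : R)
    (m : lattice n h -> R) : Prop :=
  forall (u0 u1 : lattice n h -> R[i]) (f u du : R -> lattice n h -> R[i]),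
    in_l2 u0 -> in_l2 u1 -> in_L2 T f -> is_solution alpha T m f u0 u1 u du ->
  forall e : R, 0 < e -> exists2 d : R, 0 < d &
  forall (v0 v1 : lattice n h -> R[i]) (g v dv : R -> lattice n h -> R[i]),
    in_l2 v0 -> in_l2 v1 -> in_L2 T g -> is_solution alpha T m g v0 v1 v dv ->
    (l2norm (fun x => v0 x - u0 x)%R < d%:E)%E ->
    (l2norm (fun x => v1 x - u1 x)%R < d%:E)%E ->
    (L2norm T (fun t x => g t x - f t x)%R < d%:E)%E ->
    forall t : R, t \in `[0, T] ->
      (l2norm (fun x => v t x - u t x)%R < e%:E)%E /\
      (l2norm (fun x => dv t x - du t x)%R < e%:E)%E.

(* Well-posedness in the sense of Hadamard. *)
Definition well_posed {R : realType} (n : nat) (alpha T h : R)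
    (m : lattice n h -> R) : Prop :=
  (forall u0 u1 f, in_l2 u0 -> in_l2 u1 -> in_L2 T f ->
     existence_uniqueness alpha T m f u0 u1) /\
  continuous_dependence alpha T m.

(* Main.v *)
(* Splitting complex families into real and imaginary parts identifies l^2 of the
   lattice with the real Hilbert space l^2(K x {0,1}).  By orthogonality of the
   characters on the cube, the quadratic form of the discrete fractional Laplacian is
   the integral of the symbol against |trigonometric polynomial|^2, so that the spatial
   operator B (fractional Laplacian plus potential) is bounded, symmetric and
   non-negative, of norm at most h^(-2 alpha) (4 n)^alpha + sup m.

   Existence: the velocity solves the Volterra equation v = G - B(int int v), by a
   series converging in exponentially weighted sup norms; v is then an indefinite
   integral, differentiable at the common Lebesgue points of |f - q|, q ranging over a
   countable dense set.

   Estimate: the energy |v|^2 + <B u, u> is absolutely continuous and its derivative is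
   2 <f, v>, almost everywhere at most 2 T |f|^2 + S / (2 T) when S bounds the energy;
   integrating and taking for S the supremum gives a bound on v, hence on
   u = u_0 + int v.  Applied to differences of solutions, it yields uniqueness and
   continuous dependence. *)

Require Import Defs.
From HB Require Import structures.
From mathcomp Require Import all_boot all_order all_algebra.
From mathcomp Require Import finmap.
From mathcomp Require Import all_classical all_reals all_analysis.
From mathcomp Require Import measurable_realfun complex.
From mathcomp Require Import ring lra.

Set Implicit Arguments.
Unset Strict Implicit.
Unset Printing Implicit Defensive.

Import Order.TTheory GRing.Theory Num.Theory.
Import numFieldNormedType.Exports.

Local Open Scope classical_set_scope.
Local Open Scope ring_scope.

(** The obstacle is that the acceleration exists only almost everywhere, so the energy cannot be
    treated by a pointwise mean value theorem. Absolute continuity replaces it: a real function that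
    is absolutely continuous and has non-positive derivative off a null set is non-increasing.
    Subtracting from the energy a primitive of the expected bound brings the estimate to this form.
    The supremum of the energy must be finite before half of it can be absorbed; absolute continuity
    of the velocity on a compact interval ensures this, and no Gronwall exponential appears. Square
    sums are bounded by duality: a sum of squares [S] is rewritten as a pairing of a vector with
    itself, estimated by [N * Num.sqrt S], and the present lemma divides out the root. Rows of a
    matrix, images of vectors and vector integrals all enter l^2 in this way. *)

Lemma le_sqr_of_le_sqrt (R : realType) (S N : R) : 0 <= S -> 0 <= N -> S <= N * Num.sqrt S -> S <= N ^+ 2.
Proof.
move=> S0 N0; rewrite -[in X in X <= _](sqr_sqrtr S0) expr2 => H.
rewrite -(sqr_sqrtr S0) ler_pXn2r ?nnegrE ?sqrtr_ge0//.
have [->//|s0] := eqVneq (Num.sqrt S) 0.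
by rewrite -(@ler_pM2r _ (Num.sqrt S))// lt_def s0 sqrtr_ge0.
Qed.

(** * Unconditional sums and real l^2 *)

Section Sums.
Variables (R : realType) (J : choiceType).
Implicit Types (F G : J -> R) (A B : {fset J}).

(** Convergence of the net of finite partial sums. As [rsum] is a difference of two extended sums,
    identities are proved for this relation and moved to [rsum] by [rsumE]. *)
Definition has_sum F (s : R) := forall e, 0 < e ->
  exists A0 : {fset J}, forall A, (A0 `<=` A)%fset ->
    `|\sum_(x <- A) F x - s| <= e.

Definition sums_bounded F (M : R) := forall A, \sum_(x <- A) F x <= M.

(** The constant lets one statement cover termwise comparison ([c = 0]) and bounds by a number
    ([G = 0]). *)
Lemma has_sum_cst_le F G s t (c : R) : has_sum F s -> has_sum G t ->
  (forall A, \sum_(x <- A) F x <= \sum_(x <- A) G x + c) -> s <= t + c.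
Proof.
move=> Fs Gt FG; apply/ler_addgt0Pr => e e0.
have e20 : 0 < e / 2 by rewrite divr_gt0.
have [A1 H1] := Fs _ e20; have [A2 H2] := Gt _ e20.
have := H1 (A1 `|` A2)%fset (fsubsetUl _ _).
have := H2 (A1 `|` A2)%fset (fsubsetUr _ _).
have := FG (A1 `|` A2)%fset.
by rewrite !ler_norml => ? /andP[? ?] /andP[? ?]; lra.
Qed.

Lemma has_sum_le F G s t : has_sum F s -> has_sum G t ->
  (forall x, F x <= G x) -> s <= t.
Proof.
move=> Fs Gt FG; rewrite -[t]addr0; apply: (has_sum_cst_le Fs Gt) => A.
by rewrite addr0; apply: ler_sum.
Qed.

Lemma has_sum_unique F s t : has_sum F s -> has_sum F t -> s = t.
Proof.
by move=> Fs Ft; apply/eqP; rewrite eq_le (has_sum_le Fs Ft)// (has_sum_le Ft Fs).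
Qed.

Lemma has_sum0 : has_sum (fun=> 0) 0.
Proof. by move=> e e0; exists fset0 => A _; rewrite big1// subrr normr0 ltW. Qed.

Lemma has_sumD F G s t : has_sum F s -> has_sum G t ->
  has_sum (fun x => F x + G x) (s + t).
Proof.
move=> Fs Gt e e0.
have e20 : 0 < e / 2 by rewrite divr_gt0.
have [A1 H1] := Fs _ e20; have [A2 H2] := Gt _ e20.
exists (A1 `|` A2)%fset => A; rewrite fsubUset => /andP[/H1 + /H2].
by rewrite big_split/= !ler_norml => /andP[? ?] /andP[? ?]; apply/andP; split; lra.
Qed.

Lemma has_sumZ F s c : has_sum F s -> has_sum (fun x => c * F x) (c * s).
Proof.
move=> Fs e e0; have c0 : 0 < `|c| + 1 by rewrite ltr_wpDl.
have [A1 H1] := Fs _ (divr_gt0 e0 c0).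
exists A1 => A /H1 {}H1; rewrite -mulr_sumr -mulrBr normrM.
rewrite (le_trans (ler_wpM2l _ H1))// mulrCA ger_pMr// ler_pdivrMr//.
by rewrite mul1r lerDl.
Qed.

Lemma eq_has_sum F G s : (forall x, F x = G x) -> has_sum F s -> has_sum G s.
Proof. by move=> /funext ->. Qed.

Lemma has_sum_fin (A : {fset J}) F : (forall x, x \notin A -> F x = 0) ->
  has_sum F (\sum_(x <- A) F x).
Proof.
move=> FA e e0; exists A => B AB; rewrite (big_fset_incl _ AB) ?subrr ?normr0 ?ltW//.
by move=> x _ /FA.
Qed.

Lemma has_sum_ge_fin F s A : (forall x, 0 <= F x) -> has_sum F s ->
  \sum_(x <- A) F x <= s.
Proof.
move=> F0 Fs; apply/ler_addgt0Pr => e e0; have [A1 H1] := Fs _ e0.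
have := H1 (A1 `|` A)%fset (fsubsetUl _ _); rewrite ler_norml => /andP[_].
rewrite lerBlDr addrC => /(le_trans _) ->//.
rewrite [leRHS](big_fsetID _ [in A])/= ler_wpDr ?sumr_ge0//.
by rewrite (_ : [fset x | x in _ & _]%fset = A)//; apply/fsetP => x; rewrite !inE;
  case: (x \in A); rewrite ?orbT ?andbF.
Qed.

Lemma has_sum_le_cst F s M : has_sum F s -> sums_bounded F M -> s <= M.
Proof.
move=> Fs FM; rewrite -[M]add0r; apply: (has_sum_cst_le Fs has_sum0) => A.
by rewrite big1_eq add0r.
Qed.

Lemma esum_le_cst F M : sums_bounded F M ->
  (\esum_(x in [set: J]) (F x)%:E <= M%:E)%E.
Proof.
move=> FM; apply: ge_ereal_sup => _ [A [finA _] <-].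
by rewrite fsbig_finite//= sumEFin lee_fin.
Qed.

Lemma esum_ge_fin F A : (forall x, 0 <= F x) ->
  ((\sum_(x <- A) F x)%:E <= \esum_(x in [set: J]) (F x)%:E)%E.
Proof.
move=> F0; apply: esum_ge; exists [set` A] => //.
by rewrite fsbig_finite//= set_fsetK sumEFin.
Qed.

Lemma has_sum_esum F : (forall x, 0 <= F x) ->
  (\esum_(x in [set: J]) (F x)%:E < +oo)%E ->
  has_sum F (fine (\esum_(x in [set: J]) (F x)%:E)).
Proof.
move=> F0 Foo; set s := esum _ _ in Foo *.
have sf : s \is a fin_num by rewrite ge0_fin_numE//; apply: esum_ge0 => x; rewrite lee_fin.
move=> e e0.
have := ub_ereal_sup_adherent e0 sf => -[_ [A [finA _] <-]] sA.
exists (fset_set A) => B AB; rewrite ler_norml; apply/andP; split; last first.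
  rewrite lerBlDr; apply: ler_wpDl; first exact: ltW.
  by rewrite -lee_fin fineK//; exact: esum_ge_fin.
rewrite lerBrDr addrC; apply: ltW; apply: (@lt_le_trans _ _ (\sum_(x <- fset_set A) F x)).
  by rewrite -lte_fin EFinB fineK// -sumEFin -fsbig_finite.
rewrite [leRHS](big_fsetID _ [in fset_set A])/= ler_wpDr ?sumr_ge0//.
rewrite (_ : [fset x | x in _ & _]%fset = fset_set A)//; apply/fsetP => x; rewrite !inE.
by apply/idP/idP => [/andP[]//|xA]; rewrite xA (fsubsetP AB).
Qed.

Lemma esum_has_sum F s : (forall x, 0 <= F x) -> has_sum F s ->
  \esum_(x in [set: J]) (F x)%:E = s%:E.
Proof.
move=> F0 Fs; have FM : sums_bounded F s by move=> A; exact: has_sum_ge_fin.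
have Foo : (\esum_(x in [set: J]) (F x)%:E < +oo)%E.
  by rewrite (le_lt_trans (esum_le_cst FM))// ltry.
rewrite -(has_sum_unique (has_sum_esum F0 Foo) Fs) fineK// ge0_fin_numE//.
by apply: esum_ge0 => x _; rewrite lee_fin.
Qed.

(** Positive and negative parts are dominated by the absolute value, so both extended sums in [rsum]
    are finite and are limits of partial sums. *)
Lemma has_sum_rsum F M : sums_bounded (fun x => `|F x|) M -> has_sum F (rsum F).
Proof.
move=> FM.
have P (G : J -> R) : (forall x, `|G x| <= `|F x|) ->
    has_sum (fun x => Num.max (G x) 0) (fine (\esum_(x in [set: J]) (Num.max (G x) 0)%:E)).
  move=> GF; apply: has_sum_esum => [x|]; first by rewrite le_max lexx orbT.
  apply: (@le_lt_trans _ _ M%:E); last exact: ltry.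
  apply: esum_le_cst => A; apply: le_trans (FM A); apply: ler_sum => x _.
  by rewrite ge_max normr_ge0 andbT (le_trans (ler_norm _)).
have P1 : has_sum _ _ := P F (fun=> lexx _).
have P2 : has_sum _ _ := P (fun x => - F x) (fun x => ltac:(by rewrite normrN)).
have := has_sumD P1 (has_sumZ (-1) P2); rewrite mulN1r; apply: eq_has_sum => x.
by rewrite mulN1r /Num.max; case: ltP => ?; case: ltP => ?; lra.
Qed.

Lemma rsumE F s M : sums_bounded (fun x => `|F x|) M -> has_sum F s -> rsum F = s.
Proof. by move=> FM; apply: has_sum_unique; exact: has_sum_rsum FM. Qed.

End Sums.

Section SquareSummable.
Variables (R : realType) (J : choiceType).

(** Values are taken in the regular module [R^o], so that [J -> R^o] is a module and [l2] inherits
    its operations as a submodule. *)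
Definition square_summable : {pred J -> R^o} :=
  fun F => `[< exists M : R, sums_bounded (fun x => F x ^+ 2) M >].

Fact square_summable_submod : submod_closed square_summable.
Proof.
split; first by apply/asboolP; exists 0 => A; rewrite big1// => x _; rewrite expr0n.
move=> a F G /asboolP[M FM] /asboolP[N GN]; apply/asboolP.
exists (2 * a ^+ 2 * M + 2 * N) => A.
apply: (@le_trans _ _ (\sum_(x <- A) (2 * a ^+ 2 * F x ^+ 2 + 2 * G x ^+ 2))).
  apply: ler_sum => x _; rewrite -subr_ge0.
  rewrite (_ : _ - _ = (a * F x - G x) ^+ 2) ?sqr_ge0//.
  by rewrite (_ : (a *: F + G) x = a * F x + G x)//; ring.
rewrite big_split/= -!mulr_sumr lerD// ler_wpM2l// ?FM ?GN//.
by rewrite mulr_ge0 ?sqr_ge0.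
Qed.

HB.instance Definition _ := GRing.isSubmodClosed.Build R^o (J -> R^o) square_summable
  square_summable_submod.

Record l2 := L2 { l2val : J -> R^o; _ : l2val \in square_summable }.

HB.instance Definition _ := [isSub for l2val].
HB.instance Definition _ := [Choice of l2 by <:].
HB.instance Definition _ := [SubChoice_isSubLmodule of l2 by <:].

End SquareSummable.

Definition coef (R : realType) (J : choiceType) (u : l2 R J) (x : J) : R := l2val u x.
Coercion coef : l2 >-> Funclass.
Arguments coef {R J} u x : simpl never.

Section SquareSummableTheory.
Variables (R : realType) (J : choiceType).
Implicit Types (u v w : l2 R J) (a : R).

Lemma l2P u v : (forall x, u x = v x) -> u = v.
Proof. by move=> uv; apply/val_inj/funext. Qed.

Lemma l2_0 x : (0 : l2 R J) x = 0. Proof. by []. Qed.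
Lemma l2D u v x : (u + v) x = u x + v x. Proof. by []. Qed.
Lemma l2N u x : (- u) x = - u x. Proof. by []. Qed.
Lemma l2B u v x : (u - v) x = u x - v x. Proof. by []. Qed.
Lemma l2Z a u x : (a *: u : l2 R J) x = a * u x. Proof. by []. Qed.
Lemma l2_sum (I : Type) (r : seq I) (P : pred I) (F : I -> l2 R J) x :
  (\sum_(i <- r | P i) F i) x = \sum_(i <- r | P i) F i x.
Proof. by elim/big_rec2 : _ => //= i y1 y2 _ <-; rewrite l2D. Qed.
End SquareSummableTheory.
Definition l2E := (l2B, l2_0, l2D, l2N, l2Z, l2_sum).

(** Locked to keep [rsum] out of unification; its properties are drawn from [has_sum_dot] by
    uniqueness of sums. *)
HB.lock Definition dot (R : realType) (J : choiceType) (u v : l2 R J) : R :=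
  rsum (fun x => u x * v x).

Section HilbertStructure.
Variables (R : realType) (J : choiceType).
Implicit Types (u v w : l2 R J) (a : R) (A : {fset J}).

Lemma sums_bounded_mul u v : exists M, sums_bounded (fun x => `|u x * v x|) M.
Proof.
have /asboolP[M uM] := valP u; have /asboolP[N vN] := valP v.
exists (M + N) => A.
apply: le_trans (lerD (uM A) (vN A)); rewrite -big_split/=; apply: ler_sum => x _.
rewrite normrM -(real_normK (num_real (u x))) -(real_normK (num_real (v x))).
have := sqr_ge0 (`|u x| - `|v x|); rewrite sqrrB.
by have := sqr_ge0 (`|u x|); have := sqr_ge0 (`|v x|); lra.
Qed.

Lemma has_sum_dot u v : has_sum (fun x => u x * v x) (dot u v).
Proof. by rewrite unlock; have [M] := sums_bounded_mul u v; exact: has_sum_rsum. Qed.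

Lemma dotC u v : dot u v = dot v u.
Proof.
apply: (has_sum_unique (has_sum_dot u v)); apply: eq_has_sum (has_sum_dot v u) => x.
exact: mulrC.
Qed.

Lemma dotDl u v w : dot (u + v) w = dot u w + dot v w.
Proof.
apply: (has_sum_unique (has_sum_dot _ _)).
apply: eq_has_sum (has_sumD (has_sum_dot u w) (has_sum_dot v w)) => x.
by rewrite l2E mulrDl.
Qed.

Lemma dotZl a u w : dot (a *: u) w = a * dot u w.
Proof.
apply: (has_sum_unique (has_sum_dot _ _)).
by apply: eq_has_sum (has_sumZ a (has_sum_dot u w)) => x; rewrite l2E mulrA.
Qed.

Lemma dotDr u v w : dot w (u + v) = dot w u + dot w v.
Proof. by rewrite dotC dotDl !(dotC w). Qed.

Lemma dotZr a u w : dot w (a *: u) = a * dot w u.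
Proof. by rewrite dotC dotZl (dotC w). Qed.

Lemma dotNl u w : dot (- u) w = - dot u w.
Proof. by rewrite -scaleN1r dotZl mulN1r. Qed.

Lemma dotNr u w : dot w (- u) = - dot w u.
Proof. by rewrite -scaleN1r dotZr mulN1r. Qed.

Lemma dotBl u v w : dot (u - v) w = dot u w - dot v w.
Proof. by rewrite dotDl dotNl. Qed.

Lemma dotBr u v w : dot w (u - v) = dot w u - dot w v.
Proof. by rewrite dotDr dotNr. Qed.

Lemma dot0l w : dot 0 w = 0.
Proof. by rewrite -(scale0r 0) dotZl mul0r. Qed.

Lemma dot0r w : dot w 0 = 0. Proof. by rewrite dotC dot0l. Qed.

Definition dotE := (dotDl, dotDr, dotBl, dotBr, dotZl, dotZr, dotNl, dotNr).

Lemma sum_sqr_le_dot u A : \sum_(x <- A) u x ^+ 2 <= dot u u.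
Proof.
apply: has_sum_ge_fin => [x|]; first exact: sqr_ge0.
by apply: eq_has_sum (has_sum_dot u u) => x; rewrite expr2.
Qed.

Lemma dot_ge0 u : 0 <= dot u u.
Proof. by have := sum_sqr_le_dot u fset0; rewrite big_seq_fset0. Qed.

Lemma sqr_coord_le u x : u x ^+ 2 <= dot u u.
Proof. by have := sum_sqr_le_dot u [fset x]%fset; rewrite big_seq_fset1. Qed.

Lemma dot_eq0 u : dot u u = 0 -> u = 0.
Proof.
move=> u0; apply: l2P => x; apply/eqP; rewrite -sqrf_eq0 eq_le sqr_ge0 andbT -u0.
exact: sqr_coord_le.
Qed.

Definition l2nrm u : R := Num.sqrt (dot u u).

Lemma l2nrm_sqr u : l2nrm u ^+ 2 = dot u u.
Proof. by rewrite sqr_sqrtr ?dot_ge0. Qed.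

Fact CauchySchwarz u v : dot u v <= l2nrm u * l2nrm v.
Proof.
have [/eqP|v0] := eqVneq (l2nrm v) 0.
  rewrite sqrtr_eq0 le_eqVlt ltNge dot_ge0 orbF => /eqP/dot_eq0 ->.
  by rewrite dot0r mulr_ge0 ?sqrtr_ge0.
have [/eqP|u0] := eqVneq (l2nrm u) 0.
  rewrite sqrtr_eq0 le_eqVlt ltNge dot_ge0 orbF => /eqP/dot_eq0 ->.
  by rewrite dot0l mulr_ge0 ?sqrtr_ge0.
have := dot_ge0 (l2nrm v *: u - l2nrm u *: v).
rewrite !dotE -!l2nrm_sqr (dotC v u) => H.
have p0 : 0 < l2nrm u * l2nrm v by rewrite mulr_gt0 // lt_def ?u0 ?v0 ?sqrtr_ge0.
by rewrite -(ler_pM2l p0); nra.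
Qed.

Fact l2nrmD u v : l2nrm (u + v) <= l2nrm u + l2nrm v.
Proof.
rewrite -(@ler_pXn2r _ 2) ?nnegrE ?addr_ge0 ?sqrtr_ge0// l2nrm_sqr !dotE (dotC v u).
by rewrite sqrrD !l2nrm_sqr; have := CauchySchwarz u v; lra.
Qed.

Fact l2nrm_eq0 u : l2nrm u = 0 -> u = 0.
Proof. by move=> u0; apply: dot_eq0; rewrite -l2nrm_sqr u0 expr0n. Qed.

Fact l2nrmZ a u : l2nrm (a *: u) = `|a| * l2nrm u.
Proof. by rewrite /l2nrm dotZl dotZr mulrA -expr2 sqrtrM ?sqr_ge0// sqrtr_sqr. Qed.

Fact l2nrmMn u n : l2nrm (u *+ n) = l2nrm u *+ n.
Proof. by rewrite -scaler_nat l2nrmZ normr_nat mulr_natl. Qed.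

Fact l2nrmN u : l2nrm (- u) = l2nrm u.
Proof. by rewrite -scaleN1r l2nrmZ normrN normr1 mul1r. Qed.

(** Only a norm is declared, not a topology: continuity and derivatives of vector functions are
    spelled out with epsilons. *)
HB.instance Definition _ := Num.Zmodule_isNormed.Build R (l2 R J)
  l2nrmD l2nrm_eq0 l2nrmMn l2nrmN.

Lemma l2_normE u : `|u| = Num.sqrt (dot u u). Proof. by []. Qed.

Lemma l2_norm_sqr u : `|u| ^+ 2 = dot u u. Proof. exact: l2nrm_sqr. Qed.

Lemma l2_normZ a u : `|a *: u| = `|a| * `|u|. Proof. exact: l2nrmZ. Qed.

Lemma dot_le u v : dot u v <= `|u| * `|v|. Proof. exact: CauchySchwarz. Qed.

Lemma norm_dot_le u v : `|dot u v| <= `|u| * `|v|.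
Proof. by rewrite ler_norml dot_le andbT lerNl -dotNl -(normrN u) dot_le. Qed.

Lemma norm_coord_le u x : `|u x| <= `|u|.
Proof. by rewrite -(@ler_pXn2r _ 2) ?nnegrE// l2_norm_sqr real_normK ?num_real ?sqr_coord_le. Qed.

Lemma sum_sqr_le u A : \sum_(x <- A) u x ^+ 2 <= `|u| ^+ 2.
Proof. by rewrite l2_norm_sqr sum_sqr_le_dot. Qed.

Lemma l2_norm_le u (M : R) : 0 <= M -> (forall A, \sum_(x <- A) u x ^+ 2 <= M ^+ 2) ->
  `|u| <= M.
Proof.
move=> M0 uM; rewrite -(@ler_pXn2r _ 2) ?nnegrE// l2_norm_sqr.
by apply: (has_sum_le_cst (has_sum_dot u u)) => A; under eq_bigr do rewrite -expr2.
Qed.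

(* 0 if [F] is not square summable. *)
Definition mkl2 (F : J -> R) : l2 R J := insubd (0 : l2 R J) F.

Lemma mkl2E F (M : R) : (forall A, \sum_(x <- A) F x ^+ 2 <= M) ->
  forall x, mkl2 F x = F x.
Proof. by move=> FM x; rewrite /coef insubdK//; apply/asboolP; exists M. Qed.

Lemma mkl2_norm F (M : R) : 0 <= M -> (forall A, \sum_(x <- A) F x ^+ 2 <= M ^+ 2) ->
  `|mkl2 F| <= M.
Proof.
by move=> M0 FM; apply: l2_norm_le => // A; under eq_bigr do rewrite (mkl2E FM).
Qed.

Definition delta y : l2 R J := mkl2 (fun x => (x == y)%:R).

Lemma deltaE y x : delta y x = (x == y)%:R.
Proof.
apply: (@mkl2E _ 1) => A; have [yA|yA] := boolP (y \in A).
  rewrite (big_fsetD1 y)//= eqxx expr1n big1_fset ?addr0// => z.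
  by rewrite !inE => /andP[/negPf -> _]; rewrite expr0n.
rewrite big1_seq// => z /andP[_ zA] /=; have [zy|_] := eqVneq z y; last by rewrite expr0n.
by rewrite -zy zA in yA.
Qed.

Lemma dot_delta u y : dot u (delta y) = u y.
Proof.
apply: (has_sum_unique (has_sum_dot _ _)).
have := @has_sum_fin _ _ [fset y]%fset (fun x => u x * delta y x).
rewrite big_seq_fset1 deltaE eqxx mulr1; apply => x.
by rewrite inE deltaE => /negPf ->; rewrite mulr0.
Qed.

Definition trunc A u : l2 R J := \sum_(y <- A) u y *: delta y.

Lemma truncE A u x : trunc A u x = if x \in A then u x else 0.
Proof.
rewrite /trunc l2_sum; case: ifPn => xA; last first.
  rewrite big1_seq// => y /andP[_ yA]; rewrite l2E deltaE; case: eqP => [xy|]; rewrite ?mulr0//.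
  by rewrite xy yA in xA.
rewrite (big_fsetD1 x)// l2E deltaE eqxx mulr1 big1_fset; first exact: addr0.
move=> z; rewrite !inE => /andP[/negPf zx _] _.
by rewrite l2E deltaE eq_sym zx mulr0.
Qed.

(** Beyond a finite set on which the sum of squares is within [e ^+ 2] of its limit, every finite
    set contributes at most [e ^+ 2]. *)
Lemma trunc_approx u (e : R) : 0 < e -> exists A, `|u - trunc A u| <= e.
Proof.
move=> e0; have e20 : 0 < e ^+ 2 by rewrite exprn_gt0.
have [A HA] := has_sum_dot u u e20; exists A; apply: l2_norm_le; first exact: ltW.
move=> B.
have := sum_sqr_le_dot u (A `|` B)%fset.
have /ler_normlP[+ _] := HA A (fsubset_refl _); rewrite opprB => H1.
rewrite (big_fsetID _ [in A])/= => H2.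
have -> : \sum_(x <- B) (u - trunc A u) x ^+ 2 =
    \sum_(x <- [fset x in (A `|` B) | x \notin A]%fset) u x ^+ 2.
  rewrite (big_fsetID _ [in A] B)/= [X in X + _]big1_fset ?add0r; last first.
    move=> x; rewrite !inE => /andP[_ xA] _; rewrite l2E truncE xA subrr expr0n//.
  rewrite (_ : [fset x in A `|` B | _]%fset = [fset x in B | x \notin A]%fset).
    apply: eq_big_seq => x; rewrite !inE => /andP[_ /negPf xA].
    by rewrite l2E truncE xA subr0.
  by apply/fsetP => x; rewrite !inE; case: (x \in A); rewrite ?andbF.
move: H2; rewrite (_ : [fset x in A `|` B | x \in A]%fset = A); last first.
  by apply/fsetP => x; rewrite !inE; case: (x \in A); rewrite ?andbF.
move: H1; rewrite (eq_bigr (fun x => u x ^+ 2)) => [|x _]; last by rewrite expr2.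
by set S1 := bigop _ _ _; set S2 := bigop _ _ _; lra.
Qed.

(** The limit is taken coordinatewise. Each finite sum of squares passes to the limit, so the rate
    [b] survives without exchanging a limit and an infinite sum. *)
Lemma l2_complete (v : nat -> l2 R J) (b : R^nat) :
    (forall p q, (p <= q)%N -> `|v q - v p| <= b p) -> b @ \oo --> 0 ->
  exists w, forall p, `|w - v p| <= b p.
Proof.
move=> vb b0.
have bge p : 0 <= b p by apply: le_trans (vb p p _).
have cv x : cvgn (fun q => v q x : R).
  apply/cauchy_cvgP/cauchyP => e e0.
  have /cvgrPdist_lt/(_ _ e0)[N _ HN] := b0.
  exists (v N x); exists N => // q /= Nq.
  rewrite /ball/= distrC; apply: le_lt_trans (HN N (leqnn _)).
  rewrite sub0r normrN (ger0_norm (bge _)) -l2B.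
  by rewrite (le_trans (norm_coord_le _ _))// vb.
pose w0 x : R := limn (fun q => v q x : R).
have wb p A : \sum_(x <- A) (w0 x - v p x) ^+ 2 <= b p ^+ 2.
  have cvF (r : seq J) : (fun q => \sum_(x <- r) (v q x - v p x) ^+ 2) @ \oo -->
      \sum_(x <- r) (w0 x - v p x) ^+ 2.
    elim: r => [|x r IH].
      by under eq_fun do rewrite big_nil; rewrite big_nil; exact: cvg_cst.
    rewrite big_cons; under eq_fun do rewrite big_cons.
    apply: cvgD => //; rewrite expr2; under eq_fun do rewrite expr2.
    by apply: cvgM; apply: cvgB; [exact: cv|exact: cvg_cst|exact: cv|exact: cvg_cst].
  apply: (cvgr_to_le (cvF A)); exists p => // q /= pq.
  apply: (@le_trans _ _ (`|v q - v p| ^+ 2)); first by under eq_bigr do rewrite -l2B; exact: sum_sqr_le.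
  by rewrite ler_pXn2r ?nnegrE ?vb.
(* Square summability is known for [w0 - v 0] only, so the limit vector is obtained by adding [v 0]
   back. *)
have w0E x : (mkl2 (fun x => w0 x - v 0 x) + v 0) x = w0 x.
  by rewrite l2E (mkl2E (wb 0)) subrK.
exists (mkl2 (fun x => w0 x - v 0%N x) + v 0%N) => p.
by apply: l2_norm_le => // A; under eq_bigr do rewrite l2B w0E.
Qed.
End HilbertStructure.

(** * Bounded non-negative operators on l^2 *)

Section PositiveOperators.
Variables (R : realType) (J : choiceType).
Implicit Types (u v w : l2 R J) (a M : R) (A : {fset J}) (B : l2 R J -> l2 R J).

Record pos_op B M : Prop := PosOp {
  pos_opD : forall u v, B (u + v) = B u + B v;
  pos_opZ : forall a u, B (a *: u) = a *: B u;
  pos_op_sym : forall u v, dot (B u) v = dot u (B v);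
  pos_op_ge0 : forall u, 0 <= dot (B u) u;
  pos_op_bound : forall u, `|B u| <= M * `|u| }.

Lemma pos_opN B M u : pos_op B M -> B (- u) = - B u.
Proof. by move=> BM; rewrite -scaleN1r (pos_opZ BM) scaleN1r. Qed.

Lemma pos_opB B M u v : pos_op B M -> B (u - v) = B u - B v.
Proof. by move=> BM; rewrite (pos_opD BM) (pos_opN _ BM). Qed.

Lemma pos_op0 B M : pos_op B M -> B 0 = 0.
Proof. by move=> BM; have := pos_opB 0 0 BM; rewrite !subrr. Qed.

Lemma pos_op_add B1 B2 M1 M2 : pos_op B1 M1 -> pos_op B2 M2 ->
  pos_op (fun u => B1 u + B2 u) (M1 + M2).
Proof.
move=> [D1 Z1 S1 P1 b1] [D2 Z2 S2 P2 b2]; split=> [u v|a u|u v|u|u].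
- by rewrite /= D1 D2 addrACA.
- by rewrite /= Z1 Z2 scalerDr.
- by rewrite /= dotDl dotDr S1 S2.
- by rewrite /= dotDl addr_ge0.
- by rewrite /= (le_trans (ler_normD _ _))// mulrDl lerD.
Qed.

Lemma pos_op_scale B M a : 0 <= a -> pos_op B M -> pos_op (fun u => a *: B u) (a * M).
Proof.
move=> a0 [D Z S P b]; split=> [u v|c u|u v|u|u].
- by rewrite /= D scalerDr.
- by rewrite /= Z !scalerA mulrC.
- by rewrite /= dotZl dotZr S.
- by rewrite /= dotZl mulr_ge0.
- by rewrite /= l2_normZ ger0_norm// -mulrA ler_wpM2l.
Qed.

Lemma pos_op_diag (m : J -> R) M : (forall x, 0 <= m x <= M) ->
  exists2 B, pos_op B M & forall u x, B u x = m x * u x.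
Proof.
move=> mM; have M0 (x : J) : 0 <= M by have /andP[/le_trans H /H] := mM x.
have sq u A : \sum_(x <- A) (m x * u x) ^+ 2 <= (M * `|u|) ^+ 2.
  rewrite exprMn; apply: (@le_trans _ _ (M ^+ 2 * \sum_(x <- A) u x ^+ 2)).
    rewrite mulr_sumr; apply: ler_sum => x _; rewrite exprMn ler_wpM2r ?sqr_ge0//.
    by have /andP[m0 mx] := mM x; rewrite ler_pXn2r ?nnegrE// (M0 x).
  by rewrite ler_wpM2l ?sqr_ge0// sum_sqr_le.
pose B u := mkl2 (fun x => m x * u x).
have BE u x : B u x = m x * u x by rewrite (mkl2E (sq u)).
have dotBE u v : has_sum (fun x => m x * u x * v x) (dot (B u) v).
  by apply: eq_has_sum (has_sum_dot _ _) => x; rewrite BE.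
exists B => //; split=> [u v|a u|u v|u|u].
- by apply: l2P => x; rewrite !(BE, l2E) mulrDr.
- by apply: l2P => x; rewrite !(BE, l2E) mulrCA.
- apply: (has_sum_unique (dotBE _ _)); apply: eq_has_sum (has_sum_dot _ _) => x.
  by rewrite BE mulrA (mulrC (u x)).
- apply: (has_sum_le (@has_sum0 _ _) (dotBE u u)) => x.
  by rewrite -mulrA -expr2 mulr_ge0 ?sqr_ge0//; have /andP[] := mM x.
(* The hypothesis yields [0 <= M] only at a point of [J]; over an empty [J] every vector is 0. *)
- have [x|J0] := pselect (exists x : J, True); last first.
    have u0 v : v = 0 by apply: l2P => x; case: J0; exists x.
    by rewrite (u0 (B u)) (u0 u) !normr0 mulr0.
  apply: l2_norm_le => [|A]; first by case: x => x _; rewrite mulr_ge0// (M0 x).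
  by under eq_bigr do rewrite BE; exact: sq.
Qed.

(** Truncations are finite combinations of [delta]s and are dense. This extends identities known on
    the basis to the whole space. *)
Lemma eq0_on_delta (f : l2 R J -> R) M :
  (forall u v, f (u + v) = f u + f v) -> (forall a u, f (a *: u) = a * f u) ->
  (forall u, `|f u| <= M * `|u|) -> (forall x, f (delta R x) = 0) -> forall u, f u = 0.
Proof.
move=> fD fZ fM fd u; apply/eqP; rewrite -normr_le0; apply/ler_addgt0Pr => e e0.
(* A positive divisor, whatever the sign of [M]. *)
have M0 : 0 < `|M| + 1 by rewrite ltr_wpDl.
have [A uA] := trunc_approx u (divr_gt0 e0 M0).
have f0 : f 0 = 0 by rewrite -(scale0r 0) fZ mul0r.
have ftr : f (trunc A u) = 0.
  rewrite /trunc; elim/big_ind : _ => // [v w fv fw|x _]; first by rewrite fD fv fw addr0.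
  by rewrite fZ fd mulr0.
rewrite -(subrK (trunc A u) u) fD ftr addr0 add0r (le_trans (fM _))//.
apply: (@le_trans _ _ ((`|M| + 1) * `|u - trunc A u|)).
  by rewrite ler_wpM2r// ler_wpDr// ler_norm.
by rewrite (le_trans (ler_wpM2l (ltW M0) uA))// mulrCA mulfV ?mulr1// gt_eqF.
Qed.

Section MatrixOperator.
Variables (K : J -> J -> R) (M : R).
Hypothesis M_ge0 : 0 <= M.
Hypothesis K_sym : forall x y, K x y = K y x.
Hypothesis K_ge0 : forall A (c : J -> R),
  0 <= \sum_(x <- A) \sum_(y <- A) K x y * (c x * c y).
Hypothesis K_le : forall A (c : J -> R),
  \sum_(x <- A) \sum_(y <- A) K x y * (c x * c y) <= M * \sum_(x <- A) c x ^+ 2.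

(** Cauchy-Schwarz for the semi-definite form: with [s], [t] the norms of [c], [d], positivity at
    [t c - s d] bounds [2 s t b] by [t^2 K(c,c) + s^2 K(d,d)], hence by [2 M s^2 t^2]. *)
Let form_le A (c d : J -> R) :
  \sum_(x <- A) \sum_(y <- A) K x y * (c x * d y) <=
  M * Num.sqrt (\sum_(x <- A) c x ^+ 2) * Num.sqrt (\sum_(x <- A) d x ^+ 2).
Proof.
set b := bigop _ _ _; set C := bigop _ _ _; set D := bigop _ _ _.
have C0 : 0 <= C by apply: sumr_ge0 => x _; exact: sqr_ge0.
have D0 : 0 <= D by apply: sumr_ge0 => x _; exact: sqr_ge0.
have zero (c' : J -> R) : \sum_(x <- A) c' x ^+ 2 = 0 -> forall x, x \in A -> c' x = 0.
  move=> /eqP; rewrite psumr_eq0 => [|x _]; last exact: sqr_ge0.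
  by move=> /allP H x xA; have := H x xA; rewrite sqrf_eq0 => /eqP.
have [C00|C00] := eqVneq C 0.
  rewrite C00 sqrtr0 mulr0 mul0r /b big1_seq// => x /andP[_ xA].
  by rewrite big1// => y _; rewrite (zero _ C00)// mul0r mulr0.
have [D00|D00] := eqVneq D 0.
  rewrite D00 sqrtr0 mulr0 /b big1// => x _; rewrite big1_seq// => y /andP[_ yA].
  by rewrite (zero _ D00)// !mulr0.
have sC : 0 < Num.sqrt C by rewrite sqrtr_gt0 lt_def C00.
have sD : 0 < Num.sqrt D by rewrite sqrtr_gt0 lt_def D00.
set s := Num.sqrt C in sC *; set t := Num.sqrt D in sD *.
have H := K_ge0 A (fun x => t * c x - s * d x).
have E : \sum_(x <- A) \sum_(y <- A) K x y * ((t * c x - s * d x) * (t * c y - s * d y)) =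
    t ^+ 2 * (\sum_(x <- A) \sum_(y <- A) K x y * (c x * c y)) - t * s * b - t * s * b
    + s ^+ 2 * (\sum_(x <- A) \sum_(y <- A) K x y * (d x * d y)).
  rewrite -[in X in _ - X + _](_ : \sum_(x <- A) \sum_(y <- A) K x y * (d x * c y) = b).
    rewrite /b !mulr_sumr -!sumrB -big_split/=; apply: eq_bigr => x _.
    by rewrite !mulr_sumr -!sumrB -big_split/=; apply: eq_bigr => y _; ring.
  rewrite exchange_big/=; apply: eq_bigr => x _; apply: eq_bigr => y _.
  by rewrite K_sym (mulrC (d y)).
rewrite E in H; have := K_le A c; have := K_le A d; rewrite -/C -/D.
have -> : C = s ^+ 2 by rewrite sqr_sqrtr.
have -> : D = t ^+ 2 by rewrite sqr_sqrtr.
move=> H1 H2; have := ler_wpM2l (sqr_ge0 t) H2; have := ler_wpM2l (sqr_ge0 s) H1.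
move=> H3 H4; have st0 : 0 < s * t by rewrite mulr_gt0.
by rewrite -(ler_pM2l st0); nra.
Qed.

Let sum_incl (A A' : {fset J}) (G : J -> R) : (A `<=` A')%fset ->
  \sum_(x <- A') (if x \in A then G x else 0) = \sum_(x <- A) G x.
Proof.
move=> AA'; rewrite -(big_fset_incl _ AA') => [|x _ /negPf -> //].
by apply: eq_big_seq => x ->.
Qed.

(** Duality: the form tested on the unit mass at [x] and on row [x] cut to [A] returns the sum of
    squares itself, bounded by [M] times its square root. *)
Let row_sqr x A : \sum_(y <- A) K x y ^+ 2 <= M ^+ 2.
Proof.
apply: le_sqr_of_le_sqrt => //; first by apply: sumr_ge0 => y _; exact: sqr_ge0.
set A' := (x |` A)%fset; have AA' : (A `<=` A')%fset by exact: fsubsetU1.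
have := form_le A' (fun z => if z \in [fset x]%fset then 1 else 0)
                   (fun y => if y \in A then K x y else 0).
have -> : \sum_(z <- A') (if z \in [fset x]%fset then 1 : R else 0) ^+ 2 = 1.
  rewrite (eq_bigr (fun z => if z \in [fset x]%fset then 1 : R else 0)) => [|z _].
    by rewrite sum_incl ?big_seq_fset1// fsub1set !inE eqxx.
  by case: ifP; rewrite ?expr1n ?expr0n.
have -> : \sum_(z <- A') (if z \in A then K x z else 0) ^+ 2 = \sum_(y <- A) K x y ^+ 2.
  rewrite -(sum_incl _ AA'); apply: eq_bigr => z _; case: ifP => //.
  by rewrite expr0n.
rewrite sqrtr1 mulr1; apply: le_trans; rewrite le_eqVlt; apply/orP; left; apply/eqP.
rewrite [RHS](eq_bigr (fun z => if z \in [fset x]%fset then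
    \sum_(y <- A') (if y \in A then K x y ^+ 2 else 0) else 0)); last first.
  move=> z _; rewrite inE; case: eqP => [->|_]; last by rewrite big1// => y _; rewrite mul0r mulr0.
  by apply: eq_bigr => y _; rewrite mul1r; case: ifP; rewrite ?mulr0// expr2.
by rewrite sum_incl ?fsub1set ?inE ?eqxx// big_seq_fset1 sum_incl.
Qed.

Let row x : l2 R J := mkl2 (K x).
Let rowE x y : row x y = K x y. Proof. exact: (mkl2E (row_sqr x)). Qed.

Lemma dot_trunc u v A : dot u (trunc A v) = \sum_(y <- A) u y * v y.
Proof.
rewrite /trunc; elim/big_rec2 : _ => [|y s w _ <-]; first by rewrite dot0r.
by rewrite dotDr dotZr dot_delta mulrC.
Qed.

(** The same duality, tested on the image of [u]. The bound on the form concerns finite supports, so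
    [u] is truncated, with an arbitrarily small error. *)
Let op_sqr u A : \sum_(x <- A) (dot (row x) u) ^+ 2 <= (M * `|u|) ^+ 2.
Proof.
apply: le_sqr_of_le_sqrt; first by apply: sumr_ge0 => y _; exact: sqr_ge0.
  by rewrite mulr_ge0.
pose c x := dot (row x) u; pose w : l2 R J := \sum_(x <- A) c x *: row x.
have -> : \sum_(x <- A) dot (row x) u ^+ 2 = dot w u.
  rewrite /w; elim/big_rec2 : _ => [|y s v _ ->]; first by rewrite dot0l.
  by rewrite dotDl dotZl expr2.
set S := dot w u; apply/ler_addgt0Pr => e e0.
have w0 : 0 < `|w| + 1 by rewrite ltr_wpDl.
have [A' uA'] := trunc_approx u (divr_gt0 e0 w0).
rewrite /S -{1}(subrK (trunc A' u) u) dotDr addrC; apply: lerD; last first.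
  rewrite (le_trans (dot_le _ _))//.
  apply: (@le_trans _ _ ((`|w| + 1) * `|u - trunc A' u|)); first by rewrite ler_wpM2r// lerDl.
  by rewrite (le_trans (ler_wpM2l (ltW w0) uA'))// mulrCA mulfV ?mulr1// gt_eqF.
have -> : dot w (trunc A' u) = \sum_(x <- (A `|` A')%fset) \sum_(y <- (A `|` A')%fset)
    K x y * ((if x \in A then c x else 0) * (if y \in A' then u y else 0)).
  rewrite dot_trunc -(sum_incl _ (fsubsetUr A A')) exchange_big/=; apply: eq_bigr => y _.
  case: ifP => _; last by rewrite big1// => x _; rewrite !mulr0.
  rewrite /w l2_sum mulr_suml -(sum_incl _ (fsubsetUl A A')); apply: eq_bigr => x _.
  by rewrite l2Z rowE; case: ifP => _; [ring|rewrite mul0r mulr0].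
apply: le_trans (form_le _ _ _) _.
have sqrif (A1 : {fset J}) (d : J -> R) : (A1 `<=` A `|` A')%fset ->
    \sum_(x <- (A `|` A')%fset) (if x \in A1 then d x else 0) ^+ 2 = \sum_(x <- A1) d x ^+ 2.
  move=> A1A; rewrite -(sum_incl _ A1A); apply: eq_bigr => x _.
  by case: ifP; rewrite ?expr0n.
rewrite !sqrif ?fsubsetUl ?fsubsetUr//.
have -> : \sum_(x <- A) c x ^+ 2 = S.
  rewrite /S /w; elim/big_rec2 : _ => [|y s v _ ->]; first by rewrite dot0l.
  by rewrite dotDl dotZl expr2.
rewrite -mulrA [X in _ <= X]mulrAC -mulrA ler_wpM2l//.
rewrite ler_wpM2l ?sqrtr_ge0// -(@ger0_norm _ `|u|)// -sqrtr_sqr.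
by rewrite ler_sqrt ?sqr_ge0// sum_sqr_le.
Qed.

Lemma matrix_op : exists2 B, pos_op B M &
  forall u x, has_sum (fun y => K x y * u y) (B u x) /\
    exists N, sums_bounded (fun y => `|K x y * u y|) N.
Proof.
have [B BE] : exists B : l2 R J -> l2 R J, forall u x, B u x = dot (row x) u.
  by exists (fun u => mkl2 (fun x => dot (row x) u)) => u x; rewrite (mkl2E (op_sqr u)).
have BD u v : B (u + v) = B u + B v by apply: l2P => x; rewrite !(BE, l2E) dotDr.
have BZ a u : B (a *: u) = a *: B u by apply: l2P => x; rewrite !(BE, l2E) dotZr.
have Bb u : `|B u| <= M * `|u|.
  apply: l2_norm_le => [|A]; first by rewrite mulr_ge0.
  by under eq_bigr do rewrite BE; exact: op_sqr.
have Bdelta y : B (delta R y) = row y.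
  by apply: l2P => x; rewrite BE dot_delta !rowE K_sym.
exists B; last first.
  move=> u x; split.
    by rewrite BE; apply: eq_has_sum (has_sum_dot _ _) => y; rewrite rowE.
  have [N HN] := sums_bounded_mul (row x) u; exists N => A.
  by under eq_bigr do rewrite -rowE; exact: HN.
split=> // [u v|u].
  apply/eqP; rewrite -subr_eq0; apply/eqP.
  (* Both terms are bounded and linear in [v]; at [delta x] each of them is the coordinate
     [B u x]. *)
  apply: (@eq0_on_delta (fun v => dot (B u) v - dot u (B v)) (2 * M * `|u|)).
  - by move=> v1 v2; rewrite BD !dotDr; ring.
  - move=> a v1. rewrite /= BZ !dotZr. by ring.
  - move=> v1; rewrite (le_trans (ler_normB _ _))//.
    have := norm_dot_le (B u) v1; have := norm_dot_le u (B v1).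
    have := ler_wpM2r (normr_ge0 v1) (Bb u); have := ler_wpM2l (normr_ge0 u) (Bb v1).
    by lra.
  - by move=> x; rewrite Bdelta dot_delta BE dotC subrr.
apply/ler_addgt0Pr => e e0.
(* Replacing [u] by a truncation [t] changes the form by at most [2 M |u| |u - t|], and the form at
   [t] is a finite sum, non-negative by [K_ge0]. *)
pose C := 2 * M * `|u| + 1; have C0 : 0 < C by rewrite ltr_wpDl ?mulr_ge0.
have [A uA] := trunc_approx u (divr_gt0 e0 C0); set t := trunc A u in uA.
have tu : `|t| <= `|u|.
  apply: l2_norm_le => // A'; apply: le_trans (sum_sqr_le u A'); apply: ler_sum => x _.
  by rewrite truncE; case: ifP => // _; rewrite expr0n sqr_ge0.
have tt : 0 <= dot (B t) t.
  have := K_ge0 A (fun x => u x); congr (_ <= _).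
  rewrite dot_trunc; apply: eq_bigr => x _; rewrite BE dot_trunc mulr_suml.
  by apply: eq_bigr => y _; rewrite rowE; ring.
have -> : dot (B u) u = dot (B t) t + (dot (B (u - t)) t + dot (B u) (u - t)).
  have -> : B (u - t) = B u - B t by rewrite BD -(scaleN1r t) BZ scaleN1r.
  by rewrite dotBl dotBr; ring.
rewrite -addrA ler_wpDl//.
have := norm_dot_le (B (u - t)) t; have := norm_dot_le (B u) (u - t).
rewrite !ler_norml => /andP[H1 _] /andP[H2 _].
have H3 : `|B u| * `|u - t| <= M * `|u| * `|u - t| by rewrite ler_wpM2r.
have H4 : `|B (u - t)| * `|t| <= M * `|u - t| * `|u|.
  by rewrite ler_pM.
have H5 : C * `|u - t| <= e.
  by rewrite (le_trans (ler_wpM2l (ltW C0) uA))// mulrCA mulfV ?mulr1// gt_eqF.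
by have := normr_ge0 (u - t); rewrite /C in H5; nra.
Qed.

End MatrixOperator.
End PositiveOperators.

(** * The symbol of the fractional Laplacian *)

Section CubeMeasure.
Variable R : realType.
Notation Rm := (measurableTypeR R).
Notation mu := (@lebesgue_measure R).

Lemma sin_shift_2piz (c : R) (k : int) : sin (c + 2 * pi * k%:~R) = sin c.
Proof.
have H (a : R) (p : nat) : sin (a + 2 * pi * p%:R) = sin a.
  have := periodicn (@sinD2pi R) p a; congr (sin _ = _); congr (_ + _).
  by rewrite mulr_natr mulr_natl.
case: k => p; first exact: H.
by rewrite NegzE rmorphN /= mulrN -[c in RHS](subrK (2 * pi * p.+1%:R)) H.
Qed.

Lemma integral_cos_period (c : R) (k : int) : k != 0 ->
  (\int[mu]_(x in `[(- 2^-1)%R, 2^-1%R]) (cos (c + 2 * pi * (k%:~R * x)))%:E = 0)%E.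
Proof.
move=> k0; pose F (x : R) := (2 * pi * k%:~R)^-1 * sin (c + 2 * pi * k%:~R * x).
have w0 : 2 * pi * k%:~R != 0 :> R by rewrite !mulf_neq0// ?intr_eq0// gt_eqF// pi_gt0.
have dF (x : R) : is_derive x 1 F (cos (c + 2 * pi * (k%:~R * x))).
  rewrite /F; apply: is_derive_eq.
  by rewrite add0r mul1r /GRing.scale/= mulr1 mulrCA mulVf// mulr1 !mulrA.
have cF (x : R) : {for x, continuous F}.
  by apply/differentiable_continuous/derivable1_diffP; have [] := dF x.
have lt1 : - 2^-1 < 2^-1 :> R by rewrite gtrN// invr_gt0.
rewrite (@continuous_FTC2 _ _ F)//=.
- have E : c + 2 * pi * k%:~R * 2^-1 = c + 2 * pi * k%:~R * - 2^-1 + 2 * pi * k%:~R.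
    by rewrite [pi]lock; field.
  by rewrite /F E sin_shift_2piz -EFinB subrr.
- apply: continuous_subspaceT => x.
  apply: (@continuous_comp _ _ _ (fun x : R => c + 2 * pi * (k%:~R * x)) cos).
    apply: cvgD; first exact: cvg_cst.
    by apply: cvgM; [exact: cvg_cst|apply: cvgM; [exact: cvg_cst|exact: cvg_id]].
  exact: continuous_cos.
- split => [x _||]; first by have [] := dF x.
  + exact/cvg_at_right_filter/cF.
  + exact/cvg_at_left_filter/cF.
- by move=> x _; rewrite derive1E; have [_ ->] := dF x.
Qed.

Definition tuple_box n (a b : R) : set (n.-tuple Rm) :=
  [set t | forall i, a <= tnth t i <= b].

Lemma measurable_tuple_box n (a b : R) : measurable (@tuple_box n a b).
Proof.
rewrite (_ : tuple_box a b = \bigcap_(i in [set: 'I_n]) ((@tnth n Rm ^~ i) @^-1` `[a, b])).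
  apply: fin_bigcap_measurable => [|i _]; first exact: finite_finset.
  by rewrite -[X in measurable X]setTI; exact: measurable_tnth.
apply/seteqP; split=> t H i; first by move=> _ /=; rewrite in_itv/= H.
by have := H i I; rewrite /= in_itv.
Qed.

Definition tuple_cons n (z : Rm * n.-tuple Rm) : n.+1.-tuple Rm := [tuple of z.1 :: z.2].

Lemma measurable_tuple_cons n : measurable_fun setT (@tuple_cons n).
Proof. exact: (measurable_cons measurable_fst measurable_snd). Qed.

Lemma preimage_tuple_box n (a b : R) :
  @tuple_cons n @^-1` tuple_box a b = `[a, b] `*` tuple_box a b.
Proof.
apply/seteqP; split=> -[x t] /=.
  move=> H; split; first by have := H ord0; rewrite in_itv.
  by move=> i; have := H (lift ord0 i); rewrite tnthS.
move=> -[]; rewrite in_itv/= => abx abt i.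
by have [->|[j ->]] : i = ord0 \/ exists j, i = lift ord0 j;
  [case: (unliftP ord0 i) => [j ->|->]; [right; exists j|left]| |rewrite tnthS].
Qed.

(** [lebesgue_measure_tuple] is a bare set function; its recursion is that of the push-forward of a
    product measure along [tuple_cons]. Sigma-finiteness has to travel through the induction because
    the product requires it, and the volume of boxes provides it. *)
Lemma tuple_measure_exists n :
  exists nu : {sigma_finite_measure set (n.-tuple Rm) -> \bar R},
    @lebesgue_measure_tuple R n = nu /\
    forall a b : R, a <= b -> nu (tuple_box a b) = ((b - a) ^+ n)%:E.
Proof.
elim: n => [|n [nu [nuE nubox]]].
  exists (@dirac _ _ ([tuple] : 0.-tuple Rm) R); split=> // a b _.
  by rewrite /= diracE mem_set ?expr0//; case.
have muE (a b : R) : a <= b -> mu `[a, b] = (b - a)%:E.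
  by move=> ab; rewrite lebesgue_measure_itv/= lte_fin; case: ltgtP ab => // -> _; rewrite subrr.
have @m : {measure set (n.+1.-tuple Rm) -> \bar R}.
  by refine (pushforward (mu \x nu)%E (@tuple_cons n)); exact: measurable_tuple_cons.
have mbox (a b : R) : a <= b -> m (tuple_box a b) = ((b - a) ^+ n.+1)%:E.
  move=> ab; rewrite /m/= /pushforward preimage_tuple_box product_measure1E//.
    by rewrite [X in (X * _)%E]muE// nubox// exprS.
  exact: measurable_tuple_box.
have sf : sigma_finite setT m.
  exists (fun k => tuple_box (- k%:R) k%:R).
    apply/seteqP; split=> // t _; have := ltac:(exact: (archi_boundP (x := \sum_i `|tnth t i|))).
    move=> /(_ (sumr_ge0 _ (fun i _ => normr_ge0 _))) tk.
    exists (Num.bound (\sum_i `|tnth t i|)) => //= i; rewrite -ler_norml.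
    apply: le_trans (ltW tk); rewrite (bigD1 i)//= lerDl; exact: sumr_ge0.
  move=> k; split; first exact: measurable_tuple_box.
  by rewrite mbox ?ltry// ge0_cp.
pose sfm := Measure_isSigmaFinite.Build _ _ _ m sf.
pose nu2 : {sigma_finite_measure set (n.+1.-tuple Rm) -> \bar R} :=
  HB.pack (m : set _ -> \bar R) (Measure.class m) sfm.
exists nu2; split=> //; apply/funext => A /=; rewrite nuE /m /pushforward /=.
by apply: eq_integral => x _ /=; congr (nu _); apply/seteqP; split=> y; rewrite /xsection/= ?inE.
Qed.

Definition lebt n : {sigma_finite_measure set (n.-tuple Rm) -> \bar R} :=
  projT1 (cid (tuple_measure_exists n)).

Lemma lebtE n : @lebesgue_measure_tuple R n = lebt n.
Proof. by rewrite /lebt; case: cid => nu []. Qed.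

Lemma lebt_box n (a b : R) : a <= b -> lebt n (tuple_box a b) = ((b - a) ^+ n)%:E.
Proof. by rewrite /lebt; case: cid => nu /= [_]; exact. Qed.

Lemma half_cubeE n : @half_cube R n = tuple_box (- 2^-1) 2^-1.
Proof. by []. Qed.

Lemma measurable_half_cube n : measurable (@half_cube R n).
Proof. exact: measurable_tuple_box. Qed.

Let half_itv : - 2^-1 <= 2^-1 :> R. Proof. by rewrite ge0_cp. Qed.

Lemma lebt_half_cube n : lebt n (@half_cube R n) = 1%E.
Proof.
by rewrite half_cubeE lebt_box// (_ : _ - _ = 1) ?expr1n//; field.
Qed.

Lemma integrable_half_cube n (f : n.-tuple Rm -> R) (M : R) :
  measurable_fun setT f -> (forall t, half_cube t -> `|f t| <= M) ->
  (lebt n).-integrable (@half_cube R n) (EFin \o f).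
Proof.
move=> mf fM; apply: measurable_bounded_integrable.
- exact: measurable_half_cube.
- by rewrite [X in (X < _)%E]lebt_half_cube ltry.
- exact: measurable_funTS.
- by exists M; split; rewrite ?num_real// => M' MM' t Dt; exact: le_trans (fM t Dt) (ltW MM').
Qed.

Definition phase n (j : 'I_n -> int) (t : n.-tuple Rm) : R :=
  2 * pi * \sum_(i < n) (j i)%:~R * tnth t i.

Lemma measurable_phase n (j : 'I_n -> int) : measurable_fun setT (phase j).
Proof.
apply: measurable_funM => //; apply: measurable_sum => i.
by apply: measurable_funM => //; exact: measurable_tnth.
Qed.

(** The free shift [c] absorbs the coordinates fixed by Fubini, and a quarter turn of it covers
    sines. If the first frequency vanishes, the other coordinates are integrated first and the
    induction hypothesis applies; otherwise the first coordinate runs over a whole number of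
    periods. *)
Lemma integral_cos_phase n (j : 'I_n -> int) (c : R) : (exists i, j i != 0) ->
  (\int[lebt n]_(t in @half_cube R n) (cos (c + phase j t))%:E = 0)%E.
Proof.
elim: n j c => [|n IH] j c [i ji]; first by case: i ji.
have mf k (j' : 'I_k -> int) (c' : R) : measurable_fun setT (fun t => cos (c' + phase j' t)).
  apply: (measurableT_comp (f := cos)); first by apply: continuous_measurable_fun; exact: continuous_cos.
  by apply: measurable_funD => //; exact: measurable_phase.
pose I : set Rm := [set` `[(- 2^-1 : R)%R, (2^-1 : R)%R]].
pose f (z : Rm * n.-tuple Rm) : R := cos (c + phase j (tuple_cons z)).
have fE x t : f (x, t) = cos (c + 2 * pi * ((j ord0)%:~R * x)
                             + phase (fun i => j (lift ord0 i)) t).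
  congr cos; rewrite -addrA; congr +%R; rewrite /phase -mulrDr big_ord_recl; congr (_ * (_ + _)).
  by apply: eq_bigr => k _; rewrite tnthS.
have mIC : measurable (I `*` @half_cube R n).
  by apply: measurableX; [exact: measurable_itv|exact: measurable_half_cube].
have mff : measurable_fun setT f := (measurableT_comp (mf _ j c) (@measurable_tuple_cons n)).
have intf : (mu \x lebt n)%E.-integrable (I `*` @half_cube R n) (EFin \o f).
  apply: measurable_bounded_integrable => //.
  - rewrite [X in (X < _)%E]product_measure1E; last 2 first.
      exact: measurable_itv.
      exact: measurable_half_cube.
    rewrite [X in (_ * X)%E]lebt_half_cube mule1 [X in (X < _)%E]lebesgue_measure_itv/=.
    by case: ifP; rewrite -?EFinB ltry.
  - exact: measurable_funTS.
  - exists 1; split; rewrite ?num_real// => M' M1 z _.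
    by apply: le_trans (ltW M1); rewrite ler_norml cos_geN1 cos_le1.
(* The recursive measure is exchanged for the push-forward of the product, to which Fubini
   applies. *)
have -> : (\int[lebt n.+1]_(t in @half_cube R n.+1) (cos (c + phase j t))%:E =
   \int[mu \x lebt n]_(z in I `*` @half_cube R n) (f z)%:E)%E.
  rewrite -preimage_tuple_box -half_cubeE.
  have @m : {measure set (n.+1.-tuple Rm) -> \bar R}.
    by refine (pushforward (mu \x lebt n)%E (@tuple_cons n)); exact: measurable_tuple_cons.
  rewrite -[RHS](@integral_pushforward _ _ _ _ _ _ (@measurable_tuple_cons n) (mu \x lebt n)%E
    _ (fun t => (cos (c + phase j t))%:E)).
  - apply: (@eq_measure_integral _ _ _ _ m) => A mA _.
    transitivity (@lebesgue_measure_tuple R n.+1 A); first by rewrite lebtE.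
    rewrite /m /= /pushforward /product_measure1 /=.
    apply: eq_integral => x _ /=; rewrite lebtE; congr (lebt n _).
    by apply/seteqP; split=> y; rewrite /xsection/= ?inE.
  - by apply/measurable_EFinP; exact: mf.
  - by rewrite half_cubeE preimage_tuple_box.
  - exact: measurable_half_cube.
have [j0|j0] := eqVneq (j ord0) 0.
  have [k jk] : exists k, j (lift ord0 k) != 0.
    by case: (unliftP ord0 i) ji => [k ->|->]; [exists k|rewrite j0 eqxx].
  rewrite integral_mkcond -integral12_prod_meas1; last first.
    exact: (integrable_mkcond _ mIC).1.
  apply: integral0_eq => x _; rewrite /fubini_F.
  have [xI|xI] := pselect (I x); last first.
    apply: integral0_eq => t _; rewrite patchE memNset//; by move=> -[].
  rewrite -[RHS](IH (fun i => j (lift ord0 i)) (c + 2 * pi * ((j ord0)%:~R * x))); last by exists k.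
  rewrite [RHS]integral_mkcond; apply: eq_integral => t _; rewrite !patchE fE.
  have [tC|tC] := pselect (@half_cube R n t); first by rewrite !mem_set.
  by rewrite !memNset// => -[].
rewrite integral_mkcond -integral21_prod_meas1; last first.
  exact: (integrable_mkcond _ mIC).1.
apply: integral0_eq => t _; rewrite /fubini_G.
have [tC|tC] := pselect (@half_cube R n t); last first.
  by apply: integral0_eq => x _; rewrite patchE memNset// => -[].
rewrite -[RHS](integral_cos_period (c + phase (fun i => j (lift ord0 i)) t) j0).
rewrite [RHS]integral_mkcond; apply: eq_integral => x _; rewrite !patchE fE.
have [xI|xI] := pselect (I x); first by rewrite !mem_set// addrAC.
by rewrite !memNset// => -[].
Qed.
End CubeMeasure.

Section Coefficients.
Variables (R : realType) (n : nat) (alpha : R).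
Hypothesis alpha_gt0 : 0 < alpha.
Notation Rm := (measurableTypeR R).
Notation Zn := 'rV[int]_n.
Implicit Types (f g : n.-tuple Rm -> R).

(** A class stable under sums and products whose members are all integrable on the cube, so that
    linearity of [cube_int] has light side conditions. *)
Definition bounded_measurable f :=
  measurable_fun setT f /\ exists M : R, forall t, `|f t| <= M.

Lemma bm_cst (c : R) : bounded_measurable (fun=> c).
Proof. by split; [exact: measurable_cst|exists `|c|]. Qed.

Lemma bmD f g : bounded_measurable f -> bounded_measurable g ->
  bounded_measurable (fun t => f t + g t).
Proof.
move=> [mf [M fM]] [mg [N gN]]; split; first exact: measurable_funD.
by exists (M + N) => t; rewrite (le_trans (ler_normD _ _))// lerD.
Qed.

Lemma bmM f g : bounded_measurable f -> bounded_measurable g ->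
  bounded_measurable (fun t => f t * g t).
Proof.
move=> [mf [M fM]] [mg [N gN]]; split; first exact: measurable_funM.
by exists (M * N) => t; rewrite normrM ler_pM.
Qed.

Lemma bm_sum (I : Type) (r : seq I) (F : I -> n.-tuple Rm -> R) :
  (forall i, bounded_measurable (F i)) -> bounded_measurable (fun t => \sum_(i <- r) F i t).
Proof.
move=> bF; elim: r => [|i r IH].
  by under eq_fun do rewrite big_nil; exact: bm_cst.
by under eq_fun do rewrite big_cons; exact: bmD.
Qed.

Definition cube_int f : R := \int[lebt R n]_(t in @half_cube R n) f t.

Let bm_int f : bounded_measurable f ->
  (lebt R n).-integrable (@half_cube R n) (EFin \o f).
Proof. by move=> [mf [M fM]]; exact: (integrable_half_cube mf (fun t _ => fM t)). Qed.

Let mcube : measurable (@half_cube R n). Proof. exact: measurable_half_cube. Qed.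

Lemma cube_intD f g : bounded_measurable f -> bounded_measurable g ->
  cube_int (fun t => f t + g t) = cube_int f + cube_int g.
Proof. by move=> bf bg; exact: (RintegralD mcube (bm_int bf) (bm_int bg)). Qed.

Lemma cube_intZ c f : bounded_measurable f ->
  cube_int (fun t => c * f t) = c * cube_int f.
Proof. by move=> bf; exact: (RintegralZl _ mcube (bm_int bf)). Qed.

Lemma cube_int_le f g : bounded_measurable f -> bounded_measurable g ->
  (forall t, f t <= g t) -> cube_int f <= cube_int g.
Proof. by move=> bf bg fg; apply: le_Rintegral => //; exact: bm_int. Qed.

Lemma cube_int_cst c : cube_int (fun=> c) = c.
Proof.
rewrite /cube_int Rintegral_cst; last exact: mcube.
by rewrite [X in fine X]lebt_half_cube mulr1.
Qed.

Lemma cube_int_sum (I : Type) (r : seq I) (F : I -> n.-tuple Rm -> R) :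
  (forall i, bounded_measurable (F i)) ->
  cube_int (fun t => \sum_(i <- r) F i t) = \sum_(i <- r) cube_int (F i).
Proof.
move=> bF; elim: r => [|i r IH].
  by rewrite big_nil -[RHS](cube_int_cst 0); congr cube_int; apply/funext => t; rewrite big_nil.
rewrite big_cons -IH -cube_intD//; last exact: bm_sum.
by congr cube_int; apply/funext => t; rewrite big_cons.
Qed.

Lemma eq_cube_int f g : f =1 g -> cube_int f = cube_int g.
Proof. by move=> /funext ->. Qed.

Lemma laplacian_symbol_ge0 (t : n.-tuple Rm) : 0 <= laplacian_symbol t.
Proof. by apply: sumr_ge0 => i _; rewrite mulr_ge0 ?sqr_ge0. Qed.

Lemma laplacian_symbol_le (t : n.-tuple Rm) : laplacian_symbol t <= 4 * n%:R.
Proof.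
rewrite (_ : 4 * n%:R = \sum_(i < n) 4); last by rewrite sumr_const card_ord mulr_natr.
apply: ler_sum => i _; rewrite ger_pMr// -(expr1n _ 2) -(@ger0_norm _ 1)//.
Qed.

Let S : R := (4 * n%:R) `^ alpha.
Let sym (t : n.-tuple Rm) : R := laplacian_symbol t `^ alpha.

Let sym_ge0 t : 0 <= sym t. Proof. exact: powR_ge0. Qed.

Let sym_le t : sym t <= S.
Proof.
apply: ge0_ler_powR; rewrite ?nnegrE ?laplacian_symbol_ge0 ?laplacian_symbol_le ?(ltW alpha_gt0)//.
Qed.

Lemma measurable_sin_comp (f : n.-tuple Rm -> R) : measurable_fun setT f ->
  measurable_fun setT (fun t => sin (f t)).
Proof.
move=> mf; apply: (measurableT_comp (f := sin)) => //.
by apply: continuous_measurable_fun; exact: continuous_sin.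
Qed.

Lemma measurable_cos_comp (f : n.-tuple Rm -> R) : measurable_fun setT f ->
  measurable_fun setT (fun t => cos (f t)).
Proof.
move=> mf; apply: (measurableT_comp (f := cos)) => //.
by apply: continuous_measurable_fun; exact: continuous_cos.
Qed.

Let bm_sin f : measurable_fun setT f -> bounded_measurable (fun t => sin (f t)).
Proof.
move=> mf; split; first exact: measurable_sin_comp.
by exists 1 => t; rewrite ler_norml sin_geN1 sin_le1.
Qed.

Let bm_cos f : measurable_fun setT f -> bounded_measurable (fun t => cos (f t)).
Proof.
move=> mf; split; first exact: measurable_cos_comp.
by exists 1 => t; rewrite ler_norml cos_geN1 cos_le1.
Qed.

Let bm_sym : bounded_measurable sym.
Proof.
split; last by exists S => t; rewrite ger0_norm.
apply: (measurableT_comp (f := fun x : R => x `^ alpha)); first exact: measurable_powR.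
apply: measurable_sum => i; apply: measurable_funM => //; apply: measurable_funX.
by apply: measurable_sin_comp; apply: measurable_funM => //; exact: measurable_tnth.
Qed.

Let ph (k : Zn) t : R := phase (fun i => k ord0 i) t.

Let mph k : measurable_fun setT (ph k). Proof. exact: measurable_phase. Qed.

Let phB k l t : ph (k - l) t = ph k t - ph l t.
Proof.
rewrite /ph /phase -mulrBr -sumrB; congr (_ * _); apply: eq_bigr => i _.
by rewrite !mxE rmorphB mulrBl.
Qed.

Let ph0 t : ph 0 t = 0.
Proof. by rewrite /ph /phase big1 ?mulr0// => i _; rewrite mxE mul0r. Qed.

(* Real and imaginary parts of the contribution of a unit mass at [p] to the
   trigonometric polynomial [\sum_k z_k e^(- 2 pi i k.t)], the boolean of [p]
   telling whether the mass is imaginary. *)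
Let X (p : Zn * bool) t : R := if p.2 then sin (ph p.1 t) else cos (ph p.1 t).
Let Y (p : Zn * bool) t : R := if p.2 then cos (ph p.1 t) else - sin (ph p.1 t).

Let bmX p : bounded_measurable (X p).
Proof. by case: p => k []; [exact: bm_sin|exact: bm_cos]. Qed.

Let bmY p : bounded_measurable (Y p).
Proof.
case: p => k []; first exact: bm_cos.
have -> : Y (k, false) = fun t => -1 * sin (ph k t) by apply/funext => t; rewrite mulN1r.
by apply: bmM; [exact: bm_cst|exact: bm_sin].
Qed.

(* The matrix of the convolution by the coefficients of the symbol, as a Gram matrix: its
   quadratic form is the integral of [sym t * |\sum_k z_k e^(- 2 pi i k.t)|^2]. *)
Definition symbol_kernel (p q : Zn * bool) : R :=
  cube_int (fun t => sym t * (X p t * X q t + Y p t * Y q t)).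

(** By the subtraction formulas the integrand depends on the two sites through their difference
    only: the kernel is a convolution. *)
Let gramE p q t : X p t * X q t + Y p t * Y q t =
  let d := ph (q.1 - p.1) t in
  if p.2 == q.2 then cos d else if q.2 then sin d else - sin d.
Proof.
by case: p q => [k []] [l []]; rewrite /X /Y/= phB ?cosB ?sinB; ring.
Qed.

(** Orthonormality of the characters in real coordinates; a sine is a cosine shifted by a quarter
    turn, so one vanishing integral serves all cases. *)
Let gram_int p q : cube_int (fun t => X p t * X q t + Y p t * Y q t) = (p == q)%:R.
Proof.
have int0 k (c : R) : k != 0 -> cube_int (fun t => cos (c + ph k t)) = 0.
  move=> k0; rewrite /cube_int /Rintegral integral_cos_phase//.
  apply/existsP; apply: contraNT k0 => /existsPn H; apply/eqP/rowP => i; rewrite mxE.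
  by apply/eqP; have := H i; rewrite negbK.
have sinE (x : R) : sin x = cos (- (pi / 2) + x) by rewrite addrC cosBpihalf.
rewrite (eq_cube_int (gramE p q)); case: p q => [k b] [l b'] /=.
rewrite xpair_eqE; have [->|kl] := eqVneq k l.
  rewrite subrr/=; have [_|bb] := eqVneq b b'.
    by rewrite -[RHS]cube_int_cst; apply: eq_cube_int => t; rewrite ph0 cos0.
  by rewrite -[RHS]cube_int_cst; apply: eq_cube_int => t; rewrite ph0 sin0; case: ifP; rewrite ?oppr0.
have lk : l - k != 0 by rewrite subr_eq0 eq_sym. rewrite andFb -[RHS]/(0 : R).
case: eqP => _ /=.
  by rewrite -(int0 _ 0 lk); apply: eq_cube_int => t; rewrite add0r.
case: b'.
  by rewrite -(int0 _ (- (pi / 2)) lk); apply: eq_cube_int => t; rewrite sinE.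
transitivity (-1 * cube_int (fun t => cos (- (pi / 2) + ph (l - k) t))).
  rewrite -cube_intZ; first by apply: eq_cube_int => t; rewrite sinE mulN1r.
  by apply: bm_cos; apply: measurable_funD.
by rewrite int0// mulr0.
Qed.

Lemma symbol_kernel_sym p q : symbol_kernel p q = symbol_kernel q p.
Proof. by apply: eq_cube_int => t; congr (_ * (_ + _)); exact: mulrC. Qed.

(** The weight is left free because it takes two values: the symbol, for positivity, and a constant,
    to reduce the upper bound to orthonormality. *)
Let form_expand (w : n.-tuple Rm -> R) (A : {fset Zn * bool}) (c : Zn * bool -> R) :
  bounded_measurable w ->
  \sum_(p <- A) \sum_(q <- A)
     cube_int (fun t => w t * (X p t * X q t + Y p t * Y q t)) * (c p * c q) =
  cube_int (fun t => w t * ((\sum_(p <- A) c p * X p t) ^+ 2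
                            + (\sum_(p <- A) c p * Y p t) ^+ 2)).
Proof.
move=> bw.
have bg p q : bounded_measurable (fun t => w t * (X p t * X q t + Y p t * Y q t)).
  by apply: bmM => //; apply: bmD; apply: bmM.
have bgc p q : bounded_measurable
    (fun t => (c p * c q) * (w t * (X p t * X q t + Y p t * Y q t))).
  by apply: bmM => //; exact: bm_cst.
transitivity (cube_int (fun t => \sum_(p <- A) \sum_(q <- A)
    (c p * c q) * (w t * (X p t * X q t + Y p t * Y q t)))).
  rewrite cube_int_sum => [|p]; last exact: bm_sum.
  apply: eq_bigr => p _; rewrite cube_int_sum//; apply: eq_bigr => q _.
  by rewrite cube_intZ// mulrC.
apply: eq_cube_int => t; rewrite !expr2 mulrDr !mulr_suml !mulr_sumr -big_split/=.
apply: eq_bigr => p _; rewrite !mulr_sumr -big_split/=; apply: eq_bigr => q _; ring.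
Qed.

Lemma symbol_kernel_ge0 (A : {fset Zn * bool}) (c : Zn * bool -> R) :
  0 <= \sum_(p <- A) \sum_(q <- A) symbol_kernel p q * (c p * c q).
Proof.
rewrite form_expand; last exact: bm_sym.
by apply: Rintegral_ge0 => t _; rewrite mulr_ge0 ?addr_ge0 ?sqr_ge0.
Qed.

(** Under the integral, the symbol multiplies a sum of two squares and may be replaced by its bound
    [S]; with this constant weight the kernel is [S] times the identity. *)
Lemma symbol_kernel_le (A : {fset Zn * bool}) (c : Zn * bool -> R) :
  \sum_(p <- A) \sum_(q <- A) symbol_kernel p q * (c p * c q) <=
  (4 * n%:R) `^ alpha * \sum_(p <- A) c p ^+ 2.
Proof.
have bp (Z : Zn * bool -> n.-tuple Rm -> R) : (forall p, bounded_measurable (Z p)) ->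
    bounded_measurable (fun t => (\sum_(p <- A) c p * Z p t) ^+ 2).
  move=> bZ; under eq_fun do rewrite expr2.
  by apply: bmM; apply: bm_sum => p; apply: bmM => //; exact: bm_cst.
rewrite form_expand; last exact: bm_sym.
apply: (@le_trans _ _ (cube_int (fun t => S * ((\sum_(p <- A) c p * X p t) ^+ 2
                            + (\sum_(p <- A) c p * Y p t) ^+ 2)))).
  apply: cube_int_le.
  - by apply: bmM; [exact: bm_sym|apply: bmD; exact: bp].
  - by apply: bmM; [exact: bm_cst|apply: bmD; exact: bp].
  - by move=> t; rewrite ler_wpM2r// addr_ge0 ?sqr_ge0.
rewrite -form_expand; last exact: bm_cst.
rewrite mulr_sumr le_eqVlt; apply/orP; left; apply/eqP; apply: eq_big_seq => p pA.
have kE q : cube_int (fun t => S * (X p t * X q t + Y p t * Y q t)) = S * (p == q)%:R.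
  by rewrite cube_intZ ?gram_int//; apply: bmD; apply: bmM.
rewrite (big_fsetD1 p)//= kE eqxx mulr1 -expr2 big1_fset ?addr0// => q.
by rewrite !inE kE eq_sym => /andP[/negPf -> _] _; rewrite mulr0 mul0r.
Qed.

Lemma fraclap_coefE (j : Zn) :
  fraclap_coef alpha j =
  (cube_int (fun t => sym t * cos (ph j t)) +i* - cube_int (fun t => sym t * sin (ph j t)))%C.
Proof.
rewrite /fraclap_coef /cube_integral lebtE; congr (_ +i* _)%C.
  by congr fine; apply: eq_integral => t _; rewrite /expi/= cosN mul0r subr0.
have bs : bounded_measurable (fun t => sym t * sin (ph j t)).
  by apply: bmM; [exact: bm_sym|exact: bm_sin].
rewrite -mulN1r -cube_intZ//.
congr fine; apply: eq_integral => t _; rewrite /expi/= sinN mul0r addr0 mulrN mulN1r.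
by [].
Qed.

(** The two-by-two real blocks of multiplication by the complex coefficient of index [l - k]. *)
Lemma symbol_kernelE (k l : Zn) (b b' : bool) :
  symbol_kernel (k, b) (l, b') =
  if b == b' then complex.Re (fraclap_coef alpha (l - k))
  else if b then complex.Im (fraclap_coef alpha (l - k))
  else - complex.Im (fraclap_coef alpha (l - k)).
Proof.
rewrite fraclap_coefE /= /symbol_kernel.
under eq_cube_int do rewrite gramE/=.
case: b b' => [] [] //=; last by rewrite opprK.
rewrite -mulN1r -cube_intZ; last by apply: bmM; [exact: bm_sym|exact: bm_sin].
by apply: eq_cube_int => t; rewrite mulN1r mulrN.
Qed.

End Coefficients.

(** * Vector-valued integrals and absolutely continuous functions *)

(* The coordinatewise integral; [mkl2] makes it 0 when the coordinates are not square
   summable. *)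
HB.lock Definition vint (R : realType) (J : choiceType) (D : set (measurableTypeR R))
    (g : R -> l2 R J) : l2 R J :=
  mkl2 (fun x => \int[@lebesgue_measure R]_(s in D) g s x).

Section VectorIntegral.
Variables (R : realType) (J : countType).
Notation mu := (@lebesgue_measure R).
Implicit Types (g h : R -> l2 R J) (w : l2 R J) (D E : set (measurableTypeR R)).

(** An exhausting sequence of finite sets: over a countable index, inner products become sequential
    limits of finite sums, hence measurable in time. *)
Definition first_indices (k : nat) : {fset J} := [fset x in pmap (@choice.unpickle J) (iota 0 k)]%fset.

Lemma mem_first_indices k x : (choice.pickle x < k)%N -> x \in first_indices k.
Proof.
move=> xk; rewrite !inE mem_pmap; apply/mapP.
by exists (choice.pickle x); rewrite ?mem_iota ?choice.pickleK.
Qed.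

Lemma has_sum_cvg (F : J -> R) s : has_sum F s ->
  (fun k => \sum_(x <- first_indices k) F x) @ \oo --> s.
Proof.
move=> Fs; apply/cvgrPdist_le => e e0; have [A HA] := Fs e e0.
exists (\max_(x <- A) (choice.pickle x).+1)%N => // k /= Ak; rewrite distrC; apply: HA.
apply/fsubsetP => x xA; apply: mem_first_indices; apply: leq_trans Ak.
exact: (@leq_bigmax_seq _ _ xpredT (fun y => (choice.pickle y).+1) x).
Qed.

Lemma sum_mul_le (A : {fset J}) (c : J -> R) w :
  \sum_(x <- A) c x * w x <= `|w| * Num.sqrt (\sum_(x <- A) c x ^+ 2).
Proof.
pose v : l2 R J := \sum_(x <- A) c x *: delta R x.
have dv u : dot u v = \sum_(x <- A) c x * u x.
  rewrite /v; elim/big_rec2 : _ => [|x s t _ <-]; first by rewrite dot0r.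
  by rewrite dotDr dotZr dot_delta.
rewrite -dv (le_trans (dot_le _ _))// ler_wpM2l// l2_normE dv.
rewrite (eq_big_seq (fun x => c x ^+ 2))// => x xA; rewrite expr2; congr (_ * _).
rewrite /v l2_sum (big_fsetD1 x)//= l2E deltaE eqxx mulr1 big1_fset ?addr0// => z.
by rewrite !inE l2E deltaE eq_sym => /andP[/negPf -> _]; rewrite mulr0.
Qed.

Definition vmeas g := forall x, measurable_fun [set: measurableTypeR R] (fun s => g s x).

Lemma vmeas_dot g h : vmeas g -> vmeas h -> measurable_fun [set: measurableTypeR R] (fun s => dot (g s) (h s)).
Proof.
move=> mg mh; apply: (@measurable_fun_cvg _ _ _ _
   (fun k s => \sum_(x <- first_indices k) g s x * h s x)) => [k|s _].
  by apply: measurable_sum => x; exact: (measurable_funM (mg x) (mh x)).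
by apply: has_sum_cvg; exact: has_sum_dot.
Qed.

Lemma vmeas_norm g : vmeas g -> measurable_fun [set: measurableTypeR R] (fun s => `|g s|).
Proof.
move=> mg; rewrite (_ : (fun s => _) = Num.sqrt \o (fun s => dot (g s) (g s)))//.
apply: measurableT_comp; last exact: vmeas_dot.
by apply: continuous_measurable_fun; exact: sqrt_continuous.
Qed.

Lemma vmeas_cst w : vmeas (fun=> w).
Proof. by move=> x; exact: measurable_cst. Qed.

Lemma vmeasD g h : vmeas g -> vmeas h -> vmeas (fun s => g s + h s).
Proof. by move=> mg mh x; under eq_fun do rewrite l2D; exact: measurable_funD. Qed.

Lemma vmeasZ (a : R -> R) g : measurable_fun [set: measurableTypeR R] a -> vmeas g ->
  vmeas (fun s => a s *: g s).
Proof. by move=> ma mg x; under eq_fun do rewrite l2Z; exact: measurable_funM. Qed.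

Lemma vmeasN g : vmeas g -> vmeas (fun s => - g s).
Proof. by move=> mg x; under eq_fun do rewrite l2N; exact: measurable_funN. Qed.

Lemma vmeasB g h : vmeas g -> vmeas h -> vmeas (fun s => g s - h s).
Proof. by move=> mg mh; apply: vmeasD => //; exact: vmeasN. Qed.

Definition vintegrable D g := vmeas g /\ mu.-integrable D (fun s => `|g s|%:E).

Lemma vintegrable_dom D g (G : R -> R) : measurable D -> vmeas g ->
  mu.-integrable D (EFin \o G) -> (forall s, D s -> `|g s| <= G s) -> vintegrable D g.
Proof.
move=> mD mg iG gG; split => //; apply: (le_integrable mD _ _ iG).
  by apply/measurable_EFinP/measurable_funTS; exact: vmeas_norm.
by move=> s Ds; rewrite /= lee_fin normr_id (le_trans (gG s Ds))// ler_norm.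
Qed.

Lemma vintegrableS D E g : measurable D -> measurable E -> E `<=` D ->
  vintegrable D g -> vintegrable E g.
Proof. by move=> mD mE ED [mg ig]; split => //; exact: (integrableS mD mE ED). Qed.

Lemma vintegrableD D g h : measurable D -> vintegrable D g -> vintegrable D h ->
  vintegrable D (fun s => g s + h s).
Proof.
move=> mD [mg ig] [mh ih]; apply: (vintegrable_dom mD (vmeasD mg mh) (integrableD mD ig ih)).
by move=> s _; exact: ler_normD.
Qed.

Lemma vintegrableZ D g a : measurable D -> vintegrable D g ->
  vintegrable D (fun s => a *: g s).
Proof.
move=> mD [mg ig].
apply: (vintegrable_dom mD (G := fun s => `|a| * `|g s|)).
- by apply: vmeasZ.
- exact: (integrableZl mD `|a| ig).
- by move=> s _; rewrite l2_normZ.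
Qed.

Section On.
Variable D : set (measurableTypeR R).
Hypothesis mD : measurable D.

Lemma integrable_dot g w : vintegrable D g ->
  mu.-integrable D (fun s => (dot (g s) w)%:E).
Proof.
move=> [mg ig]; apply: (le_integrable mD _ _ (integrableZl mD `|w| ig)).
  apply/measurable_EFinP/measurable_funTS; apply: vmeas_dot => //; exact: vmeas_cst.
move=> s _; rewrite /= lee_fin normrM !normr_id mulrC; exact: norm_dot_le.
Qed.

Lemma integrable_coord g x : vintegrable D g ->
  mu.-integrable D (fun s => (g s x)%:E).
Proof.
by move=> ig; have := integrable_dot (delta R x) ig; under eq_fun do rewrite dot_delta.
Qed.

(** Minkowski's inequality by duality: with [c] the family of integrals, the sum of the [c x ^+ 2]
    is the integral of the pairing of [c] with [g s], at most [|g s|] times the norm of [c]. *)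
Let vint_sqr g : vintegrable D g -> forall A : {fset J},
  \sum_(x <- A) (\int[mu]_(s in D) g s x) ^+ 2 <= (\int[mu]_(s in D) `|g s|) ^+ 2.
Proof.
move=> ig A; have I0 : 0 <= \int[mu]_(s in D) `|g s| by exact: Rintegral_ge0.
apply: le_sqr_of_le_sqrt => //; first by apply: sumr_ge0 => x _; exact: sqr_ge0.
pose c x := \int[mu]_(s in D) g s x.
have key (r : seq J) : mu.-integrable D (fun s => (\sum_(x <- r) c x * g s x)%:E) /\
    \sum_(x <- r) c x * c x = \int[mu]_(s in D) (\sum_(x <- r) c x * g s x).
  elim: r => [|x r [IH1 IH2]].
    split; first by under eq_fun do rewrite big_nil; exact: integrable0.
    by rewrite big_nil -[LHS](mul0r (fine (mu D))) -Rintegral_cst//; apply: eq_Rintegral => s _;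
      rewrite big_nil.
  have ix : mu.-integrable D (fun s => (c x * g s x)%:E).
    exact: (integrableZl mD _ (integrable_coord x ig)).
  split.
    by under eq_fun do rewrite big_cons EFinD; exact: integrableD.
  rewrite big_cons IH2 {2}/c -RintegralZl//; last exact: integrable_coord.
  by rewrite -RintegralD//; apply: eq_Rintegral => s _; rewrite big_cons.
rewrite [leLHS](eq_bigr (fun x => c x * c x)) => [|x _]; last by rewrite expr2.
have [i1 E1] := key A; rewrite [leLHS]E1.
rewrite -RintegralZr//; last by case: ig.
apply: le_Rintegral => // [|s _]; first by case: ig => _ ig; exact: (integrableZr mD _ ig).
exact: sum_mul_le.
Qed.

Lemma vintE g x : vintegrable D g -> vint D g x = \int[mu]_(s in D) g s x.
Proof. by rewrite unlock => /vint_sqr/mkl2E ->. Qed.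

Lemma vint_norm g : vintegrable D g -> `|vint D g| <= \int[mu]_(s in D) `|g s|.
Proof. by rewrite unlock => ig; apply: mkl2_norm (vint_sqr ig); exact: Rintegral_ge0. Qed.

Lemma vint_norm_le g (G : R -> R) : vintegrable D g -> mu.-integrable D (EFin \o G) ->
  (forall s, D s -> `|g s| <= G s) -> `|vint D g| <= \int[mu]_(s in D) G s.
Proof.
move=> ig iG gG; rewrite (le_trans (vint_norm ig))//; apply: le_Rintegral => //.
by case: ig.
Qed.

Lemma vintD g h : vintegrable D g -> vintegrable D h ->
  vint D (fun s => g s + h s) = vint D g + vint D h.
Proof.
move=> ig ih; apply: l2P => x; rewrite l2D !vintE//; last exact: vintegrableD.
by rewrite -RintegralD//; exact: integrable_coord.
Qed.

Lemma vintZ g a : vintegrable D g -> vint D (fun s => a *: g s) = a *: vint D g.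
Proof.
move=> ig; apply: l2P => x; rewrite l2Z !vintE//; last exact: vintegrableZ.
by rewrite -RintegralZl//; exact: integrable_coord.
Qed.

Lemma vintegrable_cst w : (mu D < +oo)%E -> vintegrable D (fun=> w).
Proof.
move=> Doo; split; first exact: vmeas_cst.
by apply: (measurable_bounded_integrable mD) => //; exists `|w|; split;
  rewrite ?num_real// => M wM s _ /=; rewrite normr_id ltW.
Qed.

Lemma vint_cst w : (mu D < +oo)%E -> vint D (fun=> w) = fine (mu D) *: w.
Proof.
move=> Doo; apply: l2P => x; rewrite l2Z vintE; last exact: vintegrable_cst.
by rewrite (Rintegral_cst mu mD) mulrC.
Qed.

End On.

Lemma vint_setU D E g : measurable D -> measurable E -> vintegrable (D `|` E) g ->
  [disjoint D & E] -> vint (D `|` E) g = vint D g + vint E g.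
Proof.
move=> mD mE ig DE; have mDE := measurableU _ _ mD mE.
have iD : vintegrable D g by apply: vintegrableS ig => //; exact: subsetUl.
have iE : vintegrable E g by apply: vintegrableS ig => //; exact: subsetUr.
apply: l2P => x; rewrite l2D !vintE// Rintegral_setU//; exact: integrable_coord.
Qed.

End VectorIntegral.

(** * Monotonicity of absolutely continuous functions *)

Section AbsolutelyContinuousMonotone.
Variable R : realType.
Notation mu := (@lebesgue_measure R).
Implicit Types (psi : R -> R) (T : R).

Definition ac_on T psi := forall e : R, 0 < e -> exists2 d : R, 0 < d &
  forall (N : nat) (a b : 'I_N -> R),
    (forall i, 0 <= a i /\ a i <= b i /\ b i <= T) ->
    (forall i j, i != j -> b i <= a j \/ b j <= a i) ->
    \sum_(i < N) (b i - a i) < d -> \sum_(i < N) `|psi (b i) - psi (a i)| < e.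

(** The intervals are listed from right to left, the order in which [tagged_partition] puts them at
    the head of its list. *)
Lemma measure_disjoint_itvs (s : seq (R * R)) :
  all (fun p => p.1 <= p.2) s -> pairwise (fun p q => q.2 <= p.1) s ->
  mu (\big[setU/set0]_(p <- s) [set` `]p.1, p.2]]) = (\sum_(p <- s) (p.2 - p.1))%:E.
Proof.
have m1 (p : R * R) : @measurable _ (measurableTypeR R) [set` `]p.1, p.2]] by exact: measurable_itv.
elim: s => [|p s IH] /=; first by rewrite !big_nil measure0.
move=> /andP[p12 sle] /andP[ps pws]; rewrite !big_cons measureU//; last 2 first.
- by apply: bigsetU_measurable => q _.
- rewrite predeqE => x; split=> //= -[]; rewrite in_itv/= => /andP[p1x _].
  rewrite -bigcup_seq => -[q /= qs]; rewrite in_itv/= => /andP[_ xq].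
  by move/allP: ps => /(_ _ qs) qp; have := lt_le_trans p1x (le_trans xq qp); rewrite ltxx.
rewrite EFinD; congr (_ + _)%E; last exact: IH.
rewrite [LHS]lebesgue_measure_itv/= lte_fin.
by case: ltgtP p12 => // -> _; rewrite subrr.
Qed.

(* The tagged partition of [0, T] is built by real induction: an interval tagged
   at a good point contributes at most [e] times its length, the other ones lie
   in the open set [U]. *)
Lemma tagged_partition T psi (U : set R) (e : R) : 0 <= T -> 0 < e -> open U ->
  (forall t, 0 <= t <= T -> ~ U t -> exists2 r, 0 < r &
     forall s, 0 <= s <= T -> `|s - t| < r ->
       (t <= s -> psi s - psi t <= e * (s - t)) /\
       (s <= t -> psi t - psi s <= e * (t - s))) ->
  exists s : seq (R * R), [/\ all (fun p => p.1 <= p.2) s,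
    pairwise (fun p q => q.2 <= p.1) s,
    forall p, p \in s -> [/\ 0 <= p.1, p.2 <= T & forall z, p.1 <= z <= p.2 -> U z] &
    psi T - psi 0 <= e * T + \sum_(p <- s) (psi p.2 - psi p.1)].
Proof.
move=> T0 e0 oU good.
pose bad (x : R) (s : seq (R * R)) := [/\ all (fun p => p.1 <= p.2) s,
  pairwise (fun p q => q.2 <= p.1) s &
  forall p, p \in s -> [/\ 0 <= p.1, p.2 <= x & forall z, p.1 <= z <= p.2 -> U z]].
pose P x := 0 <= x <= T /\ exists s, bad x s /\
  psi x - psi 0 <= e * x + \sum_(p <- s) (psi p.2 - psi p.1).
have badW x y s : x <= y -> bad x s -> bad y s.
  move=> xy [s1 s2 s3]; split=> // p /s3[p0 px pU]; split=> //; exact: le_trans xy.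
have P0 : P 0.
  split; first by rewrite lexx.
  by exists [::]; split; [split|rewrite big_nil subrr mulr0 addr0].
have supP : has_sup P by split; [exists 0|exists T => x [/andP[]]].
set c := sup P.
have c0 : 0 <= c by exact: sup_upper_bound.
have cT : c <= T by apply: sup_le_ub => //; [by exists 0|move=> x [/andP[]]].
have good_step x y : P x -> x <= y -> y <= T ->
    psi y - psi x <= e * (y - x) -> P y.
  move=> [/andP[x0 xT] [s [bs sx]]] xy yT pxy; split; first by rewrite (le_trans x0).
  by exists s; split; [exact: badW bs|lra].
have bad_step x y : P x -> x <= y -> y <= T -> (forall z, x <= z <= y -> U z) -> P y.
  move=> [/andP[x0 xT] [s [[s1 s2 s3] sx]]] xy yT xyU.
  split; first by rewrite (le_trans x0).
  exists ((x, y) :: s); split; last first.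
    have exy : e * x <= e * y by rewrite ler_pM2l.
    by rewrite big_cons/=; lra.
  split=> [||p]; first by rewrite /= xy.
    by rewrite /= s2 andbT; apply/allP => p /s3[].
  rewrite inE => /orP[/eqP ->//|/s3[p0 px pU]]; split=> //; exact: le_trans xy.
(* Crossing the supremum [c]: if [c] lies in [U], a single listed interval joins [x] to [y]; if not,
   the pieces on both sides are tagged at [c]. *)
have [r r0 Hr] : exists2 r, 0 < r & forall x y, P x -> c - r < x -> x <= c -> c <= y ->
    y < c + r -> y <= T -> P y.
  have [Uc|Uc] := pselect (U c).
    have /nbhs_ballP[r /= r0 rU] := open_nbhs_nbhs (conj oU Uc).
    exists r => // x y Px cx xc cy yc yT; apply: (bad_step x y) => //.
      exact: le_trans cy.
    move=> z /andP[xz zy]; apply: rU; rewrite /ball/= ltr_distlC.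
    by rewrite (lt_le_trans cx xz) (le_lt_trans zy yc).
  have c0T : 0 <= c <= T by rewrite c0.
  have [r r0 Hr] := good c c0T Uc; exists r => // x y Px cx xc cy yc yT.
  have [/andP[x0 xT] _] := Px.
  have Pc : P c.
    apply: (good_step x c) => //; have := Hr x; rewrite x0 xT.
    by rewrite distrC ger0_norm ?subr_ge0// => /(_ isT)[|_ -> //]; lra.
  apply: (good_step c y) => //; have := Hr y; rewrite (le_trans c0 cy) yT.
  by rewrite ger0_norm ?subr_ge0// => /(_ isT)[|-> //]; lra.
have [x Px cx] := sup_adherent r0 supP.
have xc : x <= c by exact: sup_upper_bound.
have PT : P T.
  have [cT'|cT'] := eqVneq c T.
    rewrite -cT'; apply: (Hr x c) => //; first by rewrite ltrDl.
  have cT1 : c < T by rewrite lt_neqAle cT'.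
  pose y := Num.min T (c + r / 2).
  have cy : c < y by rewrite lt_min cT1 ltrDl divr_gt0.
  have : P y.
    apply: (Hr x y) => //; [exact: ltW| |by rewrite ge_min lexx].
    by rewrite gt_min; apply/orP; right; lra.
  by move=> /(sup_upper_bound supP); rewrite leNgt cy.
by have [_ [s [[s1 s2 s3] sT]]] := PT; exists s.
Qed.

(** With [U] empty no interval can be listed, since it would lie in [U]; the good increments alone
    remain. *)
Lemma monotone_of_good T psi : 0 <= T ->
  (forall t, 0 <= t <= T -> forall e, 0 < e -> exists2 r, 0 < r &
     forall s, 0 <= s <= T -> `|s - t| < r ->
       (t <= s -> psi s - psi t <= e * (s - t)) /\
       (s <= t -> psi t - psi s <= e * (t - s))) ->
  psi T <= psi 0.
Proof.
move=> T0 good; rewrite -subr_le0; apply/ler_addgt0Pr => e e0; rewrite add0r.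
have T1 : 0 < T + 1 by rewrite ltr_wpDl.
have eT : 0 < e / (T + 1) by rewrite divr_gt0.
have [|s [s1 _ s3 sT]] := @tagged_partition T psi set0 (e / (T + 1)) T0 eT open0.
  by move=> t tT _; exact: good.
case: s s1 s3 sT => [_ _|p s /= /andP[p12 _] /(_ p (mem_head _ _))[_ _ H]].
  rewrite big_nil addr0 => /le_trans; apply; rewrite mulrAC ler_pdivrMr//.
  by rewrite ler_wpM2l ?(ltW e0)// lerDl.
by case: (H p.1); rewrite lexx.
Qed.

(** The null set is covered by an open set of measure below the modulus [d]. The listed intervals
    are disjoint and lie in it, so absolute continuity makes their total contribution less than
    [e]. *)
Lemma ac_nonincreasing T psi (N : set R) : 0 <= T -> ac_on T psi -> mu.-negligible N ->
  (forall t, 0 <= t <= T -> ~ N t -> forall e, 0 < e -> exists2 r, 0 < r &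
     forall s, 0 <= s <= T -> `|s - t| < r ->
       (t <= s -> psi s - psi t <= e * (s - t)) /\
       (s <= t -> psi t - psi s <= e * (t - s))) ->
  psi T <= psi 0.
Proof.
move=> T0 ac [A [mA A0 NA]] good.
have step e : 0 < e -> psi T - psi 0 <= e * T + e.
  move=> e0; have [d d0 Hd] := ac _ e0.
  have [U [oU AU UAd]] : exists U, [/\ open U, A `<=` U & (mu U < d%:E)%E].
    have Aoo : (mu A < +oo)%E by rewrite A0 ltry.
    have [U [oU AU UA]] := lebesgue_regularity_outer mA Aoo d0.
    exists U; split=> //; rewrite -(setDUK AU) setUC measureU0//.
    by apply: measurableD => //; exact: open_measurable.
  have [|s [s1 s2 s3 sT]] := tagged_partition (psi := psi) T0 e0 oU.
    by move=> t tT Ut; apply: good => // /NA/AU.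
  rewrite (le_trans sT)// lerD2l ltW//.
  pose a (i : 'I_(size s)) := (nth (0, 0) s i).1.
  pose b (i : 'I_(size s)) := (nth (0, 0) s i).2.
  have sumE (F : R * R -> R) : \sum_(p <- s) F p = \sum_(i < size s) F (nth (0, 0) s i).
    by rewrite (big_nth (0, 0)) big_mkord.
  have mem i : (nth (0, 0) s (i : 'I_(size s))) \in s by rewrite mem_nth.
  apply: le_lt_trans (Hd (size s) a b _ _ _).
  - rewrite (sumE (fun p => psi p.2 - psi p.1)); apply: ler_sum => i _; exact: ler_norm.
  - move=> i; have [p0 pT _] := s3 _ (mem i); split=> //; split=> //.
    by have /allP := s1; apply.
  - move=> i j ij; have /(pairwiseP (0, 0)) sP := s2.
    have [ij'|ji|/val_inj E] := ltngtP i j; last by rewrite E eqxx in ij.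
      by right; apply: sP => //; rewrite inE.
    by left; apply: sP => //; rewrite inE.
  - rewrite -(sumE (fun p => p.2 - p.1)) -lte_fin -measure_disjoint_itvs//.
    apply: le_lt_trans UAd; apply: le_measure; rewrite ?inE.
    + by apply: bigsetU_measurable => p _; exact: measurable_itv.
    + exact: open_measurable.
    + rewrite -bigcup_seq => x0 [p /= /s3[_ _ pU]]; rewrite in_itv/= => /andP[/ltW p1 p2].
      by apply: pU; rewrite p1.
rewrite -subr_le0; apply/ler_addgt0Pr => e e0; rewrite add0r.
have T1 : 0 < T + 1 by rewrite ltr_wpDl.
have := step (e / (T + 1)) (divr_gt0 e0 T1).
by rewrite -{2}(mulr1 (e / (T + 1))) -mulrDr divfK// gt_eqF.
Qed.
End AbsolutelyContinuousMonotone.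

Section IntegralAbsoluteContinuity.
Variable R : realType.
Notation mu := (@lebesgue_measure R).
Notation Rm := (measurableTypeR R).

(** The sum over disjoint intervals is one integral over their union, a set of measure less than
    [d]. *)
Lemma integral_ac (T : R) (phi : R -> R) :
  (forall s, 0 <= phi s) -> mu.-integrable `[0, T] (EFin \o phi) ->
  forall e, 0 < e -> exists2 d : R, 0 < d &
  forall (N : nat) (a b : 'I_N -> R),
    (forall i, 0 <= a i /\ a i <= b i /\ b i <= T) ->
    (forall i j, i != j -> b i <= a j \/ b j <= a i) ->
    \sum_(i < N) (b i - a i) < d ->
    \sum_(i < N) \int[mu]_(s in `]a i, b i]) phi s < e.
Proof.
move=> phi0 iphi e e0.
have mT : measurable (`[0, T]%classic : set Rm) by exact: measurable_itv.
have iT : mu.-integrable setT (EFin \o (phi \_ `[0, T])).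
  by rewrite -restrict_EFin; exact: (integrable_mkcond _ mT).1.
have [d [d0 Hd]] := integral_normr_continuous iT e0.
exists d => // N a b ab disj sumd.
pose F (i : 'I_N) : set Rm := [set` `]a i, b i]].
have mF i : measurable (F i) by exact: measurable_itv.
have FT i : F i `<=` [set` `[0, T]].
  move=> x; rewrite /F /= !in_itv/= => /andP[ax xb]; have [a0 [_ bT]] := ab i.
  by rewrite (le_trans a0 (ltW ax)) (le_trans xb).
have tF : trivIset [set` enum 'I_N] F.
  move=> i j _ _ [x []]; rewrite /F /= !in_itv/= => /andP[ax xb] /andP[ax' xb'].
  apply/eqP; apply: contraT => /disj[] H; first by have := lt_le_trans ax' (le_trans xb H); rewrite ltxx.
  by have := lt_le_trans ax (le_trans xb' H); rewrite ltxx.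
pose U : set Rm := \big[setU/set0]_(i <- enum 'I_N) F i.
have mU : measurable U by apply: bigsetU_measurable => i _.
have UT : U `<=` [set` `[0, T]].
  by rewrite /U -bigcup_seq => x [i _]; exact: FT.
have muF i : mu (F i) = (b i - a i)%:E.
  have [_ [le_ab _]] := ab i.
  by rewrite [LHS]lebesgue_measure_itv/= lte_fin; case: ltgtP le_ab => // -> _; rewrite subrr.
have muU : (mu U < d%:E)%E.
  rewrite -[X in (X < _)%E]mul1e -integral_cst// ge0_integral_bigsetU ?enum_uniq//=.
  rewrite (eq_bigr (fun i => (b i - a i)%:E)) => [|i _]; last first.
    by rewrite integral_cst// mul1e; exact: muF.
  by rewrite sumEFin lte_fin big_enum.
have iF i : mu.-integrable (F i) (EFin \o phi).
  by apply: integrableS iphi => //; exact: FT.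
have iU : mu.-integrable U (EFin \o phi) by apply: integrableS iphi.
apply: le_lt_trans (Hd U mU muU); rewrite -lee_fin.
rewrite (_ : \int[mu]_(x in U) _ = \int[mu]_(x in U) phi x); last first.
  by apply: eq_Rintegral => x /set_mem/UT xT; rewrite patchE mem_set// ger0_norm.
rewrite /Rintegral fineK; last exact: integrable_fin_num.
rewrite -sumEFin; under eq_bigr => i _ do rewrite fineK ?(integrable_fin_num (mF i))//.
rewrite /U ge0_integral_bigsetU ?enum_uniq//=; last 2 first.
- by case/integrableP: iU.
- by move=> x _; rewrite lee_fin.
by rewrite big_enum.
Qed.

End IntegralAbsoluteContinuity.

(** * Indefinite integrals of vector-valued functions *)

Section Primitive.
Variables (R : realType) (J : countType) (T : R).
Hypothesis T_ge0 : 0 <= T.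
Notation mu := (@lebesgue_measure R).
Notation Rm := (measurableTypeR R).
Implicit Types (g h : R -> l2 R J) (w : l2 R J) (t s : R).

(** Times are projected to [0, T], so that primitives are defined and continuous on the whole
    line. *)
Definition clip t : R := Num.max 0 (Num.min t T).

Lemma clip_in t : 0 <= clip t <= T.
Proof. by rewrite /clip le_max lexx/= ge_max T_ge0 ge_min lexx orbT. Qed.

Lemma clip_id t : 0 <= t <= T -> clip t = t.
Proof.
by move=> /andP[t0 tT]; rewrite /clip (min_idPl tT) (max_idPr t0).
Qed.

Lemma clip_lip s t : `|clip s - clip t| <= `|s - t|.
Proof.
have maxl (a b : R) : `|Num.max 0 a - Num.max 0 b| <= `|a - b|.
  by case: (leP 0 a) => ?; case: (leP 0 b) => ?; rewrite ?subrr ?normr0//;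
    rewrite ?subr0 ?sub0r ler_norml; case: ler0P => ?; apply/andP; split; lra.
have minl (a b : R) : `|Num.min a T - Num.min b T| <= `|a - b|.
  by case: (leP a T) => ?; case: (leP b T) => ?; rewrite ?subrr ?normr0//;
    rewrite ler_norml; case: ler0P => ?; apply/andP; split; lra.
exact: le_trans (maxl _ _) (minl _ _).
Qed.

Lemma measurable_itvD (i : interval R) : measurable ([set` i] : set Rm).
Proof. exact: measurable_itv. Qed.

Definition prim g t := vint `[0, clip t] g.

Lemma primE g t : prim g t = vint `[0, clip t] g. Proof. by []. Qed.

Lemma prim_sub g s t : vintegrable `[0, T] g -> 0 <= s -> s <= t -> t <= T ->
  prim g t - prim g s = vint `]s, t] g.
Proof.
move=> ig s0 st tT; rewrite /prim !clip_id ?(le_trans s0 st) ?s0//; last exact: le_trans tT.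
have sub (i : interval R) : [set` i] `<=` [set` `[0, T]] -> vintegrable [set` i] g.
  by move=> iT; apply: vintegrableS ig => //; exact: measurable_itvD.
have E : (`[0, t]%classic : set Rm) = `[0, s] `|` `]s, t].
  by rewrite -itv_bndbnd_setU// bnd_simp.
rewrite E (vint_setU (measurable_itvD _) (measurable_itvD _)).
- by rewrite addrAC subrr add0r.
- by rewrite -E; apply: sub => x; rewrite /= !in_itv/= => /andP[-> /le_trans ->].
- apply/disj_setPS => x /=; rewrite !in_itv/= => -[/andP[_ xs] /andP[sx _]].
  by have := lt_le_trans sx xs; rewrite ltxx.
Qed.

Lemma mu_itv_oc s t : s <= t -> mu `]s, t] = (t - s)%:E.
Proof.
move=> st; rewrite lebesgue_measure_itv/= lte_fin.
by case: ltgtP st => // -> _; rewrite subrr.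
Qed.

(** The single source of the regularity of primitives: [w = 0] gives absolute continuity and
    Lipschitz bounds, [w = g t] the derivative at [t], be it a point of continuity or a Lebesgue
    point. *)
Lemma prim_increment g w s t : vintegrable `[0, T] g -> 0 <= s -> s <= t -> t <= T ->
  `|prim g t - prim g s - (t - s) *: w| <= \int[mu]_(x in `]s, t]) `|g x - w|.
Proof.
move=> ig s0 st tT; rewrite prim_sub//.
have mD : measurable (`]s, t]%classic : set Rm) by exact: measurable_itvD.
have ist : vintegrable `]s, t] g.
  apply: (vintegrableS (measurable_itvD _) mD _ ig) => x.
  rewrite /= !in_itv/= => /andP[sx xt].
  by rewrite (le_trans s0 (ltW sx)) (le_trans xt).
have fin : (mu `]s, t] < +oo)%E by rewrite mu_itv_oc// ltry.
have icst := vintegrable_cst mD (- w) fin.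
have <- : vint `]s, t] (fun x => g x - w) = vint `]s, t] g - (t - s) *: w.
  by rewrite vintD// vint_cst// mu_itv_oc//= scalerN.
by apply: vint_norm => //; exact: vintegrableD.
Qed.

Lemma prim_increment_le g w s t (e : R) : vintegrable `[0, T] g ->
  0 <= s -> s <= t -> t <= T -> (forall x, s < x <= t -> `|g x - w| <= e) ->
  `|prim g t - prim g s - (t - s) *: w| <= e * (t - s).
Proof.
move=> ig s0 st tT gw; apply: le_trans (prim_increment w ig s0 st tT) _.
have mD : measurable (`]s, t]%classic : set Rm) by exact: measurable_itvD.
have fin : (mu `]s, t] < +oo)%E by rewrite mu_itv_oc// ltry.
have -> : e * (t - s) = \int[mu]_(x in `]s, t]) e.
  by rewrite Rintegral_cst// [X in fine X]mu_itv_oc.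
have ist : vintegrable `]s, t] g.
  apply: (vintegrableS (measurable_itvD _) mD _ ig) => x.
  rewrite /= !in_itv/= => /andP[sx xt].
  by rewrite (le_trans s0 (ltW sx)) (le_trans xt).
apply: le_Rintegral => //.
- by have [] := vintegrableD mD ist (vintegrable_cst mD (- w) fin).
- apply: (measurable_bounded_integrable mD) => //; exists `|e|; split;
  by rewrite ?num_real// => M eM x _ /=; rewrite ltW.
Qed.

Definition vac v := forall e : R, 0 < e -> exists2 d : R, 0 < d &
  forall (N : nat) (a b : 'I_N -> R),
    (forall i, 0 <= a i /\ a i <= b i /\ b i <= T) ->
    (forall i j, i != j -> b i <= a j \/ b j <= a i) ->
    \sum_(i < N) (b i - a i) < d ->
    \sum_(i < N) `|v (b i) - v (a i) : l2 R J| < e.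

Lemma prim_vac g : vintegrable `[0, T] g -> vac (prim g).
Proof.
move=> ig e e0; have [mg ig'] := ig.
have [d d0 Hd] := integral_ac (fun s => normr_ge0 (g s)) ig' e0.
exists d => // N a b ab disj sumd; apply: le_lt_trans (Hd N a b ab disj sumd).
apply: ler_sum => i _; have [a0 [le_ab bT]] := ab i.
have := prim_increment 0 ig a0 le_ab bT; rewrite scaler0 subr0.
by under eq_Rintegral do rewrite subr0.
Qed.

Lemma vacD v1 v2 : vac v1 -> vac v2 -> vac (fun t => v1 t + v2 t).
Proof.
move=> ac1 ac2 e e0; have e20 : 0 < e / 2 by rewrite divr_gt0.
have [d1 d10 H1] := ac1 _ e20; have [d2 d20 H2] := ac2 _ e20.
exists (Num.min d1 d2); first by rewrite lt_min d10.
move=> N a b ab disj; rewrite lt_min => /andP[/(H1 N a b ab disj) {}H1 /(H2 N a b ab disj) {}H2].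
rewrite [e]splitr; apply: le_lt_trans (ltrD H1 H2); rewrite -big_split/=.
apply: ler_sum => i _; rewrite -[X in `|X|](_ : (v1 (b i) - v1 (a i)) + (v2 (b i) - v2 (a i)) = _).
  exact: ler_normD.
by rewrite addrACA opprD.
Qed.

Lemma lipschitz_vac v (L : R) : 0 <= L ->
  (forall s t, 0 <= s -> s <= t -> t <= T -> `|v t - v s| <= L * (t - s)) -> vac v.
Proof.
move=> L0 lip e e0; have L1 : 0 < L + 1 by rewrite ltr_wpDl.
exists (e / (L + 1)); first by rewrite divr_gt0.
move=> N a b ab disj; rewrite ltr_pdivlMr// => H; apply: le_lt_trans H.
rewrite mulr_suml; apply: ler_sum => i _; have [a0 [le_ab bT]] := ab i.
by rewrite (le_trans (lip _ _ a0 le_ab bT))// mulrC ler_wpM2l ?subr_ge0// lerDl.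
Qed.

Definition vcont g := forall t e, 0 < e -> exists2 r : R, 0 < r &
  forall s, `|s - t| < r -> `|g s - g t| <= e.

Lemma vac_vcont v : vac v -> vcont (fun t => v (clip t)).
Proof.
move=> acv t e e0; have [d d0 Hd] := acv e e0; exists d => // s st.
have key x y : 0 <= x -> x <= y -> y <= T -> y - x < d -> `|v y - v x| <= e.
  move=> x0 xy yT yxd; have := Hd 1%N (fun=> x) (fun=> y).
  rewrite !big_ord1 => H; apply: ltW; apply: H => //.
  by move=> i j; rewrite !ord1.
have /andP[s0 sT] := clip_in s; have /andP[t0 tT] := clip_in t.
have := le_lt_trans (clip_lip s t) st.
have [H|/ltW H] := leP (clip t) (clip s); first by rewrite ger0_norm ?subr_ge0//; exact: key.
by rewrite (distrC (clip s)) ger0_norm ?subr_ge0// (distrC (v _)); exact: key.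
Qed.

Lemma vcont_vmeas g : vcont g -> vmeas g.
Proof.
move=> cg x; apply: continuous_measurable_fun => t; apply/cvgrPdist_le => e e0.
have [r r0 Hr] := cg t e e0; apply/nbhs_ballP; exists r => //= s.
rewrite /ball/= distrC => /Hr; apply: le_trans.
by rewrite distrC -l2B; exact: norm_coord_le.
Qed.

Lemma prim_clip g t : prim g (clip t) = prim g t.
Proof. by rewrite /prim (clip_id (clip_in t)). Qed.

Lemma prim_vcont g : vintegrable `[0, T] g -> vcont (prim g).
Proof.
move=> /prim_vac/vac_vcont H t e e0; have [r r0 Hr] := H t e e0.
by exists r => [//|s /Hr]; rewrite (prim_clip g s) (prim_clip g t).
Qed.

(** Remainder form instead of a quotient: meaningful at [s = t], and one-sided at the end points. *)
Definition vderiv v t w := forall e, 0 < e -> exists2 r, 0 < r &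
  forall s, 0 <= s <= T -> `|s - t| < r ->
    `|v s - v t - (s - t) *: w : l2 R J| <= e * `|s - t|.

Lemma prim_vderiv_cont g t : vintegrable `[0, T] g -> vcont g -> 0 <= t <= T ->
  vderiv (prim g) t (g t).
Proof.
move=> ig cg /andP[t0 tT] e e0; have [r r0 Hr] := cg t e e0; exists r => // s /andP[s0 sT] st.
have [ts|/ltW st'] := leP t s.
  rewrite (ger0_norm (x := s - t)) ?subr_ge0//.
  apply: (prim_increment_le ig t0 ts sT) => x /andP[tx xs].
  apply: Hr; rewrite ger0_norm ?subr_ge0 1?ltW//.
  by apply: le_lt_trans st; rewrite ger0_norm ?subr_ge0// lerD2r.
have -> : prim g s - prim g t - (s - t) *: g t = - (prim g t - prim g s - (t - s) *: g t).
  by rewrite -(opprB t s) scaleNr !opprD !opprK (addrC (- prim g t)).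
rewrite normrN (distrC s) (ger0_norm (x := t - s)) ?subr_ge0//.
apply: (prim_increment_le ig s0 st' tT) => x /andP[sx xt].
apply: Hr; rewrite distrC ger0_norm ?subr_ge0//.
by apply: le_lt_trans st; rewrite distrC ger0_norm ?subr_ge0// lerD2l lerN2 ltW.
Qed.

End Primitive.

(** * Almost everywhere differentiation of primitives *)

Section LebesguePoints.
Variables (R : realType) (J : countType).
Notation mu := (@lebesgue_measure R).
Notation Rm := (measurableTypeR R).

Lemma lebesgue_pt_integral (phi : R -> R) t : lebesgue_pt phi t ->
  forall e, 0 < e -> exists2 rho, 0 < rho & forall r, 0 < r -> r < rho ->
    (\int[mu]_(y in ball t r) `|phi y - phi t|%:E < (2 * r * e)%:E)%E.
Proof.
move=> lp e e0.
have := lp _ (@nbhs_open_ereal_lt R 0 (fun=> e) e0).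
rewrite /= nbhs_simpl /= => -[rho /= rho0 H]; exists rho => // r r0 rrho.
have := H r; rewrite /= sub0r normrN gtr0_norm// => /(_ rrho r0).
rewrite /davg /iavg [X in X^-1%E](lebesgue_measure_ball t (ltW r0)) inver.
have -> : (r *+ 2 == 0) = false by rewrite mulrn_eq0/= gt_eqF.
rewrite lte_pdivrMl ?mulrn_wgt0// -EFinM mulr_natl.
by under eq_integral do rewrite abse_EFin.
Qed.

(** A dense family indexed by a countable type, so that the exceptional sets of its members still
    unite to a null set. *)
Definition rational_combination (q : seq (J * rat)) : l2 R J :=
  \sum_(p <- q) ratr p.2 *: delta R p.1.

Lemma rational_combination_dense (w : l2 R J) (e : R) : 0 < e ->
  exists q, `|w - rational_combination q| <= e.
Proof.
move=> e0; have e20 : 0 < e / 2 by rewrite divr_gt0.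
have [A wA] := trunc_approx w e20.
have normd x : `|delta R x : l2 R J| = 1.
  by rewrite l2_normE dot_delta deltaE eqxx sqrtr1.
have n0 : 0 < (size A).+1%:R :> R by rewrite ltr0n.
pose d := e / 2 / (size A).+1%:R; have d0 : 0 < d by rewrite divr_gt0.
have rat_near x : exists p : rat, `|w x - ratr p| <= d.
  have [p] := @rat_in_itvoo R (w x) (w x + d) ltac:(by rewrite ltrDl).
  rewrite in_itv/= => /andP[p1 p2]; exists p; rewrite distrC ger0_norm.
    by rewrite lerBlDl ltW.
  by rewrite subr_ge0 ltW.
have [p Hp] := choice rat_near.
exists [seq (x, p x) | x <- A].
rewrite -(subrK (trunc A w) w) -addrA (le_trans (ler_normD _ _))// [e]splitr lerD//.
rewrite /rational_combination big_map /trunc -sumrB.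
apply: le_trans (ler_norm_sum _ _ _) _.
apply: (@le_trans _ _ (\sum_(x <- A) d)).
  by apply: ler_sum => x _; rewrite -scalerBl l2_normZ normd mulr1.
have <- : d * (size A).+1%:R = e / 2 by rewrite /d divfK// gt_eqF.
by rewrite big_const_seq count_predT iter_addr_0 mulr_natr; apply: ler_wpMn2l (ltW d0) _ _ _.
Qed.

(** Scalar Lebesgue differentiation applies to the distances from [f] to the rational combinations.
    At a common Lebesgue point [t], a [q] close to [f t] bounds [|f x - f t|] by the oscillation of
    [|f - q|] plus twice the distance from [f t] to [q]. *)
Lemma prim_vderiv_ae (T : R) (f : R -> l2 R J) : 0 <= T -> vintegrable `[0, T] f ->
  {ae mu, forall t : Rm, 0 <= t <= T -> vderiv T (prim T f) t (f t)}.
Proof.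
move=> T0 intf; have [mf intf'] := intf.
have mD : measurable (`[0, T]%classic : set Rm) by exact: measurable_itv.
have finD : (mu `[0%R, T] < +oo)%E.
  by rewrite lebesgue_measure_itv/= lte_fin; case: ifP; rewrite -?EFinB ltry.
(* Cut off outside [0, T], since [f] is integrable on that interval only. *)
pose phi (q : seq (J * rat)) : R -> R :=
  (fun s => `|f s - rational_combination q|) \_ `[0, T].
have ae_q q : {ae mu, forall t : Rm, lebesgue_pt (phi q) t}.
  apply: lebesgue_differentiation; apply: integrable_locally => //.
  by have [] := vintegrableD mD intf (vintegrable_cst mD (- rational_combination q) finD).
have : {ae mu, forall t : Rm, forall k q,
    choice.unpickle k = Some q -> lebesgue_pt (phi q) t}.
  apply: ae_foralln => k; move: (choice.unpickle k) => o.
  case: o => [q0|]; last by apply: aeW => t q.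
  move: (ae_q q0); apply: filterS; first exact: (ae_filter_ringOfSetsType mu).
  by move=> t H q [<-].
apply: filterS.
move=> t Ht /andP[t0 tT] e e0.
(* The oscillation over a ball of radius [2 (b - a)] costs [4 (b - a) e / 6], the two distances to
   [q] cost [2 (b - a) e / 6]. *)
have e60 : 0 < e / 6 by rewrite divr_gt0.
have [q qt] := rational_combination_dense (f t) e60.
have /lebesgue_pt_integral/(_ _ e60)[rho rho0 Hrho] := Ht _ _ (choice.pickleK q).
exists (rho / 2); first by rewrite divr_gt0.
have incr a b : 0 <= a -> a <= b -> b <= T -> b - a < rho / 2 -> a <= t <= b ->
    (a == t) || (b == t) -> `|prim T f b - prim T f a - (b - a) *: f t| <= e * (b - a).
  move=> a0 ab bT abrho atb tab.
  have [->|aneb] := eqVneq a b; first by rewrite !subrr scale0r subrr normr0 mulr0.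
  have {}ab : a < b by rewrite lt_neqAle aneb.
  have ba0 : 0 < b - a by rewrite subr_gt0.
  apply: le_trans (prim_increment (f t) intf a0 (ltW ab) bT) _.
  pose D : set Rm := [set` `]a, b]].
  have mab : measurable D by exact: measurable_itv.
  (* Twice the length, so that the open ball about [t] contains the whole interval. *)
  pose r := 2 * (b - a).
  have r0 : 0 < r by rewrite mulr_gt0.
  have rrho : r < rho by rewrite /r mulrC -ltr_pdivlMr.
  have Dball : D `<=` ball t r.
    move=> x; rewrite /D /ball/= in_itv/= => /andP[ax xb].
    move: atb => /andP[a_t tb]; rewrite ltr_norml /r; apply/andP; split; lra.
  have DT : D `<=` [set` `[0, T]].
    move=> x; rewrite /D /= !in_itv/= => /andP[/ltW ax xb].
    by rewrite (le_trans a0 ax) (le_trans xb bT).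
  have mball : measurable (ball t r : set Rm) by exact: measurable_ball.
  have tD : (t : Rm) \in (`[0, T]%classic : set Rm).
    by rewrite inE/= in_itv/= t0.
  have fab : (mu D < +oo)%E by rewrite (mu_itv_oc (ltW ab)) ltry.
  have iDf : vintegrable D f by apply: vintegrableS intf.
  have iD1 : mu.-integrable D (fun x => `|f x - f t|%:E).
    by have [] := vintegrableD mab iDf (vintegrable_cst mab (- f t) fab).
  pose G x := `|phi q x - phi q t|.
  have mphi : measurable_fun [set: Rm] (phi q).
    apply: (measurable_restrictT _ mD).1; apply: measurable_funTS; apply: vmeas_norm.
    by apply: vmeasB => //; exact: vmeas_cst.
  have mG : measurable_fun [set: Rm] G.
    rewrite (_ : G = Num.norm \o (phi q \- cst (phi q t)))//.
    apply: measurableT_comp; first exact: normr_measurable.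
    exact: (measurable_funB mphi (measurable_cst _)).
  have G0 x : 0 <= G x by exact: normr_ge0.
  have IG := Hrho r r0 rrho.
  have iG : mu.-integrable (ball t r) (EFin \o G).
    apply/integrableP; split; first by apply/measurable_EFinP/measurable_funTS.
    under eq_integral do rewrite /= normr_id.
    exact: lt_trans IG (ltry _).
  have iDG : mu.-integrable D (EFin \o G) by apply: integrableS iG.
  have icst c : mu.-integrable D (fun=> c%:E).
    apply: (measurable_bounded_integrable mab) => //; exists `|c|; split;
    by rewrite ?num_real// => M eM x _ /=; rewrite ltW.
  apply: (@le_trans _ _ (\int[mu]_(x in D) (G x + 2 * (e / 6)))).
    apply: le_Rintegral => //; first exact: (integrableD mab iDG (icst _)).
    move=> x Dx; have xT : x \in (`[0, T]%classic : set Rm) by rewrite inE; exact: DT.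
    rewrite /G /phi !patchE xT tD.
    have := ler_distD (rational_combination q) (f x) (f t).
    rewrite (distrC (rational_combination q)).
    have := ler_norm (`|f x - rational_combination q| - `|f t - rational_combination q|).
    by move: qt; set A1 := `|_|; set A2 := `|f x - _|; set A3 := `|f x - f t|; lra.
  rewrite (RintegralD mab iDG (icst (2 * (e / 6)))) (Rintegral_cst mu mab).
  rewrite [X in fine X](mu_itv_oc (ltW ab))/=.
  have : \int[mu]_(x in D) G x <= 2 * r * (e / 6).
    rewrite -lee_fin /Rintegral fineK; last exact: integrable_fin_num.
    apply: le_trans (ltW IG); apply: ge0_subset_integral => //.
      exact/measurable_EFinP/measurable_funTS.
    by move=> x _; rewrite lee_fin.
  by rewrite /r => HG; lra.
move=> s /andP[s0 sT] st; have [ts|/ltW ts] := leP t s.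
  rewrite (ger0_norm (x := s - t)) ?subr_ge0//; apply: incr => //; rewrite ?lexx ?eqxx//.
  by move: st; rewrite ger0_norm ?subr_ge0.
have -> : prim T f s - prim T f t - (s - t) *: f t = - (prim T f t - prim T f s - (t - s) *: f t).
  by rewrite -(opprB t s) scaleNr !opprD !opprK (addrC (- prim T f t)).
rewrite normrN (distrC s) (ger0_norm (x := t - s)) ?subr_ge0//.
apply: incr => //; rewrite ?lexx ?eqxx ?orbT ?andbT//.
by move: st; rewrite distrC ger0_norm ?subr_ge0.
Qed.
End LebesguePoints.

(** * The abstract wave equation *)

Section Volterra.
Variables (R : realType) (J : countType) (T : R).
Hypothesis T_ge0 : 0 <= T.
Notation mu := (@lebesgue_measure R).
Notation Rm := (measurableTypeR R).
Notation prim := (prim T).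
Notation clip := (clip T).
Implicit Types (g h : R -> l2 R J) (w : l2 R J) (t s : R).

Definition cbounded g := vcont g /\ exists C : R, forall t, `|g t| <= C.

Lemma clip_T t : clip t <= T. Proof. by have /andP[] := clip_in T_ge0 t. Qed.
Lemma clip_0 t : 0 <= clip t. Proof. by have /andP[] := clip_in T_ge0 t. Qed.

Lemma itv_clip_sub t : [set` `[0, clip t]] `<=` [set` `[0, T]].
Proof.
by move=> x; rewrite /= !in_itv/= => /andP[-> xt]; rewrite (le_trans xt)// clip_T.
Qed.

Lemma vintegrable_clip g t : vintegrable `[0, T] g -> vintegrable `[0, clip t] g.
Proof.
move=> ig; apply: (vintegrableS _ _ (@itv_clip_sub t) ig); exact: measurable_itvD.
Qed.

Lemma integrable_cst_itv (a b c : R) : mu.-integrable `[a, b] (EFin \o (fun=> c)).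
Proof.
apply: (measurable_bounded_integrable (measurable_itvD _)) => //.
  by rewrite [X in (X < _)%E]lebesgue_measure_itv/=; case: ifP; rewrite -?EFinB ltry.
by exists `|c|; split; rewrite ?num_real// => M eM x _ /=; rewrite ltW.
Qed.

Lemma cbounded_vintegrable g : cbounded g -> vintegrable `[0, T] g.
Proof.
move=> [cg [C gC]].
apply: (vintegrable_dom (measurable_itvD _) (vcont_vmeas cg) (integrable_cst_itv _ _ C)).
by move=> s _; exact: gC.
Qed.

Lemma mu_itv_cc (a b : R) : a <= b -> mu `[a, b] = (b - a)%:E.
Proof.
move=> ab; rewrite lebesgue_measure_itv/= lte_fin.
by case: ltgtP ab => // -> _; rewrite subrr.
Qed.

Lemma prim_norm_le g (G : R -> R) t : vintegrable `[0, T] g ->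
  mu.-integrable `[0, clip t] (EFin \o G) ->
  (forall s, 0 <= s <= clip t -> `|g s| <= G s) ->
  `|prim g t| <= \int[mu]_(s in `[0, clip t]) G s.
Proof.
move=> ig iG gG; apply: (vint_norm_le (measurable_itvD _) (vintegrable_clip t ig) iG).
by move=> s; rewrite /= in_itv; exact: gG.
Qed.

Lemma prim_bound g C t : vintegrable `[0, T] g ->
  (forall s, `|g s| <= C) -> `|prim g t| <= C * T.
Proof.
move=> ig gC; have C0 : 0 <= C by apply: le_trans (gC 0).
apply: le_trans (prim_norm_le ig (integrable_cst_itv _ _ C) _) _ => //.
rewrite (Rintegral_cst mu (measurable_itvD _)) [X in fine X](mu_itv_cc (clip_0 t))/= subr0.
by rewrite ler_wpM2l// clip_T.
Qed.

Lemma integral_expR (N l t : R) : 0 < l -> 0 <= t ->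
  mu.-integrable `[0, t] (EFin \o (fun s => N * expR (l * s))) /\
  \int[mu]_(s in `[0, t]) (N * expR (l * s)) = N / l * (expR (l * t) - 1).
Proof.
move=> l0 t0.
have cf : continuous (fun s : R => N * expR (l * s)).
  move=> s; apply: cvgM; first exact: cvg_cst.
  apply: (@continuous_comp _ _ _ (fun s : R => l * s) expR).
    by apply: cvgM; [exact: cvg_cst|exact: cvg_id].
  exact: continuous_expR.
split.
  apply: continuous_compact_integrable; first exact: segment_compact.
  exact: continuous_subspaceT.
have [->|tn0] := eqVneq t 0.
  by rewrite set_itv1 Rintegral_set1 mulr0 expR0 subrr mulr0.
have t0' : 0 < t by rewrite lt_def tn0.
pose F (s : R) : R := N / l * expR (l * s).
have dF (s : R) : is_derive s 1 F (N * expR (l * s)).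
  rewrite /F; apply: is_derive_eq.
  by rewrite /GRing.scale/= ?add0r ?mul1r ?mulr1; field; rewrite gt_eqF.
have cF (s : R) : {for s, continuous F}.
  by apply/differentiable_continuous/derivable1_diffP; have [] := dF s.
rewrite /Rintegral (@continuous_FTC2 _ _ F)//=.
- by rewrite /F mulr0 expR0; ring.
- exact: continuous_subspaceT.
- split => [s _||]; first by have [] := dF s.
  + exact/cvg_at_right_filter/cF.
  + exact/cvg_at_left_filter/cF.
- by move=> s _; rewrite derive1E; have [_ ->] := dF s.
Qed.

(** In the sup norm weighted by [expR (- l t)] a primitive gains a factor [1 / l], so the series
    converges on all of [0, T] at once, however large [T] and [M] are. *)
Lemma prim_exp_bound g (N l : R) : 0 < l -> 0 <= N -> vintegrable `[0, T] g ->
  (forall s, `|g s| <= N * expR (l * clip s)) ->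
  forall t, `|prim g t| <= N / l * expR (l * clip t).
Proof.
move=> l0 N0 ig gN t; have [iG intG] := integral_expR N l0 (clip_0 t).
apply: le_trans (prim_norm_le ig iG _) _.
  move=> s /andP[s0 st]; rewrite -{2}(@clip_id _ T s) ?gN// s0 (le_trans st)//; exact: clip_T.
by rewrite intG ler_wpM2l ?divr_ge0 ?(ltW l0)// lerBlDr lerDl.
Qed.

Lemma vcontD g h : vcont g -> vcont h -> vcont (fun t => g t + h t).
Proof.
move=> cg ch t e e0; have e20 : 0 < e / 2 by rewrite divr_gt0.
have [r1 r10 H1] := cg t _ e20; have [r2 r20 H2] := ch t _ e20.
exists (Num.min r1 r2) => [|s]; first by rewrite lt_min r10.
rewrite lt_min => /andP[/H1 {}H1 /H2 {}H2].
rewrite [e]splitr opprD addrACA (le_trans (ler_normD _ _))//; exact: lerD.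
Qed.

Lemma vcont_op B M g : 0 <= M -> pos_op B M -> vcont g -> vcont (fun t => B (g t)).
Proof.
move=> M0 BM cg t e e0; have M1 : 0 < M + 1 by rewrite ltr_wpDl.
have [r r0 H] := cg t _ (divr_gt0 e0 M1); exists r => [//|s /H {}H].
rewrite -(pos_opB _ _ BM) (le_trans (pos_op_bound BM _))//.
apply: (@le_trans _ _ ((M + 1) * `|g s - g t|)); first by rewrite ler_wpM2r// lerDl.
by rewrite (le_trans (ler_wpM2l (ltW M1) H))// mulrCA mulfV ?mulr1// gt_eqF.
Qed.

Lemma cbounded_cst w : cbounded (fun=> w).
Proof.
split; last by exists `|w|.
by move=> t e e0; exists 1 => // s _; rewrite subrr normr0 ltW.
Qed.

Lemma cboundedD g h : cbounded g -> cbounded h -> cbounded (fun t => g t + h t).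
Proof.
move=> [cg [C gC]] [ch [D hD]]; split; first exact: vcontD.
by exists (C + D) => t; rewrite (le_trans (ler_normD _ _))// lerD.
Qed.

Lemma cboundedN g : cbounded g -> cbounded (fun t => - g t).
Proof.
move=> [cg [C gC]]; split; last by exists C => t; rewrite normrN.
move=> t e e0; have [r r0 H] := cg t e e0; exists r => [//|s /H].
by rewrite -opprD normrN.
Qed.

Lemma cbounded_op B M g : 0 <= M -> pos_op B M -> cbounded g -> cbounded (fun t => B (g t)).
Proof.
move=> M0 BM [cg [C gC]]; split; first exact: vcont_op BM cg.
by exists (M * C) => t; rewrite (le_trans (pos_op_bound BM _))// ler_wpM2l.
Qed.

Lemma prim_le_total g t : vintegrable `[0, T] g ->
  `|prim g t| <= \int[mu]_(s in `[0, T]) `|g s|.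
Proof.
move=> ig; have ig' := vintegrable_clip t ig.
apply: le_trans (vint_norm (measurable_itvD _) ig') _.
have [_ i1] := ig'; have [_ i2] := ig.
rewrite -lee_fin /Rintegral !fineK; last 2 first.
- by apply: integrable_fin_num; [exact: measurable_itvD|].
- by apply: integrable_fin_num; [exact: measurable_itvD|].
apply: ge0_subset_integral; [exact: measurable_itvD|exact: measurable_itvD| | |].
- by case/integrableP: i2.
- by move=> s _; rewrite lee_fin.
- exact: itv_clip_sub.
Qed.

Lemma prim_cbounded g : vintegrable `[0, T] g -> cbounded (prim g).
Proof.
move=> ig; split; first exact: prim_vcont.
by exists (\int[mu]_(s in `[0, T]) `|g s|) => t; exact: prim_le_total.
Qed.

Lemma primD g h t : vintegrable `[0, T] g -> vintegrable `[0, T] h ->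
  prim (fun s => g s + h s) t = prim g t + prim h t.
Proof.
move=> ig ih; apply: vintD; [exact: measurable_itvD|exact: vintegrable_clip..].
Qed.

Lemma primN g t : vintegrable `[0, T] g -> prim (fun s => - g s) t = - prim g t.
Proof.
move=> ig; rewrite -[RHS]scaleN1r !primE -(vintZ (measurable_itvD _)).
  by congr vint; apply/funext => s; rewrite scaleN1r.
exact: vintegrable_clip.
Qed.

Lemma prim_0 g : prim g 0 = 0.
Proof.
apply: l2P => x; rewrite l2_0 primE clip_id ?lexx// set_itv1.
by rewrite unlock (@mkl2E _ _ _ 0) ?Rintegral_set1// => A; rewrite big1// => y _;
  rewrite Rintegral_set1 expr0n.
Qed.

Lemma vcont_uniform_limit (v : R -> l2 R J) (S : nat -> R -> l2 R J) (b : R^nat) :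
  (forall p, vcont (S p)) -> (forall p t, `|v t - S p t| <= b p) -> b @ \oo --> 0 ->
  vcont v.
Proof.
move=> cS vS b0 t e e0; have e30 : 0 < e / 3 by rewrite divr_gt0.
have /cvgrPdist_le/(_ _ e30)[p _ /(_ p (leqnn p))] := b0; rewrite sub0r normrN => bp.
have {}bp : b p <= e / 3 by apply: le_trans bp; exact: ler_norm.
have [r r0 H] := cS p t _ e30; exists r => [//|s /H {}H].
have E : v s - v t = (v s - S p s) + (S p s - S p t) + (S p t - v t).
  by rewrite !addrA !subrK.
rewrite E (le_trans (ler_normD _ _))//.
have := ler_normD (v s - S p s) (S p s - S p t).
have := vS p s; have := vS p t; rewrite (distrC (v t)).
set a1 := `|_|; set a2 := `|v s - _|; set a3 := `|_ + _|; set a4 := `|S p s - _| in H *.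
by move=> ? ? ?; lra.
Qed.

Section Solution.
Variables (B : l2 R J -> l2 R J) (M : R) (G0 : R -> l2 R J).
Hypothesis M_ge0 : 0 <= M.
Hypothesis BM : pos_op B M.
Hypothesis cbG0 : cbounded G0.

Let prim_cb g : cbounded g -> cbounded (prim g).
Proof. by move=> /cbounded_vintegrable; exact: prim_cbounded. Qed.

Lemma volterra_solution : exists2 v, cbounded v &
  forall t, v t = G0 t - B (prim (prim v) t).
Proof.
have [term [term0 termS]] : exists term : nat -> R -> l2 R J,
    term 0%N = G0 /\ forall p t, term p.+1 t = - B (prim (prim (term p)) t).
  by exists (fun p => iter p (fun d t => - B (prim (prim d) t)) G0).
have term_cb p : cbounded (term p).
  elim: p => [|p IH]; first by rewrite term0.
  rewrite (_ : term p.+1 = fun t => - B (prim (prim (term p)) t)); last exact/funext.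
  by apply: cboundedN; apply: (cbounded_op M_ge0 BM); exact/prim_cb/prim_cb.
have [S [S0 SSp]] : exists S : nat -> R -> l2 R J,
    S 0%N = (fun=> 0) /\ forall p t, S p.+1 t = S p t + term p t.
  exists (fun p t => \sum_(i < p) term i t); split=> [|p t]; last by rewrite big_ord_recr.
  by apply/funext => t; rewrite big_ord0.
have [_ [N0 G0N0]] := cbG0.
pose N := `|N0| + 1; have N_gt0 : 0 < N by rewrite ltr_wpDl.
have G0N t : `|G0 t| <= N by rewrite (le_trans (G0N0 t))// ler_wpDr// ler_norm.
(* Two primitives and one application of [B] multiply the weighted norm by [M / l ^+ 2]; this [l]
   makes the factor at most one half. *)
pose l := 1 + 2 * M; have l0 : 0 < l by rewrite /l; have := M_ge0; lra.
have Ml : M / l / l <= 2^-1.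
  by rewrite !ler_pdivrMr// /l; have := M_ge0; nra.
have termN p t : `|term p t| <= N / 2 ^+ p * expR (l * clip t).
  elim: p t => [|p IH] t.
    rewrite term0 expr0 divr1 (le_trans (G0N t))// ler_peMr ?(ltW N_gt0)//.
    by rewrite -expR0 ler_expR mulr_ge0 ?(ltW l0) ?clip_0.
  have Np0 : 0 <= N / 2 ^+ p by rewrite divr_ge0 ?(ltW N_gt0)// exprn_ge0.
  have b1 := prim_exp_bound l0 Np0 (cbounded_vintegrable (term_cb p)) IH.
  have Npl0 : 0 <= N / 2 ^+ p / l by rewrite divr_ge0 ?(ltW l0).
  have b2 := prim_exp_bound l0 Npl0 (cbounded_vintegrable (prim_cb (term_cb p))) b1.
  rewrite termS normrN (le_trans (pos_op_bound BM _))//.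
  apply: (le_trans (ler_wpM2l M_ge0 (b2 t))).
  rewrite mulrA ler_wpM2r ?expR_ge0// exprS invfM.
  rewrite (_ : M * (N / 2 ^+ p / l / l) = (N / 2 ^+ p) * (M / l / l)); last by ring.
  by rewrite [leRHS](_ : _ = N / 2 ^+ p * 2^-1) ?ler_wpM2l//; ring.
pose C := N * expR (l * T).
have C0 : 0 <= C by rewrite mulr_ge0 ?expR_ge0 ?(ltW N_gt0).
have termC p t : `|term p t| <= C / 2 ^+ p.
  rewrite (le_trans (termN p t))// /C mulrAC ler_wpM2r ?invr_ge0 ?exprn_ge0//.
  by rewrite ler_wpM2l ?(ltW N_gt0)// ler_expR ler_wpM2l ?(ltW l0)// clip_T.
(* The tail, from index [p] on, of the geometric series dominating the terms. *)
pose b p := 2 * C / 2 ^+ p.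
have bge0 p : 0 <= b p by apply: divr_ge0; [exact: mulr_ge0|exact: exprn_ge0].
have b0 : b @ \oo --> 0.
  have -> : b = geometric (2 * C) 2^-1 by apply/funext => p; rewrite /b /= exprVn.
  by apply: cvg_geometric; rewrite ger0_norm ?invf_lt1 ?ltr1n.
have SS t p k : `|S (p + k)%N t - S p t| <= b p - b (p + k)%N.
  elim: k => [|k IH]; first by rewrite addn0 !subrr normr0.
  rewrite addnS SSp addrAC (le_trans (ler_normD _ _))//.
  have := termC (p + k)%N t; rewrite {2}/b exprS invfM => H.
  have : b (p + k)%N = C / 2 ^+ (p + k) + C / 2 ^+ (p + k) by rewrite /b; ring.
  rewrite (_ : 2 * C * (2^-1 / 2 ^+ (p + k)) = C / 2 ^+ (p + k)); last by field.
  by move: IH H; set a1 := `|_|; set a2 := `|_|; lra.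
have Sb t p q : (p <= q)%N -> `|S q t - S p t| <= b p.
  by move=> pq; rewrite -(subnKC pq) (le_trans (SS _ _ _))// gerBl.
have [v vS] := choice (fun t => l2_complete (Sb t) b0).
have Scb p : cbounded (S p).
  elim: p => [|p IH]; first by rewrite S0; exact: cbounded_cst.
  by rewrite (_ : S p.+1 = fun t => S p t + term p t); [exact: cboundedD|exact/funext].
have vcb : cbounded v.
  split; first exact: (vcont_uniform_limit (fun p => (Scb p).1) (fun p t => vS t p) b0).
  by exists (b 0%N) => t; have := vS t 0%N; rewrite S0 subr0.
have prim2D g h t : cbounded g -> cbounded h ->
    prim (prim (fun s => g s + h s)) t = prim (prim g) t + prim (prim h) t.
  move=> cg ch; have ig := cbounded_vintegrable cg; have ih := cbounded_vintegrable ch.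
  rewrite -primD; [|exact/cbounded_vintegrable/prim_cb..].
  by congr (prim _ t); apply/funext => s; exact: primD.
(* The partial sums are the Picard iterates started at 0, so the defect of the limit in the equation
   is controlled by [v - S p]. *)
have Srec p t : S p.+1 t = G0 t - B (prim (prim (S p)) t).
  elim: p => [|p IH].
    have z s : prim (fun=> 0) s = 0 :> l2 R J.
      have := primN s (cbounded_vintegrable (cbounded_cst (0 : l2 R J))); rewrite oppr0.
      by move=> /eqP; rewrite -addr_eq0 -mulr2n -scaler_nat scaler_eq0 pnatr_eq0 => /eqP.
    have {}z : prim (fun=> 0) = (fun=> 0) :> (R -> l2 R J) by exact/funext.
    by rewrite SSp S0 term0 add0r z z (pos_op0 BM) subr0.
  have E : S p.+1 = fun s => S p s + term p s by exact/funext.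
  rewrite SSp IH termS E (prim2D _ _ t (Scb p) (term_cb p)) (pos_opD BM) opprD.
  exact/esym/addrA.
exists v => // t; apply/eqP; rewrite -subr_eq0 -normr_le0.
have bound p : `|v t - (G0 t - B (prim (prim v) t))| <= b p + M * (T * T) * b p.
  have cd : cbounded (fun s => v s - S p s) by apply: cboundedD => //; exact: cboundedN.
  have -> : v t - (G0 t - B (prim (prim v) t)) =
      (v t - S p.+1 t) + B (prim (prim (fun s => v s - S p s)) t).
    have -> : prim (prim v) t = prim (prim (fun s => v s - S p s)) t + prim (prim (S p)) t.
      rewrite -prim2D//; congr (prim (prim _) t); apply/funext => s; by rewrite subrK.
    have alg (a g x y : l2 R J) : a - (g - (x + y)) = (a - (g - y)) + x.
      by rewrite !opprB -!addrA; congr (_ + _); rewrite addrC -addrA.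
    by rewrite Srec (pos_opD BM) alg.
  rewrite (le_trans (ler_normD _ _))// lerD//.
    have bS : b p.+1 = 2^-1 * b p by rewrite /b exprS invfM; ring.
    by rewrite (le_trans (vS t p.+1))// bS ler_piMl// invf_le1 ?ler1n.
  rewrite (le_trans (pos_op_bound BM _))// -mulrA ler_wpM2l//.
  have i1 := cbounded_vintegrable cd.
  have := prim_bound t (cbounded_vintegrable (prim_cb cd)) (fun s => prim_bound s i1 (fun s => vS s p)).
  by congr (_ <= _); ring.
have c0 : (fun p => b p + M * (T * T) * b p) @ \oo --> 0.
  rewrite -[X in _ --> X](_ : 0 + M * (T * T) * 0 = 0); last by rewrite mulr0 addr0.
  by apply: cvgD => //; apply: cvgM => //; exact: cvg_cst.
apply: (cvgr_to_ge c0); near=> p; exact: bound.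
Unshelve. all: by end_near. Qed.

End Solution.
End Volterra.

Section Derivatives.
Variables (R : realType) (J : countType) (T : R).
Implicit Types (v : R -> l2 R J) (w : l2 R J).

Lemma vderivD v1 v2 t w1 w2 : vderiv T v1 t w1 -> vderiv T v2 t w2 ->
  vderiv T (fun s => v1 s + v2 s) t (w1 + w2).
Proof.
move=> d1 d2 e e0; have e20 : 0 < e / 2 by rewrite divr_gt0.
have [r1 r10 H1] := d1 _ e20; have [r2 r20 H2] := d2 _ e20.
exists (Num.min r1 r2) => [|s sT]; first by rewrite lt_min r10.
rewrite lt_min => /andP[/(H1 s sT) {}H1 /(H2 s sT) {}H2].
have -> : v1 s + v2 s - (v1 t + v2 t) - (s - t) *: (w1 + w2) =
    (v1 s - v1 t - (s - t) *: w1) + (v2 s - v2 t - (s - t) *: w2).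
  by rewrite scalerDr !opprD (addrACA (v1 s)) (addrACA (v1 s - v1 t)).
rewrite [e]splitr mulrDl (le_trans (ler_normD _ _))//; exact: lerD.
Qed.

Lemma vderiv_op B M v t w : 0 <= M -> pos_op B M -> vderiv T v t w ->
  vderiv T (fun s => B (v s)) t (B w).
Proof.
move=> M0 BM dv e e0; have M1 : 0 < M + 1 by rewrite ltr_wpDl.
have [r r0 H] := dv _ (divr_gt0 e0 M1); exists r => [//|s sT /(H s sT) {}H].
have -> : B (v s) - B (v t) - (s - t) *: B w = B (v s - v t - (s - t) *: w).
  by rewrite !(pos_opB _ _ BM) (pos_opZ BM).
apply: le_trans (pos_op_bound BM _) _.
apply: (@le_trans _ _ ((M + 1) * `|v s - v t - (s - t) *: w|)).
  by rewrite ler_wpM2r// lerDl.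
by rewrite (le_trans (ler_wpM2l (ltW M1) H))// mulrA (mulrC (M + 1)) divfK// gt_eqF.
Qed.

Lemma vderiv_cst w t : vderiv T (fun=> w) t 0.
Proof.
move=> e e0; exists 1 => // s _ _.
by rewrite subrr scaler0 subr0 normr0 mulr_ge0 ?(ltW e0).
Qed.

Lemma vderivN v t w : vderiv T v t w -> vderiv T (fun s => - v s) t (- w).
Proof.
move=> dv e e0; have [r r0 H] := dv e e0; exists r => [//|s sT /(H s sT)].
by rewrite scalerN -!opprD normrN.
Qed.

Lemma vderivB v1 v2 t w1 w2 : vderiv T v1 t w1 -> vderiv T v2 t w2 ->
  vderiv T (fun s => v1 s - v2 s) t (w1 - w2).
Proof. by move=> d1 d2; apply: vderivD => //; exact: vderivN. Qed.

End Derivatives.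

Section WaveExistence.
Variables (R : realType) (J : countType) (T : R).
Hypothesis T_ge0 : 0 <= T.
Notation mu := (@lebesgue_measure R).
Notation Rm := (measurableTypeR R).

Lemma prim_lipschitz (g : R -> l2 R J) (C s t : R) : vintegrable `[0, T] g ->
  (forall x, `|g x| <= C) -> 0 <= s -> s <= t -> t <= T ->
  `|prim T g t - prim T g s| <= C * (t - s).
Proof.
move=> ig gC s0 st tT; rewrite -[X in `|X|]subr0 -[X in _ - _ - X](scaler0 _ (t - s)).
by apply: prim_increment_le => // x _; rewrite subr0.
Qed.

(* With [v] the velocity and [u = u0 + \int v], the equation [v' + B u = f]
   integrates to the Volterra equation solved below. *)
Lemma wave_existence (B : l2 R J -> l2 R J) (M : R) (f : R -> l2 R J) (u0 u1 : l2 R J) :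
  0 <= M -> pos_op B M -> vintegrable `[0, T] f ->
  exists u v : R -> l2 R J, [/\ u 0 = u0, v 0 = u1,
    forall t, 0 <= t <= T -> vderiv T u t (v t),
    vcont v /\ vac T v &
    {ae mu, forall t : Rm, 0 <= t <= T -> vderiv T v t (f t - B (u t))}].
Proof.
move=> M0 BM intf.
have cu0 := cbounded_cst u0; have iu0 := cbounded_vintegrable T cu0.
(* The contribution of [u0] to the integral of [B u] is known and joins the source term. *)
have cG0 : cbounded (fun t => u1 + prim T f t - B (prim T (fun=> u0) t)).
  apply: cboundedD; first by apply: cboundedD; [exact: cbounded_cst|exact: prim_cbounded].
  by apply: cboundedN; apply: (cbounded_op M0 BM); exact: prim_cbounded.
have [v cv vE] := volterra_solution T_ge0 M0 BM cG0.
have iv := cbounded_vintegrable T cv.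
have cpv := prim_cbounded T_ge0 iv; have ipv := cbounded_vintegrable T cpv.
pose u t : l2 R J := u0 + prim T v t.
have cu : cbounded u by apply: cboundedD.
have iu := cbounded_vintegrable T cu.
have {}vE t : v t = u1 + prim T f t - B (prim T u t).
  have pu : prim T u t = prim T (fun=> u0) t + prim T (prim T v) t by exact: primD.
  rewrite vE pu (pos_opD BM) opprD; exact/esym/addrA.
exists u, v; split.
- by rewrite /u (prim_0 T_ge0) addr0.
- by rewrite vE !(prim_0 T_ge0) (pos_op0 BM) addr0 subr0.
- move=> t tT; rewrite -[v t]add0r; apply: vderivD; first exact: vderiv_cst.
  by apply: prim_vderiv_cont => //; case: cv.
(* Absolute continuity is read off the integrated equation: a constant, a primitive, and the image
   under [B] of a Lipschitz primitive. *)
- split; first by case: cv.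
  have -> : v = fun t => u1 + prim T f t - B (prim T u t) by exact/funext.
  have [_ [C uC]] := cu; have C0 : 0 <= C := le_trans (normr_ge0 _) (uC 0).
  apply: vacD; first apply: vacD.
  + by apply: (@lipschitz_vac _ _ _ _ 0) => // s t *; rewrite subrr normr0 mul0r.
  + exact: prim_vac.
  + apply: (@lipschitz_vac _ _ _ _ (M * C)) => [|s t s0 st tT]; first exact: mulr_ge0.
    rewrite -opprD normrN -(pos_opB _ _ BM) (le_trans (pos_op_bound BM _))// -mulrA.
    by rewrite ler_wpM2l// prim_lipschitz.
move: (prim_vderiv_ae T_ge0 intf); apply: filterS => t dft tT.
have -> : v = fun t => u1 + prim T f t - B (prim T u t) by exact/funext.
apply: vderivB; last first.
  apply: (vderiv_op M0 BM); apply: prim_vderiv_cont => //; by case: cu.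
rewrite -[f t]add0r; apply: vderivD; [exact: vderiv_cst|exact: dft].
Qed.

End WaveExistence.

(** * The energy estimate *)

Section ScalarDerivative.
Variables (R : realType) (T : R).
Implicit Types (phi psi : R -> R).

Definition sderiv phi t a := forall e, 0 < e -> exists2 r, 0 < r &
  forall s, 0 <= s <= T -> `|s - t| < r ->
    `|phi s - phi t - (s - t) * a : R| <= e * `|s - t|.

Lemma sderivD phi psi t a b : sderiv phi t a -> sderiv psi t b ->
  sderiv (fun s => phi s + psi s) t (a + b).
Proof.
move=> d1 d2 e e0; have e20 : 0 < e / 2 by rewrite divr_gt0.
have [r1 r10 H1] := d1 _ e20; have [r2 r20 H2] := d2 _ e20.
exists (Num.min r1 r2) => [|s sT]; first by rewrite lt_min r10.
rewrite lt_min => /andP[/(H1 s sT) {}H1 /(H2 s sT) {}H2].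
have -> : phi s + psi s - (phi t + psi t) - (s - t) * (a + b) =
    (phi s - phi t - (s - t) * a) + (psi s - psi t - (s - t) * b) by ring.
rewrite [e]splitr [leRHS]mulrDl (le_trans (ler_normD _ _))//; exact: lerD.
Qed.

Lemma sderivZ phi t a c : sderiv phi t a -> sderiv (fun s => c * phi s) t (c * a).
Proof.
move=> dv e e0; have M1 : 0 < `|c| + 1 by rewrite ltr_wpDl.
have [r r0 H] := dv _ (divr_gt0 e0 M1); exists r => [//|s sT /(H s sT) {}H].
have -> : c * phi s - c * phi t - (s - t) * (c * a) = c * (phi s - phi t - (s - t) * a) by ring.
rewrite normrM; apply: (@le_trans _ _ ((`|c| + 1) * `|phi s - phi t - (s - t) * a|)).
  by rewrite ler_wpM2r// lerDl.
by rewrite (le_trans (ler_wpM2l (ltW M1) H))// mulrA (mulrC (`|c| + 1)) divfK// gt_eqF.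
Qed.

Lemma sderiv_id t : sderiv id t 1.
Proof.
by move=> e e0; exists 1 => // s _ _; rewrite mulr1 subrr normr0 mulr_ge0 ?(ltW e0).
Qed.

Lemma sderiv_le0_good phi t a : sderiv phi t a -> a <= 0 ->
  forall e, 0 < e -> exists2 r, 0 < r &
     forall s, 0 <= s <= T -> `|s - t| < r ->
       (t <= s -> phi s - phi t <= e * (s - t)) /\
       (s <= t -> phi t - phi s <= e * (t - s)).
Proof.
move=> dv a0 e e0; have [r r0 H] := dv e e0; exists r => [//|s sT /(H s sT)].
rewrite ler_norml => /andP[H1 H2]; split => st.
  have := mulr_ge0_le0 (ltac:(by rewrite subr_ge0) : 0 <= s - t) a0.
  by move: H2; rewrite ger0_norm ?subr_ge0//; lra.
have := mulr_ge0_le0 (ltac:(by rewrite subr_ge0) : 0 <= t - s) a0.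
by move: H1; rewrite distrC ger0_norm ?subr_ge0//; lra.
Qed.

(** Product rule: two terms of the remainder are linear in the remainders of the factors, the third
    is the pairing of the two increments, quadratic in [s - t]. *)
Lemma sderiv_dot (J : countType) (p q : R -> l2 R J) t p' q' :
  vderiv T p t p' -> vderiv T q t q' ->
  sderiv (fun s => dot (p s) (q s)) t (dot p' (q t) + dot (p t) q').
Proof.
move=> dp dq e e0.
(* [K] collects the coefficients of the three terms: [d <= 1] bounds each increment by [|s - t|]
   times a derivative norm plus one, and [|s - t| <= d] makes the quadratic term small. *)
pose K := `|p t| + `|q t| + (`|p'| + 1) * (`|q'| + 1) + 1.
have K0 : 0 < K by rewrite ltr_wpDl ?addr_ge0 ?mulr_ge0 ?addr_ge0.
have [d [d0 d1 dK]] : exists d, [/\ 0 < d, d <= 1 & d * K <= e].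
  exists (Num.min 1 (e / K)); rewrite lt_min ltr01 divr_gt0// ge_min lexx; split=> //.
  by rewrite -ler_pdivlMr// ge_min lexx orbT.
have [r1 r10 H1] := dp d d0; have [r2 r20 H2] := dq d d0.
exists (Num.min d (Num.min r1 r2)) => [|s sT]; first by rewrite !lt_min d0 r10.
rewrite !lt_min => /andP[/ltW std /andP[/(H1 s sT) {}H1 /(H2 s sT) {}H2]].
set x := `|s - t| in std H1 H2 *.
have x0 : 0 <= x by exact: normr_ge0.
pose a := p s - p t - (s - t) *: p'; pose b := q s - q t - (s - t) *: q'.
have E : dot (p s) (q s) - dot (p t) (q t) - (s - t) * (dot p' (q t) + dot (p t) q') =
    dot a (q t) + dot (p t) b + dot (p s - p t) (q s - q t).
  by rewrite /a /b !dotE; ring.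
rewrite E.
have incr (v : R -> l2 R J) v' : `|v s - v t - (s - t) *: v'| <= d * x ->
    `|v s - v t| <= x * (`|v'| + 1).
  move=> H; rewrite -(subrK ((s - t) *: v') (v s - v t)) (le_trans (ler_normD _ _))//.
  by rewrite l2_normZ -/x; have := ler_wpM2r x0 d1; move: H; lra.
have i1 := incr _ _ H1; have i2 := incr _ _ H2.
have n1 := norm_dot_le a (q t); have n2 := norm_dot_le (p t) b.
have n3 := norm_dot_le (p s - p t) (q s - q t).
have m1 : `|a| * `|q t| <= d * x * `|q t| by rewrite ler_wpM2r.
have m2 : `|p t| * `|b| <= `|p t| * (d * x) by rewrite ler_wpM2l.
have m3 : `|p s - p t| * `|q s - q t| <= x * (`|p'| + 1) * (x * (`|q'| + 1)) by rewrite ler_pM.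
have m4 : x * (`|p'| + 1) * (x * (`|q'| + 1)) <= d * x * ((`|p'| + 1) * (`|q'| + 1)).
  rewrite (_ : x * (`|p'| + 1) * (x * (`|q'| + 1)) = x * x * ((`|p'| + 1) * (`|q'| + 1))); last by ring.
  by rewrite ler_wpM2r ?mulr_ge0 ?addr_ge0// ler_wpM2r.
have m5 : d * K * x <= e * x by rewrite ler_wpM2r.
have dx0 : 0 <= d * x by rewrite mulr_ge0 ?(ltW d0).
rewrite (le_trans (ler_normD _ _))// (le_trans (lerD (ler_normD _ _) (lexx _)))//.
apply: le_trans m5; rewrite /K.
move: n1 n2 n3 m1 m2 m3 m4 dx0; set A := `|dot a _|; set A2 := `|dot _ b|; set A3 := `|dot _ _|.
set P := (`|p'| + 1) * _; set b1 := `|a| * _; set b2 := `|p t| * `|b|; set b3 := `|_| * `|_|.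
by move=> *; lra.
Qed.

End ScalarDerivative.

Section MeanValue.
Variables (R : realType) (J : countType) (T : R).

(** Mean value inequality, from monotonicity of [|u (a + s) - u a| - C s]. Only one-sided increments
    of the norm are estimated, as the norm itself need not be differentiable. *)
Lemma vderiv_lipschitz (u v : R -> l2 R J) (C : R) :
  (forall t, 0 <= t <= T -> vderiv T u t (v t)) ->
  (forall t, 0 <= t <= T -> `|v t| <= C) ->
  forall a b, 0 <= a -> a <= b -> b <= T -> `|u b - u a| <= C * (b - a).
Proof.
move=> du vC a b a0 ab bT.
have ba0 : 0 <= b - a by rewrite subr_ge0.
have H : forall t, 0 <= t <= b - a -> forall e, 0 < e -> exists2 r, 0 < r &
     forall s, 0 <= s <= b - a -> `|s - t| < r -> `|u (a + s) - u (a + t)| <= (C + e) * `|s - t|.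
  move=> t /andP[t0 tb] e e0.
  have aT : 0 <= a + t <= T by rewrite addr_ge0//= (le_trans _ bT)// -lerBrDl.
  have [r r0 Hr] := du _ aT e e0; exists r => [//|s /andP[s0 sb] st].
  have sT : 0 <= a + s <= T by rewrite addr_ge0//= (le_trans _ bT)// -lerBrDl.
  have E : a + s - (a + t) = s - t by ring.
  have := Hr _ sT; rewrite E => /(_ st) H1.
  rewrite -(subrK ((s - t) *: v (a + t)) (u (a + s) - u (a + t))).
  rewrite (le_trans (ler_normD _ _))// l2_normZ addrC mulrDl lerD//.
  by rewrite mulrC ler_wpM2r// vC.
have := @monotone_of_good R (b - a) (fun s => `|u (a + s) - u a| - C * s) ba0.
have E : a + (b - a) = b by rewrite addrC subrK.
rewrite /= addr0 subrr normr0 mulr0 subr0 E subr_le0; apply.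
move=> t tb e e0; have [r r0 Hr] := H t tb e e0; exists r => [//|s sb /(Hr s sb) {}Hr].
have d1 := ler_distD (u (a + t)) (u (a + s)) (u a).
have d2 := ler_distD (u (a + s)) (u (a + t)) (u a).
move: Hr d1 d2; rewrite (distrC (u (a + t)) (u (a + s))).
set x := `|u (a + s) - u a|; set y := `|u (a + t) - u a|; set z := `|u _ - u _|.
move=> Hr d1 d2; split=> st; move: Hr.
  by rewrite ger0_norm ?subr_ge0//; lra.
by rewrite distrC ger0_norm ?subr_ge0//; lra.
Qed.

(** An a priori bound on the velocity, which makes the supremum of the energy finite. *)
Lemma vac_bounded (v : R -> l2 R J) : 0 <= T -> vac T v ->
  exists C, forall t, 0 <= t <= T -> `|v t| <= C.
Proof.
move=> T0 acv; have cv := vac_vcont T0 acv.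
have cn : {within `[0, T], continuous (fun t => `|v (clip T t)|)}.
  apply: continuous_subspaceT => t; apply/cvgrPdist_le => e e0.
  have [r r0 Hr] := cv t e e0; apply/nbhs_ballP; exists r => //= s.
  rewrite /ball/= distrC => /Hr; rewrite distrC; apply: le_trans; exact: ler_dist_dist.
have [c _ Hc] := EVT_max T0 cn.
by exists `|v (clip T c)| => t tT; rewrite -{1}(clip_id tT) Hc// in_itv.
Qed.

Lemma ac_onD (phi psi : R -> R) (t : R) : ac_on t phi -> ac_on t psi ->
  ac_on t (fun s => phi s + psi s).
Proof.
move=> ac1 ac2 e e0; have e20 : 0 < e / 2 by rewrite divr_gt0.
have [d1 d10 H1] := ac1 _ e20; have [d2 d20 H2] := ac2 _ e20.
exists (Num.min d1 d2); first by rewrite lt_min d10.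
move=> N a b ab disj; rewrite lt_min => /andP[/(H1 N a b ab disj) {}H1 /(H2 N a b ab disj) {}H2].
rewrite [e]splitr; apply: le_lt_trans (ltrD H1 H2); rewrite -big_split/=.
apply: ler_sum => i _; rewrite opprD addrACA; exact: ler_normD.
Qed.

Lemma ac_on_of_le (phi : R -> R) (v : R -> l2 R J) (L t : R) : 0 <= L -> t <= T -> vac T v ->
  (forall a b, 0 <= a -> a <= b -> b <= T -> `|phi b - phi a| <= L * `|v b - v a|) ->
  ac_on t phi.
Proof.
move=> L0 tT acv H e e0; have L1 : 0 < L + 1 by rewrite ltr_wpDl.
have [d d0 Hd] := acv _ (divr_gt0 e0 L1); exists d => // N a b ab disj sumd.
have ab' i : 0 <= a i /\ a i <= b i /\ b i <= T.
  by have [a0 [le_ab bt]] := ab i; split=> //; split=> //; exact: le_trans tT.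
have := Hd N a b ab' disj sumd; rewrite ltr_pdivlMr//; apply: le_lt_trans.
rewrite mulr_suml; apply: ler_sum => i _; have [a0 [le_ab bT]] := ab' i.
by rewrite (le_trans (H _ _ a0 le_ab bT))// mulrC ler_wpM2l// lerDl.
Qed.

Lemma ac_on_lipschitz (phi : R -> R) (L t : R) : 0 <= L ->
  (forall a b, 0 <= a -> a <= b -> b <= t -> `|phi b - phi a| <= L * (b - a)) -> ac_on t phi.
Proof.
move=> L0 H e e0; have L1 : 0 < L + 1 by rewrite ltr_wpDl.
exists (e / (L + 1)); first by rewrite divr_gt0.
move=> N a b ab disj; rewrite ltr_pdivlMr// => sd; apply: le_lt_trans sd.
rewrite mulr_suml; apply: ler_sum => i _; have [a0 [le_ab bT]] := ab i.
by rewrite (le_trans (H _ _ a0 le_ab bT))// mulrC ler_wpM2l ?subr_ge0// lerDl.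
Qed.

End MeanValue.

Section Energy.
Variables (R : realType) (J : countType) (T : R).
Hypothesis T_gt0 : 0 < T.
Notation mu := (@lebesgue_measure R).
Notation Rm := (measurableTypeR R).

Variables (B : l2 R J -> l2 R J) (M : R) (f u v : R -> l2 R J) (G : R -> R).
Hypothesis M_ge0 : 0 <= M.
Hypothesis BM : pos_op B M.
Hypothesis du : forall t, 0 <= t <= T -> vderiv T u t (v t).
Hypothesis acv : vac T v.
Hypothesis ae_eq : {ae mu, forall t : Rm, 0 < t <= T ->
  exists2 w, vderiv T v t w & w + B (u t) = f t}.
Hypothesis mG : measurable_fun [set: Rm] G.
Hypothesis G_ge0 : forall t, 0 <= G t.
Hypothesis iG : mu.-integrable `[0, T] (EFin \o G).
Hypothesis ae_fG : {ae mu, forall t : Rm, 0 <= t <= T -> `|f t| ^+ 2 <= G t}.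

Definition energy t : R := dot (v t) (v t) + dot (B (u t)) (u t).

Lemma energy_ge0 t : 0 <= energy t.
Proof. by rewrite /energy addr_ge0 ?dot_ge0 ?(pos_op_ge0 BM). Qed.

Let IG : R := \int[mu]_(t in `[0, T]) G t.

(* AM-GM: [2 <f, v> <= 2 T |f|^2 + |v|^2 / (2 T)], integrated over a length at most [T]. *)
Lemma energy_bound_step (S : R) : (forall t, 0 <= t <= T -> energy t <= S) ->
  forall t, 0 <= t <= T -> energy t <= energy 0 + 2 * T * IG + S / 2.
Proof.
move=> ES t1 /andP[t10 t1T].
have T0 := ltW T_gt0.
have [C vC] := vac_bounded T0 acv.
have C0 : 0 <= C by rewrite (le_trans _ (vC 0 _)) ?lexx.
have ulip := vderiv_lipschitz du vC.
have S0 : 0 <= S.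
  by apply: le_trans (energy_ge0 0) (ES 0 _); rewrite lexx.
(* The scalar [G] is viewed as a vector over a one-point index, so that the results on vector
   primitives apply to it. *)
pose gv (s : R) : l2 R unit := G s *: delta R tt.
have gvG s : `|gv s| = G s.
  rewrite l2_normZ l2_normE dot_delta deltaE eqxx sqrtr1 mulr1.
  exact: ger0_norm.
have igv : vintegrable `[0, T] gv.
  apply: (vintegrable_dom (measurable_itvD _) _ iG) => [|s _]; last by rewrite gvG.
  by apply: vmeasZ => //; exact: vmeas_cst.
pose PG s : R := prim T gv s tt.
have PG0 : PG 0 = 0 by rewrite /PG prim_0 ?l2_0.
have PGle : PG t1 <= IG.
  rewrite /PG; apply: le_trans (ler_norm _) _; apply: le_trans (norm_coord_le _ _) _.
  apply: le_trans (prim_le_total T0 t1 igv) _.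
  by under eq_Rintegral do rewrite gvG.
have [K uK] : exists K, forall t, 0 <= t <= T -> `|u t| <= K.
  exists (`|u 0| + C * T) => t /andP[t0 tT].
  rewrite -(subrK (u 0) (u t)) addrC (le_trans (ler_normD _ _))// lerD2l.
  by rewrite (le_trans (ulip 0 t _ t0 tT))// subr0 ler_wpM2l.
have K0 : 0 <= K by rewrite (le_trans _ (uK 0 _)) ?lexx.
pose c := S / (2 * T); have c0 : 0 <= c by rewrite divr_ge0 ?mulr_ge0.
pose psi s := energy s + (- (2 * T) * PG s + - c * s).
have ac_psi : ac_on t1 psi.
  apply: ac_onD; first apply: ac_onD.
  - apply: (ac_on_of_le (L := 2 * C) _ t1T acv) => [|a b a0 ab bT]; first exact: mulr_ge0.
    have -> : dot (v b) (v b) - dot (v a) (v a) = dot (v b - v a) (v b + v a).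
      by rewrite !dotE (dotC (v b) (v a)); ring.
    rewrite (le_trans (norm_dot_le _ _))// mulrC ler_wpM2r//.
    rewrite (le_trans (ler_normD _ _))// mulrDl mul1r lerD// vC//.
      by rewrite (le_trans a0 ab).
    by rewrite a0 (le_trans ab).
  - apply: (ac_on_lipschitz (L := 2 * M * K * C)) => [|a b a0 ab bt]; first by rewrite !mulr_ge0.
    have bT := le_trans bt t1T.
    have -> : dot (B (u b)) (u b) - dot (B (u a)) (u a) = dot (B (u b - u a)) (u b + u a).
      rewrite (pos_opB _ _ BM) !dotE.
      by rewrite (pos_op_sym BM (u b) (u a)) (dotC (u b)); ring.
    rewrite (le_trans (norm_dot_le _ _))//.
    have n1 := le_trans (pos_op_bound BM (u b - u a)) (ler_wpM2l M_ge0 (ulip _ _ a0 ab bT)).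
    have n2 : `|u b + u a| <= 2 * K.
      rewrite (le_trans (ler_normD _ _))// mulrDl mul1r lerD// uK//.
        by rewrite (le_trans a0 ab).
      by rewrite a0 (le_trans ab).
    rewrite (le_trans (ler_pM _ _ n1 n2))//.
    by rewrite le_eqVlt; apply/orP; left; apply/eqP; ring.
  - apply: ac_onD.
    + apply: (ac_on_of_le (L := 2 * T) _ t1T (prim_vac igv)) => [|a b a0 ab bT].
        exact: mulr_ge0.
      have T20 : 0 <= 2 * T by exact: mulr_ge0.
      rewrite -mulrBr normrM normrN (ger0_norm T20); apply: ler_wpM2l => //.
      by rewrite /PG -l2B; exact: norm_coord_le.
    + apply: (ac_on_lipschitz (L := c)) => // a b a0 ab _.
      by rewrite -mulrBr normrM normrN (ger0_norm c0) ger0_norm ?subr_ge0.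
pose P (t : Rm) := [/\ 0 < t <= T -> exists2 w, vderiv T v t w & w + B (u t) = f t,
   0 <= t <= T -> `|f t| ^+ 2 <= G t & 0 <= t <= T -> vderiv T (prim T gv) t (gv t)].
have aeP0 : {ae mu, forall t : Rm, P t}.
  move: ae_eq ae_fG (prim_vderiv_ae T0 igv); apply: filterS3 => t H1 H2 H3.
  by split.
(* Time 0 joins the exceptional set: the equation is required at positive times only. *)
have aeP : mu.-negligible (~` [set t | P t] `|` [set 0]).
  apply: negligibleU; first exact: aeP0.
  by apply/negligibleP => //; exact: lebesgue_measure_set1.
have good t : 0 <= t <= t1 -> ~ (~` [set t | P t] `|` [set 0]) t ->
    exists2 a, sderiv T psi t a & a <= 0.
  move=> /andP[t0 tt1] nbad.
  have tT : 0 <= t <= T by rewrite t0 (le_trans tt1).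
  have tpos : 0 < t <= T.
    rewrite (le_trans tt1 t1T) andbT lt_def t0 andbT; apply/eqP => tz.
    by apply: nbad; right.
  have [H1 H2 H3] : P t by apply: contrapT => nP; apply: nbad; left.
  have [w dw wE] := H1 tpos; have fG := H2 tT; have dPG := H3 tT.
  exists ((dot w (v t) + dot (v t) w) + (dot (B (v t)) (u t) + dot (B (u t)) (v t)) +
          (- (2 * T) * G t + - c * 1)).
    apply: sderivD; first apply: sderivD.
    - exact: sderiv_dot.
    - by apply: sderiv_dot; [exact: vderiv_op BM (du tT)|exact: du].
    - apply: sderivD; last by apply: sderivZ; exact: sderiv_id.
      apply: sderivZ => e e0; have [r r0 Hr] := dPG e e0; exists r => [//|s sT /(Hr s sT)].
      apply: le_trans; apply: le_trans (norm_coord_le _ tt); rewrite /gv !l2E deltaE mulr1.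
      exact: lexx.
  (* By symmetry of [B] the potential part contributes [2 <B u, v>]; together with [2 <w, v>] it
     leaves only the source, by the equation. *)
  have -> : dot w (v t) + dot (v t) w + (dot (B (v t)) (u t) + dot (B (u t)) (v t)) =
      2 * dot (f t) (v t).
    by rewrite -wE !dotE (dotC (v t) w) (pos_op_sym BM (v t)) (dotC (v t) (B _)); ring.
  have vS : `|v t| ^+ 2 <= S.
    by rewrite l2_norm_sqr (le_trans _ (ES t tT))// lerDl (pos_op_ge0 BM).
  have fv := dot_le (f t) (v t).
  have AG : 2 * (`|f t| * `|v t|) <= 2 * T * `|f t| ^+ 2 + `|v t| ^+ 2 / (2 * T).
    rewrite -subr_ge0 (_ : _ - _ = (2 * T * `|f t| - `|v t|) ^+ 2 / (2 * T)).
      by rewrite divr_ge0 ?sqr_ge0 ?mulr_ge0.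
    by field; rewrite gt_eqF.
  have TG : 2 * T * `|f t| ^+ 2 <= 2 * T * G t by rewrite ler_wpM2l ?mulr_ge0.
  have Tc : `|v t| ^+ 2 / (2 * T) <= c.
    by rewrite /c ler_wpM2r ?invr_ge0 ?mulr_ge0.
  move: fv AG TG Tc; set A1 := dot _ _; set A2 := `|f t| * _; set A3 := _ * `|f t| ^+ 2.
  by set A4 := _ / _; set A5 := _ * G t; rewrite mulNr -/A5 => *; lra.
have := ac_nonincreasing t10 ac_psi aeP; rewrite /psi PG0 !mulr0 !addr0 => H.
have {}H : energy t1 + (- (2 * T) * PG t1 + - c * t1) <= energy 0.
  apply: H => t tt1 nbad e e0.
  have [a da a0] := good t tt1 nbad; have [r r0 Hr] := sderiv_le0_good da a0 e0.
  exists r => [//|s /andP[s0 st1] st]; apply: Hr => //.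
  by rewrite s0 (le_trans st1).
have TPG : 2 * T * PG t1 <= 2 * T * IG by rewrite ler_wpM2l ?mulr_ge0.
have ct : c * t1 <= S / 2.
  apply: (@le_trans _ _ (c * T)); first by rewrite ler_wpM2l.
  by rewrite /c le_eqVlt; apply/orP; left; apply/eqP; field; rewrite gt_eqF.
move: H TPG ct; rewrite mulNr mulNr.
by set A1 := 2 * T * PG t1; set A2 := 2 * T * IG; set A3 := c * t1; lra.
Qed.

(** For the supremum [S] the preceding bound reads [S <= energy 0 + 2 T IG + S / 2]; absorbing
    [S / 2] doubles the other terms. *)
Lemma energy_estimate t : 0 <= t <= T -> energy t <= 2 * energy 0 + 4 * T * IG.
Proof.
move=> tT; have T0 := ltW T_gt0.
pose Es := [set energy s | s in [set s | 0 <= s <= T]].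
have [C vC] := vac_bounded T0 acv.
have C0 : 0 <= C by rewrite (le_trans _ (vC 0 _)) ?lexx.
have ulip := vderiv_lipschitz du vC.
have zT : (0 : R) <= 0 <= T by rewrite lexx.
have supE : has_sup Es.
  split; first by exists (energy 0); exists 0.
  exists (C ^+ 2 + M * (`|u 0| + C * T) ^+ 2) => _ [s /= sT <-]; apply: lerD.
    by rewrite -l2_norm_sqr ler_pXn2r ?nnegrE// vC.
  have uK : `|u s| <= `|u 0| + C * T.
    have /andP[s0 sT'] := sT.
    rewrite -(subrK (u 0) (u s)) addrC (le_trans (ler_normD _ _))// lerD2l.
    by rewrite (le_trans (ulip 0 s _ s0 sT'))// subr0 ler_wpM2l.
  rewrite (le_trans (dot_le _ _))//.
  apply: (@le_trans _ _ (M * `|u s| * `|u s|)); first by rewrite ler_wpM2r// (pos_op_bound BM).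
  rewrite -mulrA ler_wpM2l// -expr2 ler_pXn2r ?nnegrE//.
  by rewrite addr_ge0 ?mulr_ge0.
have ub s : 0 <= s <= T -> energy s <= sup Es.
  by move=> sT; apply: sup_upper_bound => //; exists s.
have H : sup Es <= energy 0 + 2 * T * IG + sup Es / 2.
  apply: sup_le_ub; first by case: supE.
  by move=> _ [s /= sT <-]; exact: energy_bound_step.
by apply: le_trans (ub t tT) _; move: H; set A := sup Es; lra.
Qed.

End Energy.

Local Open Scope complex_scope.

(** * Comparison of integrals; complex families as real vectors *)

Section IntegralMonotone.
Context d (X : measurableType d) (R : realType) (mu : {measure set X -> \bar R}).

Lemma ge0_integral_le (D : set X) (f1 f2 : X -> \bar R) :
  (forall x, D x -> (0 <= f1 x)%E) -> (forall x, D x -> (f1 x <= f2 x)%E) ->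
  (\int[mu]_(x in D) f1 x <= \int[mu]_(x in D) f2 x)%E.
Proof.
move=> f10 f12; rewrite !(integral_mkcond D) !ge0_integralTE; last 2 first.
- apply: erestrict_ge0 => x Dx; exact: le_trans (f10 x Dx) (f12 x Dx).
- exact: erestrict_ge0.
apply: le_ereal_sup => _ [h hf <-]; exists h => // x.
by apply: le_trans (hf x) _; exact: lee_restrict.
Qed.

(** Measurability is asked of the smaller function: the larger one will be the squared norm of the
    data, which is only known to agree with a measurable function off a null set. *)
Lemma ge0_ae_integral_le (D N : set X) (f1 f2 : X -> \bar R) :
  measurable D -> measurable N -> mu N = 0%E -> measurable_fun D f1 ->
  (forall x, D x -> (0 <= f1 x)%E) -> (forall x, D x -> (0 <= f2 x)%E) ->
  (forall x, D x -> ~ N x -> (f1 x <= f2 x)%E) ->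
  (\int[mu]_(x in D) f1 x <= \int[mu]_(x in D) f2 x)%E.
Proof.
move=> mD mN N0 mf1 f10 f20 f12.
have mDN : measurable (D `\` N) by exact: measurableD.
rewrite (ge0_negligible_integral mN mD mf1 f10 N0).
rewrite [leRHS]integral_mkcond [leLHS]integral_mkcond.
apply: ge0_integral_le => x _; first by apply: erestrict_ge0 => y [Dy _]; exact: f10.
rewrite !patchE; case: ifPn => [/set_mem[Dx Nx]|_].
  by rewrite mem_set//; exact: f12.
by case: ifPn => // /set_mem; exact: f20.
Qed.

End IntegralMonotone.

Section Norms.
Variables (R : realType) (K : choiceType).
Implicit Types (u v : K -> R[i]).

Definition part u (p : K * bool) : R :=
  if p.2 then complex.Im (u p.1) else complex.Re (u p.1).

Lemma esum_bool (a : bool -> \bar R) : (forall b, (0 <= a b)%E) ->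
  (\esum_(b in [set: bool]) a b = a false + a true)%E.
Proof.
move=> a0; rewrite (esumID [set false])//; congr (_ + _)%E.
  by rewrite setTI esum_set1.
rewrite setTI (_ : ~` [set false] = [set true]) ?esum_set1//.
by apply/seteqP; split=> -[]//= H; exfalso; exact: H.
Qed.

Lemma esum_part u : \esum_(x in [set: K]) (Normc.normc (u x) ^+ 2)%:E =
  \esum_(p in [set: K * bool]) (part u p ^+ 2)%:E.
Proof.
rewrite (_ : [set: K * bool] = [set: K] `*`` (fun=> [set: bool])); last first.
  by apply/seteqP; split.
rewrite -(@esum_esum _ _ _ [set: K] (fun=> [set: bool]) (fun k b => (part u (k, b) ^+ 2)%:E)).
  apply: eq_esum => x _; rewrite esum_bool => [|b]; last by rewrite lee_fin sqr_ge0.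
  rewrite -EFinD; congr EFin; rewrite /part/=; case: (u x) => a b /=.
  by rewrite sqr_sqrtr// addr_ge0 ?sqr_ge0.
by move=> k b _ _; rewrite lee_fin sqr_ge0.
Qed.

Lemma l2norm_ge0 u : (0 <= l2norm u)%E.
Proof. exact: poweR_ge0. Qed.

Lemma l2norm_lty u : in_l2 u <->
  (\esum_(p in [set: K * bool]) (part u p ^+ 2)%:E < +oo)%E.
Proof.
rewrite -esum_part /in_l2 /l2norm; set s := esum _ _.
have : (0 <= s)%E by apply: esum_ge0 => x _; rewrite lee_fin sqr_ge0.
by case: s => [r r0| |]//; rewrite ?poweR_EFin ?ltry// poweRyr.
Qed.

Definition emb u : l2 R (K * bool)%type := mkl2 (part u).

Lemma in_l2P u : in_l2 u <-> exists w : l2 R (K * bool)%type, forall p, w p = part u p.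
Proof.
rewrite l2norm_lty; split=> [uoo|[w wu]].
  have Hs := has_sum_esum (fun p => sqr_ge0 (part u p)) uoo.
  exists (emb u); apply: mkl2E => A.
  exact: (has_sum_ge_fin A (fun p => sqr_ge0 (part u p)) Hs).
have Hs : has_sum (fun p => part u p ^+ 2) (dot w w).
  by apply: eq_has_sum (has_sum_dot w w) => p; rewrite wu expr2.
by rewrite (esum_has_sum (fun p => sqr_ge0 (part u p)) Hs) ltry.
Qed.

Lemma embE u : in_l2 u -> forall p, emb u p = part u p.
Proof.
move=> /in_l2P[w wu] p; apply: (@mkl2E _ _ _ (`|w| ^+ 2)) => A.
by under eq_bigr do rewrite -wu; exact: sum_sqr_le.
Qed.

Lemma l2norm_emb u (w : l2 R (K * bool)%type) : (forall p, w p = part u p) ->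
  l2norm u = `|w|%:E.
Proof.
move=> wu; rewrite /l2norm esum_part.
have Hs : has_sum (fun p => part u p ^+ 2) (dot w w).
  by apply: eq_has_sum (has_sum_dot w w) => p; rewrite wu expr2.
rewrite (esum_has_sum (fun p => sqr_ge0 (part u p)) Hs) poweR_EFin.
by rewrite powR12_sqrt ?dot_ge0// l2_normE.
Qed.

Lemma in_l2_of_part u (w : l2 R (K * bool)%type) : (forall p, w p = part u p) -> in_l2 u.
Proof. by move=> wu; apply/in_l2P; exists w. Qed.

Lemma emb_of_part u (w : l2 R (K * bool)%type) : (forall p, w p = part u p) -> emb u = w.
Proof. by move=> wu; apply: l2P => p; rewrite wu; apply: embE; exact: in_l2_of_part wu. Qed.

(** Valid outside l^2 too, where the norm is infinite; convergence of [l2norm] thus gives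
    convergence of coordinates with no membership to check. *)
Lemma part_le_l2norm u p : ((`|part u p|)%:E <= l2norm u)%E.
Proof.
have [ul2|] := pselect (in_l2 u).
  by rewrite (l2norm_emb (embE ul2)) lee_fin -(embE ul2) norm_coord_le.
by rewrite /in_l2; move: (l2norm_ge0 u); case: (l2norm u) => [r _ []|_ _|//]; rewrite ?ltry ?leey.
Qed.

Lemma partB u v p : part (fun x => u x - v x) p = part u p - part v p.
Proof. by rewrite /part; case: p.2 => /=; case: (u p.1) => a b; case: (v p.1). Qed.

Lemma partD u v p : part (fun x => u x + v x) p = part u p + part v p.
Proof. by rewrite /part; case: p.2 => /=; case: (u p.1) => a b; case: (v p.1). Qed.

Lemma partZ (a : R) u p : part (fun x => a%:C * u x) p = a * part u p.
Proof.
by rewrite /part; case: p.2 => /=; case: (u p.1) => b c /=; rewrite !mul0r ?addr0 ?subr0.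
Qed.

Lemma part_inj u v : (forall p, part u p = part v p) -> u = v.
Proof.
move=> uv; apply/funext => x; have := uv (x, false); have := uv (x, true).
by rewrite /part/=; case: (u x) => a b; case: (v x) => c d /= -> ->.
Qed.

Definition unemb (w : l2 R (K * bool)%type) : K -> R[i] := fun x => w (x, false) +i* w (x, true).

Lemma part_unemb (w : l2 R (K * bool)%type) p : w p = part (unemb w) p.
Proof. by case: p => x []. Qed.

Lemma in_l2_unemb (w : l2 R (K * bool)%type) : in_l2 (unemb w).
Proof. exact: in_l2_of_part (part_unemb w). Qed.

Lemma emb_unemb (w : l2 R (K * bool)%type) : emb (unemb w) = w.
Proof. exact: emb_of_part (part_unemb w). Qed.

Lemma unemb_emb u : in_l2 u -> unemb (emb u) = u.
Proof. by move=> ul2; apply: part_inj => p; rewrite -part_unemb embE. Qed.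

Lemma l2normB u v : in_l2 u -> in_l2 v -> l2norm (fun x => u x - v x) = `|emb u - emb v|%:E.
Proof. by move=> u2 v2; apply: l2norm_emb => p; rewrite l2B !embE// partB. Qed.

Lemma l2normE u : in_l2 u -> l2norm u = `|emb u|%:E.
Proof. by move=> u2; apply: l2norm_emb; exact: embE. Qed.

End Norms.

Section Reindexing.
Variables (R : realType) (I K : choiceType) (sigma : I -> K) (tau : K -> I).
Hypothesis tauK : cancel tau sigma.
Hypothesis sigmaK : cancel sigma tau.
Implicit Type F : K * bool -> R.

Let doubled (A : {fset I}) : {fset K * bool} :=
  [fset p in [seq (sigma j, false) | j <- A] ++ [seq (sigma j, true) | j <- A]]%fset.

Let mem_doubled (A : {fset I}) p : (p \in doubled A) =
  (p \in [seq (sigma j, false) | j <- A] ++ [seq (sigma j, true) | j <- A]).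
Proof. by rewrite !inE mem_cat. Qed.

Let sum_doubled (A : {fset I}) F :
  \sum_(p <- doubled A) F p = \sum_(j <- A) (F (sigma j, false) + F (sigma j, true)).
Proof.
have inj b : injective (fun j => (sigma j, b)) by move=> x y [/(can_inj sigmaK)].
rewrite (perm_big ([seq (sigma j, false) | j <- A] ++ [seq (sigma j, true) | j <- A])).
  by rewrite big_cat !big_map big_split.
apply: uniq_perm; first exact: fset_uniq.
  rewrite cat_uniq !map_inj_uniq ?fset_uniq//= andbT.
  by apply/hasPn => p /mapP[j _ ->]; apply/mapP => -[i _ []].
exact: mem_doubled.
Qed.

(** Groups the two real coordinates of each site and renames the sites: a matrix row sum over sites
    becomes the sum over shifts that defines [fraclap]. *)
Lemma has_sum_pairs F s : has_sum F s ->
  has_sum (fun j => F (sigma j, false) + F (sigma j, true)) s.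
Proof.
move=> Fs e e0; have [A0 HA] := Fs e e0.
exists [fset tau p.1 | p in A0]%fset => A A0A; rewrite -sum_doubled; apply: HA.
apply/fsubsetP => -[x b] xbA; rewrite mem_doubled mem_cat.
have xA : tau x \in A by apply: (fsubsetP A0A); apply/imfsetP; exists (x, b).
by apply/orP; case: b xbA => _; [right|left]; apply/mapP; exists (tau x); rewrite ?tauK.
Qed.

Lemma sums_bounded_pairs F M : sums_bounded (fun p => `|F p|) M ->
  sums_bounded (fun j => `|F (sigma j, false) + F (sigma j, true)|) M.
Proof.
move=> FM A; apply: le_trans (FM (doubled A)); rewrite sum_doubled.
by apply: ler_sum => j _; exact: ler_normD.
Qed.

End Reindexing.

(** * The Cauchy problem on the lattice *)

Section LatticeCoordinates.
Variables (R : realType) (n : nat) (h : R).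

Lemma lattice_point_subproof (k : 'rV[int]_n) : h *: map_mx intr k \in lattice n h.
Proof. by apply/mem_set; exists k. Qed.

Definition lattice_point (k : 'rV[int]_n) : lattice n h :=
  exist _ (h *: map_mx intr k) (lattice_point_subproof k).

Lemma lattice_coord_exists (x : lattice n h) : exists k, lattice_point k = x.
Proof.
case: x => x xL; have /set_mem[k kx] := xL; exists k; exact/val_inj/esym.
Qed.

(** An arbitrary preimage: enough for the lattice to be countable whatever [h]. It is a two-sided
    inverse once [h != 0]. *)
Definition lattice_coord (x : lattice n h) : 'rV[int]_n := projT1 (cid (lattice_coord_exists x)).

Lemma lattice_coordK : cancel lattice_coord lattice_point.
Proof. by move=> x; rewrite /lattice_coord; case: cid. Qed.

HB.instance Definition _ := CanIsCountable lattice_coordK.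

Lemma lattice_pointK : h != 0 -> cancel lattice_point lattice_coord.
Proof.
move=> h0 k; have := lattice_coordK (lattice_point k); set l := lattice_coord _.
move=> /(congr1 val) /= /(scalerI h0)/matrixP H; apply/matrixP => i j.
by have := H i j; rewrite !mxE => /intr_inj.
Qed.

Lemma lattice_shiftE (x : lattice n h) j :
  lattice_shift x j = lattice_point (lattice_coord x + j).
Proof.
apply: val_inj; rewrite /= -{1}(lattice_coordK x) /= map_mxD scalerDr.
by [].
Qed.

End LatticeCoordinates.

Section FractionalLaplacian.
Variables (R : realType) (n : nat) (alpha h : R).
Hypothesis alpha_gt0 : 0 < alpha.
Hypothesis h_gt0 : 0 < h.
Notation K := (lattice n h).
Notation J := (K * bool)%type.

Let phi (p : K * bool) := (lattice_coord p.1, p.2).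

Let phi_inj : injective phi.
Proof. by move=> [x b] [y c] [/(can_inj (@lattice_coordK R n h)) -> ->]. Qed.

Let kernel (p q : K * bool) : R := symbol_kernel alpha (phi p) (phi q).

Let pull (A : {fset K * bool}) (c : K * bool -> R) :
  \sum_(x <- A) \sum_(y <- A) kernel x y * (c x * c y) =
  \sum_(p <- [fset phi x | x in A]%fset) \sum_(q <- [fset phi x | x in A]%fset)
     symbol_kernel alpha p q *
       (c (lattice_point h p.1, p.2) * c (lattice_point h q.1, q.2)).
Proof.
rewrite big_imfset/=; last by move=> x y _ _; exact: phi_inj.
apply: eq_bigr => x _; rewrite big_imfset/=; last by move=> z y _ _; exact: phi_inj.
by apply: eq_bigr => y _; rewrite !lattice_coordK; case: x y => [x b] [y b'].
Qed.

(** In integer coordinates the kernel is [symbol_kernel], whose rows, regrouped along [sigma] and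
    [tau], give the complex convolution. The bound on absolute sums from [matrix_op] is what
    identifies the limit with the value of [rsum]. *)
Lemma fraclap_op_exists : exists2 B : l2 R J -> l2 R J,
  pos_op B ((4 * n%:R) `^ alpha) &
  forall u, in_l2 u -> forall p, B (emb u) p = part (fraclap alpha u) p.
Proof.
have K0 (A : {fset K * bool}) (c : K * bool -> R) :
    0 <= \sum_(x <- A) \sum_(y <- A) kernel x y * (c x * c y).
  by rewrite pull; exact: symbol_kernel_ge0.
have KM (A : {fset K * bool}) (c : K * bool -> R) :
    \sum_(x <- A) \sum_(y <- A) kernel x y * (c x * c y) <=
    (4 * n%:R) `^ alpha * \sum_(x <- A) c x ^+ 2.
  rewrite pull (le_trans (symbol_kernel_le alpha_gt0 _ _))// ler_wpM2l ?powR_ge0//.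
  rewrite big_imfset/=; last by move=> x y _ _; exact: phi_inj.
  by rewrite le_eqVlt (eq_bigr (fun x => c x ^+ 2)) ?eqxx// => -[x b] _; rewrite lattice_coordK.
have Ksym x y : kernel x y = kernel y x by exact: symbol_kernel_sym.
have [B BM BE] := matrix_op (powR_ge0 _ _) Ksym K0 KM.
exists B => // u u2 [x b].
have h0 : h != 0 by rewrite gt_eqF.
pose sigma (j : 'rV[int]_n) := lattice_shift x j.
pose tau (y : K) := lattice_coord y - lattice_coord x.
have tauK : cancel tau sigma.
  by move=> y; rewrite /sigma lattice_shiftE /tau addrC subrK lattice_coordK.
have sigmaK : cancel sigma tau.
  by move=> j; rewrite /tau /sigma lattice_shiftE lattice_pointK// addrC addKr.
have [Hs [N HN]] := BE (emb u) (x, b).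
have Hp := has_sum_pairs tauK sigmaK Hs.
have HNp := sums_bounded_pairs sigmaK HN.
have coordE j : lattice_coord (sigma j) - lattice_coord x = j by exact: sigmaK.
have kernelE j c : kernel (x, b) (sigma j, c) =
    if b == c then complex.Re (fraclap_coef alpha j)
    else if b then complex.Im (fraclap_coef alpha j) else - complex.Im (fraclap_coef alpha j).
  rewrite -{2 3 4}(coordE j) -symbol_kernelE//.
rewrite -(rsumE HNp Hp) /fraclap /csum /part/=.
have term j : kernel (x, b) (sigma j, false) * emb u (sigma j, false) +
    kernel (x, b) (sigma j, true) * emb u (sigma j, true) =
    part (fun j => fraclap_coef alpha j * u (sigma j)) (j, b).
  rewrite !kernelE !embE// /part; case: (fraclap_coef alpha j) => a1 a2.
  by case: (u (sigma j)) => c d; case: (b) => /=; ring.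
by case: b kernelE term {Hs HN Hp HNp} => _ term; congr rsum; apply/funext => j; exact: term.
Qed.

Variable m : K -> R.
Hypothesis m_ge0 : forall x, 0 <= m x.
Hypothesis m_bounded : (linfnorm m < +oo)%E.

Definition wave_bound : R := h `^ (- (2 * alpha)) * (4 * n%:R) `^ alpha + fine (linfnorm m).

Lemma linfnorm_fin : linfnorm m = (fine (linfnorm m))%:E.
Proof.
rewrite fineK// fin_numElt m_bounded andbT.
have : ((`|m (lattice_point h 0)|)%:E <= linfnorm m)%E.
  by apply: ereal_sup_ubound; exists (lattice_point h 0).
by apply: lt_le_trans; exact: ltNyr.
Qed.

Lemma le_linfnorm x : m x <= fine (linfnorm m).
Proof.
rewrite -lee_fin -linfnorm_fin; apply: ereal_sup_ubound; exists x => //.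
by rewrite ger0_norm.
Qed.

Lemma wave_bound_ge0 : 0 <= wave_bound.
Proof.
rewrite addr_ge0 ?mulr_ge0 ?powR_ge0//.
exact: le_trans (m_ge0 (lattice_point h 0)) (le_linfnorm _).
Qed.

Lemma wave_op_exists : exists2 B : l2 R J -> l2 R J, pos_op B wave_bound &
  forall u, in_l2 u -> forall p, B (emb u) p =
    part (fun x => (h `^ (- (2 * alpha)))%:C * fraclap alpha u x + (m x)%:C * u x) p.
Proof.
have [B1 B1M B1E] := fraclap_op_exists.
have mb (p : J) : 0 <= m p.1 <= fine (linfnorm m) by rewrite m_ge0 le_linfnorm.
have [B2 B2M B2E] := pos_op_diag mb.
exists (fun w => h `^ (- (2 * alpha)) *: B1 w + B2 w).
  by apply: pos_op_add => //; apply: pos_op_scale => //; exact: powR_ge0.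
move=> u u2 p; rewrite l2D l2Z B1E// B2E embE// partD partZ; congr (_ + _).
by rewrite /part; case: p => x []/=; case: (u x) => a b /=; rewrite !mul0r ?addr0 ?subr0.
Qed.

End FractionalLaplacian.

(** * Derivatives, absolute continuity and data carried to real vectors *)

Section Transport.
Variables (R : realType) (K : countType) (T : R).
Hypothesis T_gt0 : 0 < T.
Notation J := (K * bool)%type.
Notation mu := (@lebesgue_measure R).
Notation Rm := (measurableTypeR R).
Implicit Types (u v w : K -> R[i]).

Lemma ecvg0P (I : Type) (F : set_system I) (FF : Filter F) (phi : I -> \bar R) (psi : I -> R) :
  (\forall s \near F, phi s = (psi s)%:E /\ 0 <= psi s) ->
  (phi @ F --> 0%E <-> forall e, 0 < e -> \forall s \near F, psi s <= e).
Proof.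
move=> phipsi; split=> [cv e e0|H].
  have H1 := cv _ (@nbhs_open_ereal_lt R 0 (fun=> e) e0).
  by apply: filterS2 phipsi H1 => s [E _] /=; rewrite E lte_fin => /ltW.
apply/fine_cvgP; split; first by apply: filterS phipsi => s [E _]; rewrite /= E.
apply/cvgrPdist_le => e e0; apply: filterS2 phipsi (H e e0) => s [E p0] pe.
by rewrite /= E sub0r normrN ger0_norm.
Qed.

Lemma divr_realC (z : R[i]) (r : R) : z / r%:C = (r^-1)%:C * z.
Proof. by rewrite mulrC fmorphV. Qed.

Lemma nbhs_ballR (t : R) (P : R -> Prop) :
  nbhs t P <-> exists2 r : R, 0 < r & forall s, `|s - t| < r -> P s.
Proof.
split=> [/nbhs_ballP[r /= r0 H]|[r r0 H]].
  by exists r => // s st; apply: H; rewrite /ball/= distrC.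
by apply/nbhs_ballP; exists r => //= s; rewrite /ball/= distrC; exact: H.
Qed.

Lemma near_punctured (t : R) (P : R -> Prop) :
  (\forall s \near within [set` `[0, T]] t^', P s) <->
  exists2 r : R, 0 < r & forall s, `|s - t| < r -> s != t -> 0 <= s <= T -> P s.
Proof.
transitivity (nbhs t (fun s => s != t -> s \in `[0, T] -> P s)); first by [].
by split=> [/nbhs_ballR[r r0 H]|[r r0 H]]; [|apply/nbhs_ballR]; exists r => // s st sn;
  have := H s st sn; rewrite in_itv.
Qed.

Lemma near_itv (t : R) (P : R -> Prop) :
  (\forall s \near within [set` `[0, T]] (nbhs t), P s) <->
  exists2 r : R, 0 < r & forall s, `|s - t| < r -> 0 <= s <= T -> P s.
Proof.
transitivity (nbhs t (fun s => s \in `[0, T] -> P s)); first by [].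
by split=> [/nbhs_ballR[r r0 H]|[r r0 H]]; [|apply/nbhs_ballR]; exists r => // s st;
  have := H s st; rewrite in_itv.
Qed.

(** Multiplying by [|s - t|] turns the quotient into the remainder; at [s = t], which the punctured
    limit excludes, the remainder is 0. *)
Lemma l2_derivativeP (u : R -> K -> R[i]) t w :
  (forall s, 0 <= s <= T -> in_l2 (u s)) -> in_l2 w -> 0 <= t <= T ->
  l2_derivative T u t w <-> vderiv T (fun s => emb (u s)) t (emb w).
Proof.
move=> u2 w2 tT.
pose psi s := `|(s - t)^-1 *: (emb (u s) - emb (u t)) - emb w|.
have E s : 0 <= s <= T ->
    l2norm (fun x => (u s x - u t x) / (s - t)%:C - w x) = (psi s)%:E.
  move=> sT; apply: l2norm_emb => p; have us := u2 s sT; have ut := u2 t tT.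
  rewrite !l2E !embE//.
  by under eq_fun do rewrite divr_realC; rewrite partB partZ partB.
have psiE s e : s != t -> (psi s <= e) =
    (`|emb (u s) - emb (u t) - (s - t) *: emb w| <= e * `|s - t|).
  move=> st; have st0 : s - t != 0 by rewrite subr_eq0.
  rewrite -ler_pdivrMr ?normr_gt0// mulrC -normfV -l2_normZ scalerBr scalerA mulVf//.
  by rewrite scale1r.
have near_E : \forall s \near within [set` `[0, T]] t^',
    l2norm (fun x => (u s x - u t x) / (s - t)%:C - w x) = (psi s)%:E /\ 0 <= psi s.
  apply/near_punctured; exists 1; first exact: ltr01.
  by move=> s _ _ sT; split; [exact: E|exact: normr_ge0].
rewrite /l2_derivative (ecvg0P _ near_E); split=> H e e0.
  have /near_punctured[r r0 Hr] := H e e0; exists r => // s sT st.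
  have [->|sn] := eqVneq s t.
    by rewrite !subrr scale0r subr0 !normr0 mulr0.
  by rewrite -psiE//; exact: Hr.
have [r r0 Hr] := H e e0; apply/near_punctured; exists r => // s st sn sT.
by rewrite psiE//; exact: Hr.
Qed.

Lemma l2_continuous_of_vcont (v : R -> l2 R J) : vcont v ->
  l2_continuous T (fun s => unemb (v s)).
Proof.
move=> cv t _.
have near_E : \forall s \near within [set` `[0, T]] (nbhs t),
    l2norm (fun x => unemb (v s) x - unemb (v t) x) = `|v s - v t|%:E /\ 0 <= `|v s - v t|.
  apply/near_itv; exists 1 => // s _ _; split=> //.
  by rewrite l2normB ?emb_unemb//; exact: in_l2_unemb.
rewrite (ecvg0P _ near_E) => e e0; have [r r0 Hr] := cv t e e0.
by apply/near_itv; exists r => // s st _; exact: Hr.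
Qed.

Lemma l2_absolutely_continuousP (v : R -> K -> R[i]) :
  (forall s, 0 <= s <= T -> in_l2 (v s)) ->
  l2_absolutely_continuous T v <-> vac T (fun s => emb (v s)).
Proof.
move=> v2.
have E N (a b : 'I_N -> R) : (forall i, 0 <= a i /\ a i <= b i /\ b i <= T) ->
    (\sum_(i < N) l2norm (fun x => v (b i) x - v (a i) x)%R)%E =
    (\sum_(i < N) `|emb (v (b i)) - emb (v (a i))|)%:E.
  move=> ab; rewrite -sumEFin; apply: eq_bigr => i _; have [a0 [le_ab bT]] := ab i.
  by apply: l2normB; apply: v2; [rewrite (le_trans a0 le_ab)|rewrite a0 (le_trans le_ab)].
split=> ac e e0; have [d d0 Hd] := ac e e0; exists d => // N a b ab disj sd.
  by have := Hd N a b ab disj sd; rewrite E// lte_fin.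
by rewrite E// lte_fin; exact: Hd.
Qed.

(** Convergence of the simple functions is known off a null set [N]. Setting the function to 0 there
    and outside [0, T] makes each coordinate an everywhere limit of cut-off simple functions, hence
    measurable. *)
Lemma in_L2_representative (f : R -> K -> R[i]) : in_L2 T f ->
  exists (F : R -> l2 R J) (N : set Rm),
    [/\ vmeas F, measurable N, mu N = 0%E &
        forall t, 0 <= t <= T -> ~ N t -> F t = emb (f t)].
Proof.
move=> [f2 [s s_simple [N [mN N0 sN]]] _].
pose D : set Rm := [set` `[0, T]] `\` N.
have mD : measurable D by apply: measurableD => //; exact: measurable_itv.
pose F t : l2 R J := if t \in D then emb (f t) else 0.
exists F, N; split=> //; last first.
  by move=> t tT Nt; rewrite /F mem_set//; split=> //; rewrite /= in_itv.
move=> p.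
pose S k (t : R) : R := \1_D t * part (s k t) p.
apply: (@measurable_fun_cvg _ _ _ _ S) => [k|t _].
  apply: measurable_funM; first exact: measurable_indic.
  have [M [A [c [mA c2 sE]]]] := s_simple k.
  rewrite (_ : (fun t => part (s k t) p) = fun t => \sum_(i < M) \1_(A i) t * part (c i) p).
    apply: measurable_sum => i; apply: measurable_funM; last exact: measurable_cst.
    by apply: measurable_indic; exact: mA.
  apply/funext => t; rewrite /part sE; case: p.2.
    rewrite (raddf_sum (@complex.Im R)); apply: eq_bigr => i _.
    by case: (c i p.1) => a b /=; rewrite mul0r addr0.
  rewrite (raddf_sum (@complex.Re R)); apply: eq_bigr => i _.
  by case: (c i p.1) => a b /=; rewrite mul0r subr0.
rewrite /S /F indicE; case: ifPn => [/set_mem[tT Nt]|_]; last first.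
  by under eq_fun do rewrite mul0r; exact: cvg_cst.
under eq_fun do rewrite mul1r.
have f2t : in_l2 (f t) by exact: f2.
rewrite embE//.
have cv : l2norm (fun x => s p' t x - f t x) @[p' --> \oo] --> 0%E.
  by apply: contrapT => ncv; apply: Nt; apply: sN => /= H; apply: ncv; exact: H.
apply/cvgrPdist_le => e e0.
have H : \forall k \near \oo, (l2norm (fun x => s k t x - f t x)%R < e%:E)%E.
  exact: (cv _ (@nbhs_open_ereal_lt R 0 (fun=> e) e0)).
apply: filterS H => k /= Hk; rewrite distrC -partB -lee_fin.
by apply: le_trans (part_le_l2norm _ p) _; exact: ltW.
Qed.

Lemma L2norm_sqr (f : R -> K -> R[i]) :
  (L2norm T f ^+ 2 = \int[mu]_(t in `[0%R, T]) (l2norm (f t) ^+ 2))%E.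
Proof.
rewrite /L2norm; set I := integral _ _ _.
have : (0 <= I)%E.
  by apply: integral_ge0 => t _; rewrite expe2 mule_ge0// l2norm_ge0.
case: I => [r r0| _|//]; last by rewrite poweRyr.
by rewrite poweR_EFin -EFin_expe powR12_sqrt// sqr_sqrtr.
Qed.

End Transport.

Section WaveEquation.
Variables (R : realType) (J : countType) (T : R) (B : l2 R J -> l2 R J) (M : R).
Hypotheses (T_gt0 : 0 < T) (M_ge0 : 0 <= M) (BM : pos_op B M).
Notation mu := (@lebesgue_measure R).
Notation Rm := (measurableTypeR R).
Implicit Types (u v f : R -> l2 R J).

Definition wave_solution u v f : Prop :=
  [/\ forall t, 0 <= t <= T -> vderiv T u t (v t), vac T v
    & {ae mu, forall t : Rm, 0 < t <= T ->
        exists2 w, vderiv T v t w & w + B (u t) = f t}].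

Lemma vacN v : vac T v -> vac T (fun t => - v t).
Proof.
move=> acv e e0; have [d d0 Hd] := acv e e0; exists d => // N a b ab dis sd.
under eq_bigr do rewrite -opprD normrN.
exact: Hd.
Qed.

Lemma wave_solutionB u1 v1 f1 u2 v2 f2 :
  wave_solution u1 v1 f1 -> wave_solution u2 v2 f2 ->
  wave_solution (fun t => u1 t - u2 t) (fun t => v1 t - v2 t) (fun t => f1 t - f2 t).
Proof.
move=> [du1 ac1 eq1] [du2 ac2 eq2]; split.
- by move=> t tT; apply: vderivB; [exact: du1|exact: du2].
- by apply: vacD => //; exact: vacN.
- apply: filterS2 eq1 eq2 => t H1 H2 tT.
  have [w1 dw1 e1] := H1 tT; have [w2 dw2 e2] := H2 tT.
  exists (w1 - w2); first exact: vderivB.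
  by rewrite (pos_opB _ _ BM) -e1 -e2 opprD addrACA.
Qed.

(** The potential energy may degenerate, so [u] is controlled through its velocity: with [D] the
    energy bound on [|v|^2], [|u t| <= |u 0| + T sqrt D], hence [|u t|^2 <= 2 |u 0|^2 + 2 T^2 D]. *)
Lemma wave_solution_estimate u v f (I : R) :
  wave_solution u v f -> vmeas f ->
  mu.-integrable `[0, T] (fun t => (`|f t| ^+ 2)%:E) ->
  (\int[mu]_(t in `[0, T]) (`|f t| ^+ 2) <= I)%R ->
  forall t, 0 <= t <= T ->
    `|u t| ^+ 2 + `|v t| ^+ 2 <= 2 * `|u 0| ^+ 2 +
      (2 * T ^+ 2 + 1) * (2 * (`|v 0| ^+ 2 + M * `|u 0| ^+ 2) + 4 * T * I).
Proof.
move=> [du acv ae_eq] mf intf leI.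
have mG : measurable_fun [set: Rm] (fun t => `|f t| ^+ 2).
  by apply: measurable_funX; exact: vmeas_norm.
pose D := 2 * (`|v 0| ^+ 2 + M * `|u 0| ^+ 2) + 4 * T * I.
have vD t : 0 <= t <= T -> `|v t| ^+ 2 <= D.
  move=> tT.
  have aeG : {ae mu, forall t : Rm, 0 <= t <= T -> `|f t| ^+ 2 <= `|f t| ^+ 2}.
    by apply: aeW.
  have := energy_estimate T_gt0 M_ge0 BM du acv ae_eq mG (fun=> sqr_ge0 _) intf aeG tT.
  have B0 : dot (B (u 0)) (u 0) <= M * `|u 0| ^+ 2.
    apply: le_trans (dot_le _ _) _; rewrite expr2 mulrA ler_wpM2r ?normr_ge0//.
    exact: (pos_op_bound BM).
  have Bt : 0 <= dot (B (u t)) (u t) by exact: (pos_op_ge0 BM).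
  rewrite /energy -!l2_norm_sqr => est.
  have : 4 * T * \int[mu]_(t in `[0, T]) (`|f t| ^+ 2) <= 4 * T * I.
    by rewrite ler_wpM2l// mulr_ge0// ltW.
  rewrite /D; move: est B0 Bt.
  move: (dot _ _) (dot _ _) (Rintegral _ _ _) => b0 bt S; lra.
have T0T : 0 <= (0:R) <= T by rewrite lexx ltW.
have D0 : 0 <= D by apply: le_trans (vD 0 T0T); exact: sqr_ge0.
have vsD t : 0 <= t <= T -> `|v t| <= Num.sqrt D.
  move=> tT; rewrite -[X in X <= _]ger0_norm ?normr_ge0// -sqrtr_sqr ler_sqrt//.
  exact: vD.
move=> t tT; have [t0 tT'] := andP tT.
have ut : `|u t| <= `|u 0| + Num.sqrt D * T.
  have := vderiv_lipschitz du vsD (lexx 0) t0 tT'; rewrite subr0 => lip.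
  have : Num.sqrt D * t <= Num.sqrt D * T by rewrite ler_wpM2l ?sqrtr_ge0.
  have := lerB_dist (u t) (u 0); move: lip.
  move: `|u t - u 0| `|u t| `|u 0| (Num.sqrt D * t) (Num.sqrt D * T) => a b c d e; lra.
have : `|u t| ^+ 2 <= 2 * `|u 0| ^+ 2 + 2 * (D * T ^+ 2).
  apply: (@le_trans _ _ ((`|u 0| + Num.sqrt D * T) ^+ 2)).
    by rewrite ler_pXn2r// nnegrE ?normr_ge0// (le_trans _ ut).
  have -> : D * T ^+ 2 = (Num.sqrt D * T) ^+ 2 by rewrite exprMn sqr_sqrtr.
  move: `|u 0| (Num.sqrt D * T) => a b.
  by rewrite -subr_ge0 (_ : _ - _ = (a - b) ^+ 2) ?sqr_ge0//; ring.
have := vD t tT; rewrite -/D.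
move: D {vD D0 vsD ut} => D; move: (`|u t| ^+ 2) (`|v t| ^+ 2) (`|u 0| ^+ 2) => a b c.
lra.
Qed.

End WaveEquation.

Section L2Data.
Variables (R : realType) (K : countType) (T : R).
Notation J := (K * bool)%type.
Notation mu := (@lebesgue_measure R).
Notation Rm := (measurableTypeR R).

Lemma L2norm_fin (f : R -> K -> R[i]) : in_L2 T f ->
  exists2 r : R, 0 <= r & L2norm T f = r%:E.
Proof.
move=> [_ _]; have : (0 <= L2norm T f)%E by exact: poweR_ge0.
by case: (L2norm T f) => [r r0 _|//|//]; exists r.
Qed.

Lemma L2_data_bound (F : R -> l2 R J) (N : set Rm) (f : R -> K -> R[i]) (r : R) :
  vmeas F -> measurable N -> mu N = 0%E ->
  (forall t, 0 <= t <= T -> ~ N t -> (`|F t|)%:E = l2norm (f t)) ->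
  (L2norm T f <= r%:E)%E ->
  mu.-integrable `[0, T] (fun t => (`|F t| ^+ 2)%:E) /\
  (\int[mu]_(t in `[0, T]) (`|F t| ^+ 2) <= r ^+ 2)%R.
Proof.
move=> mF mN N0 FE fr.
have mG : measurable_fun [set: Rm] (fun t => `|F t| ^+ 2).
  by apply: measurable_funX; exact: vmeas_norm.
have mGE (D : set Rm) : measurable D -> measurable_fun D (fun t : Rm => (`|F t| ^+ 2)%:E).
  by move=> mD; apply/measurable_EFinP; exact: measurable_funS mG.
have le_r : (\int[mu]_(t in `[0%R, T]) (`|F t| ^+ 2)%:E <= (r ^+ 2)%:E)%E.
  apply: (@le_trans _ _ (L2norm T f ^+ 2)%E).
    rewrite L2norm_sqr; apply: (ge0_ae_integral_le (measurable_itvD _) mN N0).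
    - by apply: mGE; exact: measurable_itvD.
    - by move=> t _; rewrite lee_fin sqr_ge0.
    - by move=> t _; rewrite expe2 mule_ge0// l2norm_ge0.
    - by move=> t; rewrite /= in_itv => tT Nt; rewrite -FE// EFin_expe.
  have L0 : (0 <= L2norm T f)%E by exact: poweR_ge0.
  move: L0 fr; case: (L2norm T f) => [s|//|//]; rewrite !lee_fin => s0 sr.
  by rewrite -expr2 ler_pXn2r// nnegrE (le_trans s0).
have int_lty : (\int[mu]_(t in `[0%R, T]) (`|F t| ^+ 2)%:E < +oo)%E.
  exact: le_lt_trans le_r (ltry _).
have int_ge0 : (0 <= \int[mu]_(t in `[0%R, T]) (`|F t| ^+ 2)%:E)%E.
  by apply: integral_ge0 => t _; rewrite lee_fin sqr_ge0.
split; last by rewrite -lee_fin /Rintegral fineK// ge0_fin_numE.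
apply/integrableP; split; first by apply: mGE; exact: measurable_itvD.
under eq_integral do rewrite gee0_abs ?lee_fin ?sqr_ge0//.
exact: int_lty.
Qed.

Lemma vintegrable_of_sqr (F : R -> l2 R J) : vmeas F ->
  mu.-integrable `[0, T] (fun t => (`|F t| ^+ 2)%:E) -> vintegrable `[0, T] F.
Proof.
move=> mF intF; apply: (@vintegrable_dom _ _ _ _ (fun t => 1 + `|F t| ^+ 2)).
- exact: measurable_itvD.
- exact: mF.
- have := integrableD (measurable_itvD _) (integrable_cst_itv 0 T 1) intF.
  by apply: eq_integrable => //; exact: measurable_itvD.
- move=> t _; have := sqr_ge0 (`|F t| - 1); have := normr_ge0 (F t).
  move: `|F t| => x; nra.
Qed.

End L2Data.

Section Solutions.
Variables (R : realType) (n : nat) (alpha T h : R) (m : lattice n h -> R).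
Notation K := (lattice n h).
Notation J := (lattice n h * bool)%type.
Notation mu := (@lebesgue_measure R).
Notation Rm := (measurableTypeR R).
Variable B : l2 R J -> l2 R J.
Hypothesis T_gt0 : 0 < T.
Hypothesis BE : forall u : K -> R[i], in_l2 u -> forall p, B (emb u) p =
  part (fun x => (h `^ (- (2 * alpha)))%:C * fraclap alpha u x + (m x)%:C * u x) p.

Lemma ae_notin (N : set Rm) : measurable N -> mu N = 0%E -> {ae mu, forall t : Rm, ~ N t}.
Proof. by move=> mN N0; exists N; split=> // t /= /contrapT. Qed.

Lemma wave_of_solution f u0 u1 u du (F : R -> l2 R J) (N : set Rm) :
  is_solution alpha T m f u0 u1 u du -> (forall t, t \in `[0, T] -> in_l2 (f t)) ->
  measurable N -> mu N = 0%E ->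
  (forall t, 0 <= t <= T -> ~ N t -> F t = emb (f t)) ->
  wave_solution T B (fun t => emb (u t)) (fun t => emb (du t)) F.
Proof.
move=> [[l2u deru _] ac _ _ ae_eq] f2 mN N0 FE.
have u2 t : 0 <= t <= T -> in_l2 (u t) by move=> tT; have [] := l2u t _; rewrite ?in_itv.
have du2 t : 0 <= t <= T -> in_l2 (du t) by move=> tT; have [] := l2u t _; rewrite ?in_itv.
split.
- move=> t tT; apply/(l2_derivativeP u2 (du2 t tT) tT).
  by apply: deru; rewrite in_itv.
- exact/l2_absolutely_continuousP.
- apply: filterS2 ae_eq (ae_notin mN N0) => t H Nt tT.
  have tT' : 0 <= t <= T by case/andP: tT => /ltW -> ->.
  have [|ddu [ddu2 der eqt]] := H _; first by rewrite in_itv.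
  exists (emb ddu); first exact/(l2_derivativeP du2 ddu2 tT').
  have ft2 : in_l2 (f t) by apply: f2; rewrite in_itv.
  rewrite FE//; apply: l2P => p; rewrite l2D (BE (u2 t tT')) !embE// -partD.
  by congr part; apply/funext => x; rewrite addrA eqt.
Qed.

Lemma solution_of_wave f u0 u1 (U V F : R -> l2 R J) (N : set Rm) :
  vcont V -> vac T V -> U 0 = emb u0 -> V 0 = emb u1 -> in_l2 u0 -> in_l2 u1 ->
  (forall t, 0 <= t <= T -> vderiv T U t (V t)) ->
  {ae mu, forall t : Rm, 0 <= t <= T -> vderiv T V t (F t - B (U t))} ->
  (forall t, t \in `[0, T] -> in_l2 (f t)) -> measurable N -> mu N = 0%E ->
  (forall t, 0 <= t <= T -> ~ N t -> F t = emb (f t)) ->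
  is_solution alpha T m f u0 u1 (fun t => unemb (U t)) (fun t => unemb (V t)).
Proof.
move=> cV acV U0 V0 u02 u12 dU ae_eq f2 mN N0 FE.
have embK (W : R -> l2 R J) : (fun t => emb (unemb (W t))) = W.
  by apply/funext => t; rewrite emb_unemb.
have in2 (W : R -> l2 R J) t : in_l2 (unemb (W t)) by exact: in_l2_unemb.
split.
- split=> [//|t|].
    rewrite in_itv => tT; apply/(l2_derivativeP (fun s _ => in2 U s) (in2 V t) tT).
    by rewrite embK emb_unemb; exact: dU.
  exact: l2_continuous_of_vcont.
- by apply/l2_absolutely_continuousP => [s _|]; [exact: in2|rewrite embK].
- by rewrite U0 unemb_emb.
- by rewrite V0 unemb_emb.
- apply: filterS2 ae_eq (ae_notin mN N0) => t H Nt.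
  rewrite in_itv /= => /andP[t0 tT]; have tT' : 0 <= t <= T by rewrite ltW.
  exists (unemb (F t - B (U t))); split; first exact: in_l2_unemb.
    apply/(l2_derivativeP (fun s _ => in2 V s) (in_l2_unemb _) tT').
    by rewrite embK emb_unemb; exact: H.
  have ft2 : in_l2 (f t) by apply: f2; rewrite in_itv.
  apply/funeqP; apply: part_inj => p; under eq_fun do rewrite -addrA.
  by rewrite partD -(BE (in2 U t)) -part_unemb emb_unemb l2B subrK FE// embE.
Qed.

End Solutions.

(** * Existence, uniqueness and continuous dependence *)

Section Cauchy.
Variables (R : realType) (n : nat) (alpha T h : R) (m : lattice n h -> R).
Notation K := (lattice n h).
Notation J := (lattice n h * bool)%type.
Hypotheses (alpha_gt0 : 0 < alpha) (T_gt0 : 0 < T) (h_gt0 : 0 < h).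
Hypotheses (m_ge0 : forall x, 0 <= m x) (m_bounded : (linfnorm m < +oo)%E).

Definition estimate_rhs (x y r : R) : R := 2 * x ^+ 2 +
  (2 * T ^+ 2 + 1) * (2 * (y ^+ 2 + wave_bound alpha m * x ^+ 2) + 4 * T * r ^+ 2).

Let M_ge0 : 0 <= wave_bound alpha m.
Proof. exact: wave_bound_ge0. Qed.

Lemma solution_estimate u0 u1 f u du r :
  in_L2 T f -> is_solution alpha T m f u0 u1 u du -> (L2norm T f <= r%:E)%E ->
  forall t, 0 <= t <= T ->
    `|emb (u t)| ^+ 2 + `|emb (du t)| ^+ 2 <= estimate_rhs `|emb u0| `|emb u1| r.
Proof.
move=> fL sol fr t tT.
have [B BM BE] := wave_op_exists alpha_gt0 h_gt0 m_ge0 m_bounded.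
have [F [N [mF mN N0 FE]]] := in_L2_representative fL.
have f2 t' : t' \in `[0, T] -> in_l2 (f t') by case: fL => f2 _ _; exact: f2.
have wave := wave_of_solution BE sol f2 mN N0 FE.
have [|intF leF] := L2_data_bound mF mN N0 _ fr.
  by move=> s sT Ns; rewrite FE// l2normE//; apply: f2; rewrite in_itv.
have := wave_solution_estimate T_gt0 M_ge0 BM wave mF intF leF tT.
by case: sol => _ _ -> -> _.
Qed.

(** The difference solves the equation with source [g - f], represented by the difference of the two
    measurable representatives off the union of their null sets. *)
Lemma solution_difference u0 u1 f u du v0 v1 g v dv r :
  in_L2 T f -> is_solution alpha T m f u0 u1 u du ->
  in_L2 T g -> is_solution alpha T m g v0 v1 v dv ->
  (L2norm T (fun t x => g t x - f t x)%R <= r%:E)%E ->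
  forall t, 0 <= t <= T ->
    `|emb (v t) - emb (u t)| ^+ 2 + `|emb (dv t) - emb (du t)| ^+ 2 <=
    estimate_rhs `|emb v0 - emb u0| `|emb v1 - emb u1| r.
Proof.
move=> fL solu gL solv fgr t tT.
have [B BM BE] := wave_op_exists alpha_gt0 h_gt0 m_ge0 m_bounded.
have [F [N [mF mN N0 FE]]] := in_L2_representative fL.
have [G [N' [mG mN' N'0 GE]]] := in_L2_representative gL.
have f2 t' : t' \in `[0, T] -> in_l2 (f t') by case: fL => f2 _ _; exact: f2.
have g2 t' : t' \in `[0, T] -> in_l2 (g t') by case: gL => g2 _ _; exact: g2.
have wave := wave_solutionB BM (wave_of_solution BE solv g2 mN' N'0 GE)
  (wave_of_solution BE solu f2 mN N0 FE).
have mNN : measurable (N `|` N') by exact: measurableU.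
have [||intF leF] := L2_data_bound (vmeasB mG mF) mNN _ _ fgr.
- exact: null_set_setU.
- move=> s sT /not_orP[Ns N's]; rewrite FE// GE// l2normB//.
    by apply: g2; rewrite in_itv.
  by apply: f2; rewrite in_itv.
have := wave_solution_estimate T_gt0 M_ge0 BM wave (vmeasB mG mF) intF leF tT.
by case: solu => _ _ -> -> _; case: solv => _ _ -> -> _.
Qed.

Lemma solution_existence u0 u1 f : in_l2 u0 -> in_l2 u1 -> in_L2 T f ->
  exists u du, is_solution alpha T m f u0 u1 u du.
Proof.
move=> u02 u12 fL.
have [B BM BE] := wave_op_exists alpha_gt0 h_gt0 m_ge0 m_bounded.
have [F [N [mF mN N0 FE]]] := in_L2_representative fL.
have f2 t' : t' \in `[0, T] -> in_l2 (f t') by case: fL => f2 _ _; exact: f2.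
have [r r0 fr] := L2norm_fin fL.
have FfE s : 0 <= s <= T -> ~ N s -> (`|F s|)%:E = l2norm (f s).
  by move=> sT Ns; rewrite FE// l2normE//; apply: f2; rewrite in_itv.
have le_fr : (L2norm T f <= r%:E)%E by rewrite fr.
have [intF _] := L2_data_bound mF mN N0 FfE le_fr.
have [U [V [U0 V0 dU [cV acV] ae_eq]]] :=
  wave_existence (ltW T_gt0) (emb u0) (emb u1) M_ge0 BM (vintegrable_of_sqr mF intF).
exists (fun t => unemb (U t)), (fun t => unemb (V t)).
exact: (solution_of_wave BE cV acV U0 V0 u02 u12 dU ae_eq f2 mN N0 FE).
Qed.

Lemma emb_inj (u v : K -> R[i]) : in_l2 u -> in_l2 v -> emb u = emb v -> u = v.
Proof. by move=> u2 v2 uv; rewrite -(unemb_emb u2) uv unemb_emb. Qed.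

Lemma solution_in_l2 u0 u1 f u du : is_solution alpha T m f u0 u1 u du ->
  forall t, 0 <= t <= T -> in_l2 (u t) /\ in_l2 (du t).
Proof. by case=> [[H _ _] _ _ _ _] t tT; apply: H; rewrite in_itv. Qed.

Lemma L2norm_subrr (f : R -> K -> R[i]) : L2norm T (fun t x => f t x - f t x)%R = 0%E.
Proof.
rewrite /L2norm integral0_eq ?poweR0r ?invr_neq0// => t _.
have -> : (fun x => f t x - f t x) = (fun _ => 0) by apply/funext => x; rewrite subrr.
rewrite (@l2norm_emb _ _ _ 0) ?normr0 ?expe2 ?mule0// => p.
by rewrite l2_0 /part; case: p.2.
Qed.

Lemma solution_unique u0 u1 f u du v dv : in_L2 T f ->
  is_solution alpha T m f u0 u1 u du -> is_solution alpha T m f u0 u1 v dv ->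
  forall t, 0 <= t <= T -> v t = u t /\ dv t = du t.
Proof.
move=> fL solu solv t tT.
have le0 : (L2norm T (fun t x => f t x - f t x)%R <= 0%:E)%E by rewrite L2norm_subrr.
have := solution_difference fL solu fL solv le0 tT.
rewrite /estimate_rhs !subrr normr0 expr0n/= !mulr0 !addr0 !mulr0 addr0.
have [u2 du2] := solution_in_l2 solu tT; have [v2 dv2] := solution_in_l2 solv tT.
have sq0 (w : l2 R J) (a : R) : `|w| ^+ 2 + a ^+ 2 <= 0 -> w = 0.
  move=> wa; apply/eqP; rewrite -normr_eq0 -sqrf_eq0 eq_le sqr_ge0 andbT.
  by apply: le_trans wa; rewrite lerDl sqr_ge0.
move=> H; split; apply: emb_inj => //; apply/eqP; rewrite -subr_eq0; apply/eqP.
  exact: sq0 H.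
by apply: (@sq0 _ `|emb (v t) - emb (u t)|); rewrite addrC.
Qed.

Lemma cauchy_existence_uniqueness u0 u1 f : in_l2 u0 -> in_l2 u1 -> in_L2 T f ->
  existence_uniqueness alpha T m f u0 u1.
Proof.
move=> u02 u12 fL; have [u [du sol]] := solution_existence u02 u12 fL.
exists u, du; split=> // [t|v dv solv t]; rewrite in_itv/= => tT.
  exact: (solution_in_l2 sol tT).
exact: (solution_unique fL sol solv tT).
Qed.

Lemma cauchy_continuous_dependence : continuous_dependence alpha T m.
Proof.
move=> u0 u1 f u du u02 u12 fL solu e e0.
(* The bound is homogeneous of degree two in the three data; [k] is its value at ones, and [d] is
   chosen with [k d^2 = e^2 / 4]. *)
pose k := 2 + (2 * T ^+ 2 + 1) * (2 + 2 * wave_bound alpha m + 4 * T).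
have k0 : 0 < k.
  have T2 : 0 <= 2 * T ^+ 2 + 1 by rewrite addr_ge0// mulr_ge0// sqr_ge0.
  by rewrite ltr_pwDl// mulr_ge0// !addr_ge0// mulr_ge0// ltW.
have rhsE d : estimate_rhs d d d = k * d ^+ 2.
  by rewrite /estimate_rhs /k; ring.
pose d := e / (2 * Num.sqrt k).
have sk0 : 0 < Num.sqrt k by rewrite sqrtr_gt0.
have d0 : 0 < d by rewrite divr_gt0// mulr_gt0.
have kd : k * d ^+ 2 < e ^+ 2.
  have -> : k * d ^+ 2 = e ^+ 2 / 4.
    by rewrite -[in k * _](sqr_sqrtr (ltW k0)) /d; field; rewrite gt_eqF.
  by have := exprn_gt0 2 e0; lra.
exists d => // v0 v1 g v dv v02 v12 gL solv.
rewrite !l2normB// !lte_fin => d0' d1' dgf t; rewrite in_itv/= => tT.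
have := solution_difference fL solu gL solv (ltW dgf) tT.
have [u2 du2] := solution_in_l2 solu tT; have [v2 dv2] := solution_in_l2 solv tT.
rewrite !l2normB// !lte_fin => H.
have le_rhs : estimate_rhs `|emb v0 - emb u0| `|emb v1 - emb u1| d <= estimate_rhs d d d.
  have T2 : 0 <= 2 * T ^+ 2 + 1 by rewrite addr_ge0// mulr_ge0// sqr_ge0.
  have s0 : `|emb v0 - emb u0| ^+ 2 <= d ^+ 2.
    by rewrite ler_pXn2r ?nnegrE ?normr_ge0 ?ltW.
  have s1 : `|emb v1 - emb u1| ^+ 2 <= d ^+ 2.
    by rewrite ler_pXn2r ?nnegrE ?normr_ge0 ?ltW.
  rewrite /estimate_rhs lerD ?ler_wpM2l ?lerD2r// ler_wpM2l// lerD// ler_wpM2l//.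
have lt_e (a b : R) : 0 <= a -> a ^+ 2 + b ^+ 2 <= estimate_rhs d d d -> a < e.
  move=> a0 ab; rewrite -(ltr_pXn2r (isT : 0 < 2)%N) ?nnegrE ?(ltW e0)//.
  apply: le_lt_trans kd; rewrite -rhsE; apply: le_trans ab.
  by rewrite lerDl sqr_ge0.
have {}H := le_trans H le_rhs; split; first exact: lt_e H.
by apply: (lt_e _ `|emb (v t) - emb (u t)|) => //; rewrite addrC.
Qed.

Lemma cauchy_well_posed : well_posed alpha T m.
Proof.
by split; [exact: cauchy_existence_uniqueness|exact: cauchy_continuous_dependence].
Qed.

End Cauchy.

(** The cap [h0] is what allows a constant uniform in [h]: at [t = 0] with [m], [u1] and [f] zero
    the estimate reads [|u0|^2 <= C h^(-2 alpha) |u0|^2], which no fixed [C] satisfies for all large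
    [h]. *)
Theorem theorem1p2 (R : realType) (n : nat) (alpha T : R)
    (n_gt0 : (0 < n)%N) (alpha_gt0 : 0 < alpha) (alpha_lt1 : alpha < 1)
    (T_gt0 : 0 < T) :
  (forall (h : R) (m : lattice n h -> R),
     0 < h -> (forall x, 0 <= m x) -> (linfnorm m < +oo)%E ->
     well_posed alpha T m) /\
  (forall h0 : R, 0 < h0 -> exists2 C : R, 0 < C &
     forall (h : R) (m : lattice n h -> R)
            (u0 u1 : lattice n h -> R[i]) (f u du : R -> lattice n h -> R[i]),
       0 < h -> h <= h0 -> (forall x, 0 <= m x) -> (linfnorm m < +oo)%E ->
       in_l2 u0 -> in_l2 u1 -> in_L2 T f ->
       is_solution alpha T m f u0 u1 u du ->
       forall t : R, t \in `[0, T] ->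
       (l2norm (u t) ^+ 2 + l2norm (du t) ^+ 2 <=
        C%:E * (1 + linfnorm m) *
        (((h `^ (- (2 * alpha)))%:E + linfnorm m) * l2norm u0 ^+ 2
         + l2norm u1 ^+ 2 + L2norm T f ^+ 2))%E).
Proof.
split=> [h m h0 m0 mb|h0 h0_gt0]; first exact: cauchy_well_posed.
pose b0 : R := h0 `^ (- (2 * alpha)).
pose a : R := (4 * n%:R) `^ alpha.
pose c : R := 2 * T ^+ 2 + 1.
have b0_gt0 : 0 < b0 by exact: powR_gt0.
have a_ge0 : 0 <= a by exact: powR_ge0.
have c_ge0 : 0 <= c by rewrite addr_ge0// mulr_ge0// sqr_ge0.
(* [2 / b0] pays for the bare [2 |u0|^2], because [h^(-2 alpha) >= b0]; the other summand compares
   the velocity bound, which carries the factor [(4 n)^alpha], with the bracket. *)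
exists (2 / b0 + c * (2 * (a + 1) + 2 + 4 * T)).
  rewrite ltr_pwDl ?divr_gt0// mulr_ge0// !addr_ge0// mulr_ge0// ?addr_ge0//.
  exact: ltW.
move=> h m u0 u1 f u du h_gt0 le_h m0 mb u02 u12 fL sol t; rewrite in_itv/= => tT.
have [r r_ge0 fr] := L2norm_fin fL.
have [u2 du2] := solution_in_l2 sol tT.
have est := solution_estimate alpha_gt0 T_gt0 h_gt0 m0 mb fL sol.
have {}est := est r _ t tT; rewrite fr lexx in est; have {}est := est isT.
pose b : R := h `^ (- (2 * alpha)).
have le_b : b0 <= b.
  rewrite /b0 /b !powRN lef_pV2 ?posrE ?powR_gt0//.
  by apply: ge0_ler_powR => //; rewrite ?nnegrE ?mulr_ge0// ltW.
have mu_ge0 : 0 <= fine (linfnorm m).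
  exact: le_trans (m0 (lattice_point h 0)) (le_linfnorm m0 mb _).
rewrite fr (linfnorm_fin mb) !l2normE// -!(EFinM, EFinD) lee_fin -!expr2.
apply: le_trans est _.
rewrite /estimate_rhs /wave_bound -/a -/b -/c.
have := sqr_ge0 r; have := sqr_ge0 `|emb u1|; have := sqr_ge0 `|emb u0|.
move: (fine _) mu_ge0 (`|emb u0| ^+ 2) (`|emb u1| ^+ 2) (r ^+ 2) => mu mu_ge0 x y z.
move=> x0 y0 z0; set W := (b + mu) * x + y + z.
have b_ge0 : 0 <= b by exact: powR_ge0.
have T0 : 0 <= T by exact: ltW.
have bx0 : 0 <= b * x by exact: mulr_ge0.
have mux0 : 0 <= mu * x by exact: mulr_ge0.
have W_ge : b * x <= W by rewrite /W; lra.
have W0 : 0 <= W by exact: le_trans bx0 W_ge.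
have x_le : 2 * x <= 2 / b0 * W.
  apply: (@le_trans _ _ (2 / b0 * (b * x))); last by rewrite ler_wpM2l// divr_ge0// ltW.
  have -> : 2 / b0 * (b * x) = 2 * x * (b / b0) by ring.
  by rewrite ler_peMr ?mulr_ge0// ler_pdivlMr// mul1r.
have rest_le : 2 * (y + (b * a + mu) * x) + 4 * T * z <= (2 * (a + 1) + 2 + 4 * T) * W.
  have abx0 : 0 <= a * (mu * x) by exact: mulr_ge0.
  have aW : 0 <= a * (y + z) by rewrite mulr_ge0// addr_ge0.
  have TW : 0 <= T * (b * x + mu * x + y) by rewrite mulr_ge0// !addr_ge0.
  rewrite /W; lra.
have C0 : 0 <= 2 / b0 + c * (2 * (a + 1) + 2 + 4 * T).
  by rewrite addr_ge0 ?divr_ge0 ?(ltW b0_gt0)// mulr_ge0// !addr_ge0// mulr_ge0// addr_ge0.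
apply: (@le_trans _ _ ((2 / b0 + c * (2 * (a + 1) + 2 + 4 * T)) * W)).
  by rewrite [leRHS]mulrDl lerD// -[leRHS]mulrA ler_wpM2l.
by rewrite ler_wpM2r// ler_peMr// lerDl.
Qed.
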